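(* Let $Z$ have true covariance parameter with components $\sigma_{01}^2,\sigma_{02}^2,\rho_0,\theta_0$, and let $$J=[a_\theta,b_\theta]\times[a_{\sigma_1},b_{\sigma_1}]\times[a_{\sigma_2},b_{\sigma_2}]\times[a_\rho,b_\rho]$$ (for the parameters $\theta,\sigma_1^2,\sigma_2^2,\rho$ in this order), where $0<a_\theta\le\theta_0\le b_\theta<\infty$, $0<a_{\sigma_k}\le\sigma_{0k}^2\le b_{\sigma_k}<\infty$ for $k=1,2$, and $-1<a_\rho\le\rho_0\le b_\rho<1$. Let $\widehat\psi=(\hat\theta,\hat\sigma_1^2,\hat\sigma_2^2,\hat\rho)\in J$ (depending on $n$) be a solution of $l_n(\widehat\psi)=\min_{\psi\in J}l_n(\psi)$. As $n\to\infty$: (1) If $a_{\sigma_k}=b_{\sigma_k}=\sigma_{0k}^2=\hat\sigma_k^2$ for $k=1,2$, $a_\rho=b_\rho=\rho_0=\hat\rho$ and $a_\theta<\theta_0<b_\theta$, then $$\sqrt n(\hat\theta-\theta_0)\xrightarrow{\mathcal D}\mathcal N(0,\theta_0^2).$$ (2) If $a_{\sigma_k}=b_{\sigma_k}=\sigma_{0k}^2=\hat\sigma_k^2$ for $k=1,2$, $a_\rho<\rho_0<b_\rho$ and $a_\theta<\theta_0<b_\theta$, then $$\sqrt n\begin{pmatrix}\hat\theta-\theta_0\\ \hat\rho-\rho_0\end{pmatrix}\xrightarrow{\mathcal D}\mathcal N(0,\Sigma_{\theta\rho}),\qquad \Sigma_{\theta\rho}=\begin{pmatrix}\theta_0^2(1+\rho_0^2)&\theta_0\rho_0(1-\rho_0^2)\\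 \theta_0\rho_0(1-\rho_0^2)&(\rho_0^2-1)^2\end{pmatrix}.$$ (3) If $a_{\sigma_k}<\sigma_{0k}^2<b_{\sigma_k}$ for $k=1,2$, $a_\rho<\rho_0<b_\rho$ and $a_\theta<\theta_0<b_\theta$, then $$\sqrt n\begin{pmatrix}\hat\sigma_1^2\hat\theta-\sigma_{01}^2\theta_0\\ \hat\sigma_2^2\hat\theta-\sigma_{02}^2\theta_0\\ \hat\rho-\rho_0\end{pmatrix}\xrightarrow{\mathcal D}\mathcal N(0,\Sigma_f),$$ where $$\Sigma_f=\begin{pmatrix}2(\theta_0\sigma_{01}^2)^2&2(\theta_0\rho_0\sigma_{01}\sigma_{02})^2&\theta_0\rho_0\sigma_{01}^2(1-\rho_0^2)\\ 2(\theta_0\rho_0\sigma_{01}\sigma_{02})^2&2(\theta_0\sigma_{02}^2)^2&\theta_0\rho_0\sigma_{02}^2(1-\rho_0^2)\\ \theta_0\rho_0\sigma_{01}^2(1-\rho_0^2)&\theta_0\rho_0\sigma_{02}^2(1-\rho_0^2)&(\rho_0^2-1)^2\end{pmatrix}.$$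
   Context: For a parameter $\psi$ with components $\sigma_1^2,\sigma_2^2>0$, $|\rho|<1$, $\theta>0$, let $P_\psi$ be the law of the stationary zero-mean bivariate Gaussian process $Z(s)=(Z_1(s),Z_2(s))^\top$, $s\in[0,1]$, with $$\mathrm{Cov}_\psi(Z_i(s),Z_j(t))=\sigma_i\sigma_j\bigl(\rho+(1-\rho)\mathbf 1_{i=j}\bigr)e^{-\theta|s-t|},\qquad i,j\in\{1,2\}.$$ The process $Z$ has law $P_{\psi_0}$ for a fixed true parameter $\psi_0$ with components $\sigma_{01}^2,\sigma_{02}^2,\rho_0,\theta_0$ (with $\sigma_{01},\sigma_{02}>0$); convergence in distribution $\xrightarrow{\mathcal D}$ is under $P_{\psi_0}$. For each $n$ it is observed at points $0\le s_1<\dots<s_n\le 1$ (the points may depend on $n$), which become dense in $[0,1]$ as $n\to\infty$, i.e. $\min_{1\le i\le n}|t-s_i|\to 0$ for every $t\in[0,1]$. The observation vector is $Z_n=(Z_{1,n}^\top,Z_{2,n}^\top)^\top$ with $Z_{k,n}=(Z_k(s_1),\dots,Z_k(s_n))^\top$, and the negative log-likelihood is $$l_n(\psi)=2n\log(2\pi)+\log|\Sigma(\psi)|+Z_n^\top\Sigma(\psi)^{-1}Z_n,\qquad \Sigma(\psi)=A\otimes R,$$ with $\otimes$ the Kronecker product, $A=\begin{pmatrix}\sigma_1^2&\sigma_1\sigma_2\rho\\ \sigma_1\sigma_2\rho&\sigma_2^2\end{pmatrix}$ and $R=[e^{-\theta|s_m-s_l|}]_{1\le m,l\le n}$. An equality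 $a=b$ of interval endpoints means that the corresponding parameter is known and fixed at its true value. *)

(* Defs.v *)
From HB Require Import structures.
From mathcomp Require Import all_boot all_order all_algebra.
From mathcomp Require Export mxtens.
From mathcomp Require Import all_classical all_reals all_analysis.

Set Implicit Arguments.
Unset Strict Implicit.
Unset Printing Implicit Defensive.

Import Order.TTheory GRing.Theory Num.Theory.
Import numFieldNormedType.Exports.

Local Open Scope classical_set_scope.
Local Open Scope ring_scope.

Section probability_notions.
Context {R : realType}.

(* [normal_prob m s] takes the standard deviation [s], and [normal_prob m 0]
   is not the Dirac mass at [m]: the variance-0 case is treated separately. *)
Definition gaussian_law (m v : R) (A : set R) : \bar R :=
  if v == 0 then dirac m A else normal_prob m (Num.sqrt v) A.

(* Joint normality: every linear combination is (possibly degenerate) normal. *)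
Definition jointly_gaussian d (T : measurableType d) (P : probability T R)
    (I : finType) (X : I -> {RV P >-> R}) : Prop :=
  forall c : I -> R, exists m v : R, 0 <= v /\
    forall A : set R, measurable A ->
      P ((fun w => \sum_(i : I) c i * X i w) @^-1` A) = gaussian_law m v A.

Definition centered_gaussian_vector d (T : measurableType d)
    (P : probability T R) k (X : 'I_k -> {RV P >-> R}) (S : 'M[R]_k) : Prop :=
  [/\ jointly_gaussian X,
      forall i, ('E_P[X i] = 0)%E
    & forall i j, covariance P (X i) (X j) = (S i j)%:E].

Definition cvg_in_distribution d1 (T1 : measurableType d1)
    (P1 : probability T1 R) d2 (T2 : measurableType d2)
    (P2 : probability T2 R) (E : topologicalType)
    (X : nat -> T1 -> E) (Y : T2 -> E) : Prop :=
  forall f : E -> R, continuous f -> (exists M : R, forall x, `|f x| <= M) ->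
    ('E_P1[f \o X n] @[n --> \oo] --> 'E_P2[f \o Y])%E.

Definition cvg_to_normal d (T : measurableType d) (P : probability T R) k
    (X : nat -> T -> 'cV[R]_k) (S : 'M[R]_k) : Prop :=
  exists (d' : measure_display) (T' : measurableType d')
    (Q : probability T' R) (Y : 'I_k -> {RV Q >-> R}),
    centered_gaussian_vector Y S /\
    cvg_in_distribution P Q X (fun w => \col_i Y i w).

End probability_notions.

Definition col_of {R : realType} k (v : seq R) : 'cV[R]_k := \col_i v`_i.

Definition mx_of_rows {R : realType} k (v : seq (seq R)) : 'M[R]_k :=
  \matrix_(i, j) (nth [::] v i)`_j.

(* [sigma2 psi i] is the variance of the i-th component, i.e. [sigma_i ^ 2];
   the components 1 and 2 have indices 0 and 1 in 'I_2. *)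
Record param (R : realType) := Param {
  theta : R;
  sigma2 : 'I_2 -> R;
  rho : R
}.

Section model.
Context {R : realType}.
Implicit Types psi a b : param R.

Definition sigma psi (i : 'I_2) : R := Num.sqrt (sigma2 psi i).

Definition cov_fun psi (i j : 'I_2) (s t : R) : R :=
  sigma psi i * sigma psi j * (rho psi + (1 - rho psi) * (i == j)%:R)
  * expR (- theta psi * `|s - t|).

(* Only the random variables [Z i s] with [s] in [0, 1] are constrained. *)
Definition has_law d (T : measurableType d) (P : probability T R)
    (Z : 'I_2 -> R -> {RV P >-> R}) psi : Prop :=
  [/\ forall m (t : 'I_m -> R), (forall k, 0 <= t k <= 1) ->
        jointly_gaussian (fun ik : 'I_2 * 'I_m => Z ik.1 (t ik.2)),
      forall i s, 0 <= s <= 1 -> ('E_P[Z i s] = 0)%E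
    & forall i j s t, 0 <= s <= 1 -> 0 <= t <= 1 ->
        covariance P (Z i s) (Z j t) = (cov_fun psi i j s t)%:E].

(* Distances between points of [0, 1] are at most 1, so for n > 0 the seed 1
   does not change the minimum. *)
Definition dense_design (s : forall n, 'I_n -> R) : Prop :=
  [/\ forall n (i : 'I_n), 0 <= s n i <= 1,
      forall n (i j : 'I_n), (i < j)%N -> s n i < s n j
    & forall t : R, 0 <= t <= 1 ->
        \big[Num.min/1]_(i < n) `|t - s n i| @[n --> \oo] --> (0 : R)].

Definition Amx psi : 'M[R]_2 :=
  \matrix_(i, j) if i == j then sigma2 psi i
                 else sigma psi 0 * sigma psi 1 * rho psi.

Definition Rmx psi n (s : 'I_n -> R) : 'M[R]_n :=
  \matrix_(m, l) expR (- theta psi * `|s m - s l|).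

Definition Sigmamx psi n (s : 'I_n -> R) : 'M[R]_(2 * n) :=
  Amx psi *t Rmx psi s.

(* [mxtens_unindex] is the row-major identification of 'I_(2 * n) with
   'I_2 * 'I_n used by [*t]: the first n entries are the Z_1(s_i), the last n
   the Z_2(s_i). *)
Definition obs_vec n (s : 'I_n -> R) (z : 'I_2 -> R -> R) : 'cV[R]_(2 * n) :=
  \col_k z (mxtens_unindex k).1 (s (mxtens_unindex k).2).

Definition negloglik n (s : 'I_n -> R) (z : 'I_2 -> R -> R) psi : R :=
  (2 * n)%:R * ln (2 * pi) + ln (\det (Sigmamx psi s))
  + ((obs_vec s z)^T *m invmx (Sigmamx psi s) *m obs_vec s z) 0 0.

Definition in_box a b psi : Prop :=
  [/\ theta a <= theta psi <= theta b,
      forall i, sigma2 a i <= sigma2 psi i <= sigma2 b i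
    & rho a <= rho psi <= rho b].

Definition is_ml_estimator a b (s : forall n, 'I_n -> R) T
    (Z : T -> 'I_2 -> R -> R) (psihat : nat -> T -> param R) : Prop :=
  forall n w, in_box a b (psihat n w) /\
    forall psi, in_box a b psi ->
      negloglik (s n) (Z w) (psihat n w) <= negloglik (s n) (Z w) psi.

Definition measurable_estimator d (T : measurableType d)
    (psihat : nat -> T -> param R) : Prop :=
  forall n, [/\ measurable_fun setT (fun w => theta (psihat n w)),
    forall i, measurable_fun setT (fun w => sigma2 (psihat n w) i)
    & measurable_fun setT (fun w => rho (psihat n w))].

Definition known T (lo hi x0 : R) (xhat : nat -> T -> R) : Prop :=
  [/\ lo = hi, hi = x0 & forall n w, x0 = xhat n w].

End model.

(* Main.v *)
(* In the coordinates b = theta sigma_1^2, v = theta sigma_2^2 (1 - rho^2) and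
   beta = rho sigma_2 / sigma_1 the likelihood is n (ln b + ln v) plus the quadratic form
   N_11 / b + (N_22 - 2 beta N_12 + beta^2 N_11) / v in the second moments N of the
   innovations, plus a function of theta.  That function and N depend on theta in a Lipschitz
   way with a constant which is bounded in expectation, not of order n.  So, up to O(1) times
   the distance of the parameters, theta may be set to theta_0 inside N, and by strict
   convexity the minimizer is at distance O(1/n) of the explicit parameter which fits the
   second moments at theta_0.  At theta_0 the innovations are Gaussian white noise, and this
   parameter is a smooth function of their empirical second moments, whence the limit law by
   the central limit theorem and linearization.
   Weak convergence is proved with the expectations of cosines of linear forms: on the event
   where a tightness variable Q is at most K, whose complement has probability at most
   E Q / K, bounded continuous functions are uniformly approximated by trigonometric
   polynomials (Bernstein polynomials in the sines of the coordinates). *)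

Require Import Defs.
From mathcomp Require Import all_boot all_order all_algebra.
From mathcomp Require Import all_classical all_reals all_analysis measurable_realfun normal_distribution.
From mathcomp Require Import ring lra.

Set Implicit Arguments.
Unset Strict Implicit.
Unset Printing Implicit Defensive.

Import Order.TTheory GRing.Theory Num.Theory.
Import numFieldNormedType.Exports.

Local Open Scope classical_set_scope.
Local Open Scope ring_scope.

(** * Gaussian integrals *)

Section gauss.
Context {R : realType}.
Notation mu := (@lebesgue_measure R).

(** The likelihood is compared at two points only, the estimator and a fitted point, which has to
    lie in the box. Hence neither consistency nor derivatives of the likelihood occur, and the
    convex gap must be bounded below on the whole box, not just near the truth. The obstacle is the
    design: spacings D may be arbitrarily small, and the factors 1 / (1 - exp(-2 theta D)) then
    explode. Multiplied by theta they behave like 1 / (2 D), free of theta, which is why theta is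
    attached to the variances. What is left of the dependence on theta is bounded by a discrete
    quadratic variation of the path, of bounded mean because the spacings add up to at most 1. On
    the event where the tightness variable is bounded the whole comparison is deterministic, and its
    error O(1/n) is negligible at the scale 1 / sqrt n. Independence enters only as factorization of
    expectations of cosines, deduced from orthogonality inside a linear space of Gaussian variables.
    The limit vectors of the multivariate cases are built on the probability space of the process
    itself. *)

Lemma ge0_integral_normal (m s : R) (f : _ -> \bar R) :
  measurable_fun setT f -> (forall x, 0 <= f x)%E ->
  (\int[normal_prob m s]_x f x = \int[mu]_x (f x * (normal_pdf m s x)%:E))%E.
Proof.
move=> mf f0.
pose g := Radon_Nikodym_SigmaFinite.f (normal_prob m s) mu.
have dom : normal_prob m s `<< mu := normal_prob_dominates m s.
rewrite -(@Radon_Nikodym_SigmaFinite.change_of_variables _ _ _ (normal_prob m s) mu dom)//.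
apply: ae_eq_integral => //.
- apply: emeasurable_funM => //.
  apply: (measurable_int mu).
  exact: Radon_Nikodym_SigmaFinite.f_integrable.
- apply: emeasurable_funM => //.
  by apply/measurable_EFinP; exact: measurable_normal_pdf.
(* The Radon-Nikodym derivative is determined only almost everywhere; it agrees with the density
   because both give the same integral over every measurable set. *)
- apply: ae_eqe_mul2l.
  apply: integral_ae_eq => //.
  + exact: Radon_Nikodym_SigmaFinite.f_integrable.
  + by apply/measurable_EFinP; exact: measurable_normal_pdf.
  + by move=> A _ mA; rewrite -Radon_Nikodym_SigmaFinite.f_integral.
Qed.

Lemma integrable_normal (m s : R) (f : _ -> R) :
  measurable_fun setT f ->
  (mu.-integrable setT (EFin \o (fun x => f x * normal_pdf m s x))) ->
  (normal_prob m s).-integrable setT (EFin \o f).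
Proof.
move=> mf /integrableP[_ fi]; apply/integrableP; split; first exact/measurable_EFinP.
rewrite ge0_integral_normal//; last first.
  by apply: measurableT_comp => //; exact/measurable_EFinP.
apply: le_lt_trans fi; rewrite le_eqVlt; apply/orP; left; apply/eqP.
apply: eq_integral => x _ /=.
by rewrite normrM (ger0_norm (normal_pdf_ge0 _ _ _)) EFinM.
Qed.

Lemma integral_normal (m s : R) (f : _ -> R) :
  measurable_fun setT f ->
  (mu.-integrable setT (EFin \o (fun x => f x * normal_pdf m s x))) ->
  (\int[normal_prob m s]_x f x = \int[mu]_x (f x * normal_pdf m s x))%R.
Proof.
move=> mf fi; rewrite /Rintegral; congr fine.
have mfE : measurable_fun setT (EFin \o f) by exact/measurable_EFinP.
rewrite integralE [RHS]integralE.
rewrite !ge0_integral_normal//; last 2 first.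
- exact: measurable_funeneg.
- exact: measurable_funepos.
congr (_ - _)%E; apply: eq_integral => x _ /=.
- by rewrite !funeposE EFinM maxeMl ?mul0e ?lee_fin ?normal_pdf_ge0.
- by rewrite !funenegE -!EFinN -mulNr EFinM maxeMl ?mul0e ?lee_fin ?normal_pdf_ge0.
Qed.

(** The fundamental theorem of calculus on the intervals from -(n+1) to n+1, and dominated
    convergence. *)
Lemma Rintegral_derive_eq0 (G g : R -> R) :
  (forall x : R, is_derive x 1 G (g x)) -> continuous g ->
  mu.-integrable setT (EFin \o g) ->
  G n%:R @[n --> \oo] --> (0 : R) -> G (- n%:R) @[n --> \oo] --> (0 : R) ->
  (\int[mu]_x g x)%R = 0.
Proof.
move=> dG cg ig G1 G2.
have cG : continuous G.
  by move=> x; apply/differentiable_continuous/derivable1_diffP; have [] := dG x.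
pose D n : set R := `[- n.+1%:R, n.+1%:R]%classic.
have mg : measurable_fun setT g by exact: continuous_measurable_fun.
have E n : (\int[mu]_x ((EFin \o g) \_ (D n)) x = (G n.+1%:R - G (- n.+1%:R))%:E)%E.
  rewrite -integral_mkcond EFinB.
  apply: continuous_FTC2.
  - by rewrite gtrN// ltr0n.
  - exact: continuous_subspaceT.
  - split.
    + by move=> x _; have [] := dG x.
    + exact/cvg_at_right_filter/cG.
    + exact/cvg_at_left_filter/cG.
  - by move=> x _; rewrite derive1E; have [] := dG x.
have H : (\int[mu]_x ((EFin \o g) \_ (D n)) x @[n --> \oo] --> \int[mu]_x (EFin \o g) x)%E.
  have [] // := @dominated_convergence _ _ _ mu setT measurableT
     (fun n => (EFin \o g) \_ (D n)) (EFin \o g) (fun x => `|(g x)%:E|%E).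
  - move=> n; apply/(measurable_restrictT _ _).1 => //.
      exact: measurable_itv.
    by apply: measurable_funTS; exact/measurable_EFinP.
  - exact/measurable_EFinP.
  - apply: aeW => x _.
    apply: cvg_near_cst; near=> n.
    rewrite patchE mem_set// /D/= in_itv/= -ler_norml.
    near: n; exists (Num.trunc `|x|) => //= n /= h.
    rewrite (le_trans (ltW (truncnS_gt _)))// ler_nat ltnS//.
  - exact: integrable_abse.
  - apply: aeW => x n _; rewrite patchE; case: ifPn => // _.
    by rewrite abse0.
rewrite /Rintegral.
have -> : (\int[mu]_x (g x)%:E = 0%:E)%E.
  apply: (cvg_unique _ H) => //.
  rewrite /=; under eq_fun do rewrite E.
  apply: cvg_EFin; first by apply: nearW => n.
  rewrite -[X in _ --> X](subr0 0).
  apply: cvgB; first by move: G1; rewrite -(cvg_shiftS (fun n => G n%:R)).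
  by move: G2; rewrite -(cvg_shiftS (fun n => G (- n%:R))).
by [].
Unshelve. all: by end_near. Qed.

(** * Stein's identity *)

Section stein.
Variables (m s : R).
Hypothesis s_gt0 : 0 < s.
Local Notation pdf := (normal_pdf m s).
(** The square of this weight still leaves the density with the decay exp(-(x - m)^2 / (4 s^2)). In
    [stein] one factor pays for the growth of [p], the other for the factor x - m. *)
Local Notation gw x := (expR ((x - m) ^+ 2 / (8 * s ^+ 2))).

Let s2_gt0 : 0 < s ^+ 2. Proof. by rewrite exprn_gt0. Qed.

Lemma normal_pdf_gt0E x : pdf x = normal_peak s * expR (- (x - m) ^+ 2 / (2 * s ^+ 2)).
Proof. by rewrite normal_pdfE ?gt_eqF// /normal_fun mulr_natl. Qed.

Lemma is_derive_normal_pdf (x : R) : is_derive x 1 pdf (- (x - m) / s ^+ 2 * pdf x).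
Proof.
have -> : pdf = (fun x => normal_peak s * expR (- (x - m) ^+ 2 / (2 * s ^+ 2))).
  by apply/funext => y; rewrite normal_pdf_gt0E.
apply: is_derive_eq; rewrite /GRing.scale/=.
by field; rewrite gt_eqF.
Qed.

Lemma gaussian_decay (f : R -> R) C :
  (forall x, `|f x| <= C * (gw x * gw x)) ->
  forall x, `|f x * pdf x| <= C * normal_peak s * gauss_fun ((x - m) / (2 * s)).
Proof.
move=> fC x; rewrite normrM (ger0_norm (normal_pdf_ge0 _ _ _)).
apply: (le_trans (ler_wpM2r (normal_pdf_ge0 _ _ _) (fC x))).
rewrite normal_pdf_gt0E le_eqVlt; apply/orP; left; apply/eqP.
rewrite /gauss_fun.
transitivity (C * normal_peak s * (gw x * gw x * expR (- (x - m) ^+ 2 / (2 * s ^+ 2)))).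
  by ring.
congr (_ * _); rewrite -!expRD; congr expR.
by field; rewrite gt_eqF.
Qed.

Lemma integrable_gaussian_decay (f : R -> R) C : measurable_fun setT f ->
  (forall x, `|f x| <= C * (gw x * gw x)) ->
  mu.-integrable setT (EFin \o (fun x => f x * pdf x)).
Proof.
move=> mf fC.
have s'0 : s * Num.sqrt 2 != 0 by rewrite mulf_neq0 ?gt_eqF// sqrtr_gt0.
(* Rescales the bound to the normal density of standard deviation s sqrt 2, which is integrable. *)
pose K := C * normal_peak s * (normal_peak (s * Num.sqrt 2))^-1.
apply: (@le_integrable _ _ _ mu setT _ _
          (fun x => (K * normal_pdf m (s * Num.sqrt 2) x)%:E)) => //.
- apply/measurable_EFinP; apply: measurable_funM => //.
  exact: measurable_normal_pdf.
- move=> x _ /=; rewrite lee_fin; apply: (le_trans (gaussian_decay fC x)).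
  apply: le_trans (ler_norm _).
  rewrite normal_pdfE// /K -[leRHS]mulrA le_eqVlt; apply/orP; left; apply/eqP; congr (_ * _).
  rewrite mulKf; last by rewrite gt_eqF// normal_peak_gt0.
  rewrite /normal_fun /gauss_fun; congr expR.
  rewrite [(s * _) ^+ 2]exprMn sqr_sqrtr// -mulr_natr.
  by field; rewrite gt_eqF.
- under eq_fun do rewrite EFinM.
  apply: integrableZl => //.
  exact: integrable_normal_pdf.
Qed.

Lemma cvg_gaussian_decay (f : R -> R) C :
  (forall x, `|f x| <= C * (gw x * gw x)) ->
  (f n%:R * pdf n%:R @[n --> \oo] --> (0 : R)) /\
  (f (- n%:R) * pdf (- n%:R) @[n --> \oo] --> (0 : R)).
Proof.
move=> fC; have H := gaussian_decay fC.
have cn (a b : R) : 0 < a -> gauss_fun ((n%:R + b) / a) @[n --> \oo] --> (0 : R).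
  move=> a0.
  apply: (cvg_comp (fun n : nat => (n%:R + b) / a) gauss_fun); last exact: cvg_gauss_fun.
  apply: (cvg_comp (fun n : nat => n%:R : R) (fun x => (x + b) / a) (@cvgr_idn R)).
  by apply/gt0_cvgMly; [rewrite invr_gt0|exact: cvg_addrr].
have s20 : 0 < 2 * s by rewrite mulr_gt0.
have cn2 b : C * normal_peak s * gauss_fun ((n%:R + b) / (2 * s)) @[n --> \oo] --> (0 : R).
  by rewrite -[X in _ --> X](mulr0 (C * normal_peak s)); apply: cvgMr; exact: cn.
split; apply/norm_cvg0P.
- apply: (squeeze_cvgr _ (cvg_cst 0) (cn2 (- m))).
  by apply: nearW => n; rewrite normr_ge0 H.
- apply: (squeeze_cvgr _ (cvg_cst 0) (cn2 m)).
  apply: nearW => n; rewrite normr_ge0/= (le_trans (H _))//.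
  by rewrite -opprD mulNr /gauss_fun sqrrN.
Qed.

(** Integration by parts: (x - m) p - s^2 p', times the density, is the derivative of -s^2 p times
    the density, which vanishes at both ends. *)
Lemma stein (p p' : R -> R) C :
  (forall x : R, is_derive x 1 p (p' x)) -> continuous p' ->
  (forall x, `|p x| <= C * gw x) -> (forall x, `|p' x| <= C * gw x) ->
  (\int[normal_prob m s]_x ((x - m) * p x) =
   s ^+ 2 * \int[normal_prob m s]_x p' x)%R.
Proof.
move=> dp cp' bp bp'.
have cp : continuous p.
  by move=> x; apply/differentiable_continuous/derivable1_diffP; have [] := dp x.
have C0 : 0 <= C.
  by have := le_trans (normr_ge0 _) (bp 0); rewrite pmulr_lge0 ?expR_gt0.
have gw1 x : 1 <= gw x.
  by rewrite -expR0 ler_expR divr_ge0 ?sqr_ge0// mulr_ge0// ltW.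
have bp2 x : `|p x| <= C * (gw x * gw x).
  apply: (le_trans (bp x)); rewrite ler_wpM2l// ler_peMr ?expR_ge0//.
have bp'2 x : `|p' x| <= C * (gw x * gw x).
  apply: (le_trans (bp' x)); rewrite ler_wpM2l// ler_peMr ?expR_ge0//.
(* From |x - m| <= 1 + (x - m)^2 and u <= exp u at u = (x - m)^2 / (8 s^2). *)
pose C' := C * (1 + 8 * s ^+ 2).
have bxp x : `|(x - m) * p x| <= C' * (gw x * gw x).
  rewrite (_ : C' * _ = (1 + 8 * s ^+ 2) * gw x * (C * gw x)); last by rewrite /C'; ring.
  rewrite normrM; apply: ler_pM => //.
  have h : (x - m) ^+ 2 / (8 * s ^+ 2) <= gw x.
    by apply: le_trans (expR_ge1Dx _); rewrite lerDr.
  rewrite ler_pdivrMr ?mulr_gt0// in h.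
  apply: (@le_trans _ _ (1 + (x - m) ^+ 2)).
    by rewrite -[(x - m) ^+ 2]real_normK ?num_real//; nra.
  rewrite mulrDl mul1r lerD// [leRHS]mulrC//.
have mp : measurable_fun setT p by exact: continuous_measurable_fun.
have mp' : measurable_fun setT p' by exact: continuous_measurable_fun.
have mxp : measurable_fun setT (fun x : R => (x - m) * p x).
  by apply: measurable_funM => //; exact: measurable_funB.
have isp : mu.-integrable setT (fun x => (s ^+ 2 * (p' x * pdf x))%:E).
  apply: (@integrableZl _ _ _ mu setT measurableT (s ^+ 2) (fun x => (p' x * pdf x)%:E)).
  exact: integrable_gaussian_decay bp'2.
rewrite !integral_normal//; last 2 first.
- exact: integrable_gaussian_decay bp'2.
- exact: integrable_gaussian_decay bxp.
apply/eqP; rewrite -subr_eq0 -RintegralZl//; last first.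
  exact: integrable_gaussian_decay bp'2.
rewrite -RintegralB//; last exact: integrable_gaussian_decay bxp.
pose G x : R := - s ^+ 2 * p x * pdf x.
have [G1 G2] : (G n%:R @[n --> \oo] --> (0 : R)) /\ (G (- n%:R) @[n --> \oo] --> (0 : R)).
  apply: (@cvg_gaussian_decay (fun x => - s ^+ 2 * p x) (s ^+ 2 * C)) => x.
  by rewrite normrM normrN (gtr0_norm s2_gt0) -mulrA ler_wpM2l// ltW.
pose g x : R := (x - m) * p x * pdf x - s ^+ 2 * (p' x * pdf x).
apply/eqP; change ((\int[mu]_x g x)%R = 0); apply: (@Rintegral_derive_eq0 G g); [| | |exact: G1|exact: G2].
- move=> x; have := is_derive_normal_pdf x; have := dp x => d1 d2.
  rewrite /G; apply: is_derive_eq; rewrite /GRing.scale/=.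
  by rewrite /g; field; rewrite gt_eqF.
- move=> x; have cpdf := @continuous_normal_pdf R m s (lt0r_neq0 s_gt0).
  apply: cvgB.
    apply: cvgM; last exact: cpdf.
    by apply: cvgM; [apply: cvgB; [exact: cvg_id|exact: cvg_cst]|exact: cp].
  by apply: cvgM; [exact: cvg_cst|apply: cvgM; [exact: cp'|exact: cpdf]].
- apply: (@integrableB _ _ _ mu setT measurableT
     (fun x => ((x - m) * p x * pdf x)%:E) (fun x => (s ^+ 2 * (p' x * pdf x))%:E)).
    exact: integrable_gaussian_decay bxp.
  exact: isp.
Qed.

End stein.

Section normal_moments.
Variables (m s : R).
Hypothesis s_gt0 : 0 < s.
Local Notation nu := (normal_prob m s).
Local Notation gw x := (expR ((x - m) ^+ 2 / (8 * s ^+ 2))).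

Let s2_gt0 : 0 < s ^+ 2. Proof. by rewrite exprn_gt0. Qed.

Let gw_ge1 x : 1 <= gw x.
Proof. by rewrite -expR0 ler_expR divr_ge0 ?sqr_ge0// mulr_ge0// ltW. Qed.

(** For k > 0 this is u / k <= exp(u / k), raised to the power k. *)
Lemma exprn_le_expR (u : R) k : 0 <= u -> u ^+ k <= k%:R ^+ k * expR u.
Proof.
move=> u0; case: k => [|k]; first by rewrite !expr0 mul1r -expR0 ler_expR.
have -> : expR u = expR (u / k.+1%:R) ^+ k.+1.
  by rewrite -expRM_natr -mulrA mulVf ?mulr1// pnatr_eq0.
rewrite -exprMn lerXn2r ?nnegrE ?mulr_ge0 ?expR_ge0//.
rewrite mulrC -ler_pdivrMr ?ltr0n//.
by apply: le_trans (expR_ge1Dx _); rewrite lerDr.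
Qed.

Lemma power_gaussian_bound k : exists2 C, 0 <= C & forall x, `|(x - m) ^+ k| <= C * gw x.
Proof.
exists (1 + (8 * s ^+ 2) ^+ k * k%:R ^+ k).
  by rewrite addr_ge0// mulr_ge0// exprn_ge0// mulr_ge0// ltW.
move=> x; rewrite normrX.
apply: (@le_trans _ _ (1 + ((x - m) ^+ 2) ^+ k)).
  rewrite -real_normK ?num_real// -exprM mulnC exprM.
  have : 0 <= `|x - m| ^+ k by rewrite exprn_ge0.
  by nra.
rewrite mulrDl mul1r lerD//.
have : 0 <= (x - m) ^+ 2 / (8 * s ^+ 2) by rewrite divr_ge0 ?sqr_ge0// mulr_ge0// ltW.
move=> /(exprn_le_expR k); rewrite exprMn exprVn ler_pdivrMr; last first.
  by rewrite exprn_gt0// mulr_gt0.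
by move=> /le_trans; apply; rewrite mulrAC [_ * (8 * _) ^+ _]mulrC.
Qed.

Lemma integrable_power_normal k : nu.-integrable setT (fun x => ((x - m) ^+ k)%:E).
Proof.
have [C C0 hC] := power_gaussian_bound k.
have mf : measurable_fun [set: R] (fun x : R => (x - m) ^+ k).
  by apply: measurable_funX; exact: measurable_funB.
apply: integrable_normal => //.
apply: (@integrable_gaussian_decay _ _ s_gt0 _ C) => // x.
by rewrite (le_trans (hC x))// ler_wpM2l// ler_peMr ?expR_ge0.
Qed.

(** Stein's identity for the monomial of degree k + 1. *)
Lemma normal_moment_rec k :
  (\int[nu]_x ((x - m) ^+ k.+2) = k.+1%:R * s ^+ 2 * \int[nu]_x ((x - m) ^+ k))%R.
Proof.
have [C1 C10 hC1] := power_gaussian_bound k.+1.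
have [C2 C20 hC2] := power_gaussian_bound k.
have := @stein m s s_gt0 (fun x => (x - m) ^+ k.+1) (fun x => k.+1%:R * (x - m) ^+ k)
  (C1 + k.+1%:R * C2).
under eq_Rintegral do rewrite -exprS.
move=> st; transitivity (s ^+ 2 * (\int[nu]_x (k.+1%:R * (x - m) ^+ k))%R); last first.
  rewrite RintegralZl//; last exact: integrable_power_normal.
  by rewrite [RHS]mulrAC -mulrA [s ^+ 2 * _]mulrC mulrA.
apply: st.
- move=> x.
  have df : is_derive x 1 (fun x : R => x - m) 1.
    by apply: is_derive_eq; rewrite oppr0 addr0.
  have := @is_deriveX _ _ _ k.+1 _ _ _ df.
  by rewrite /GRing.scale/= mulr1 exprfctE.
- move=> x; apply: cvgM; first exact: cvg_cst.
  apply: (@cvg_comp _ _ _ (fun x => x - m) (fun y => y ^+ k)); last exact: exprn_continuous.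
  by apply: cvgB; [exact: cvg_id|exact: cvg_cst].
- move=> x; rewrite mulrDl (le_trans (hC1 x))// lerDl.
  by rewrite !mulr_ge0 ?expR_ge0.
- move=> x; rewrite mulrDl normrM ger0_norm//.
  rewrite (le_trans (ler_wpM2l _ (hC2 x)))// [leRHS]addrC mulrA lerDl.
  by rewrite mulr_ge0 ?expR_ge0.
Qed.

Lemma normal_moment1 : (\int[nu]_x (x - m) = 0)%R.
Proof.
have := @stein m s s_gt0 (fun x => 1) (fun x => 0) 1.
rewrite Rintegral_cst// mul0r mulr0.
under eq_Rintegral do rewrite mulr1.
apply.
- exact: cst_continuous.
- by move=> x; rewrite normr1 mul1r.
- by move=> x; rewrite normr0 mul1r expR_ge0.
Qed.

Let int_bnd (f : R -> R) (C : R) : measurable_fun setT f -> (forall x, `|f x| <= C) ->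
  nu.-integrable setT (EFin \o f).
Proof.
move=> mf fC; apply: (@le_integrable _ _ _ nu setT measurableT _ (fun=> C%:E)) => //.
- exact/measurable_EFinP.
- by move=> x _ /=; rewrite lee_fin (le_trans (fC x))// ler_norm.
- exact: finite_measure_integrable_cst.
Qed.

Let cont_aff (g : R -> R) (a t : R) : continuous g ->
  continuous (fun x : R => g (a + t * (x - m))).
Proof.
move=> cg x; apply: (@cvg_comp _ _ _ (fun x => a + t * (x - m)) g); last exact: cg.
apply: cvgD; first exact: cvg_cst.
by apply: cvgM; [exact: cvg_cst|apply: cvgB; [exact: cvg_id|exact: cvg_cst]].
Qed.

(* By Stein's identity both sides, as functions of [t], solve [F' = - t s^2 F]. *)
Lemma normal_cos (ph t : R) :
  (\int[nu]_x cos (ph + t * (x - m)) = cos ph * expR (- (t ^+ 2 * s ^+ 2 / 2)))%R.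
Proof.
pose F (t : R) : R := (\int[nu]_x cos (ph + t * (x - m)))%R.
have dF (t0 : R) : is_derive t0 1 F (- t0 * s ^+ 2 * F t0).
  pose f (t x : R) := cos (ph + t * (x - m)).
  have df (u x : R) : is_derive u 1 (f ^~ x) (- ((x - m) * sin (ph + u * (x - m)))).
    rewrite /f; apply: is_derive_eq; rewrite /GRing.scale/=; ring.
  have p1E u x : partial1of2 f u x = - ((x - m) * sin (ph + u * (x - m))).
    by rewrite /partial1of2 derive1E; have [] := df u x.
  have mf u : measurable_fun [set: R] (f u).
    by apply: continuous_measurable_fun; exact: (cont_aff (@continuous_cos R)).
  have I0 : `]t0 - 1, t0 + 1[%classic t0.
    by rewrite /= in_itv/= ltrBlDr !ltrDl ltr01.
  have mG : measurable_fun [set: R] (fun x : R => `|x - m|).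
    by apply: measurableT_comp => //; exact: measurable_funB.
  have iG : nu.-integrable setT (EFin \o (fun x => `|x - m|)).
    have := integrable_power_normal 1.
    by move=> /integrable_abse; apply: eq_integrable => // x _; rewrite /= expr1.
  have h1 u : `]t0 - 1, t0 + 1[%classic u -> nu.-integrable setT (EFin \o f u).
    by move=> _; apply: (@int_bnd _ 1) => // x; exact: cos_max.
  have h2 u y : `]t0 - 1, t0 + 1[%classic u -> [set: R] y -> derivable (f ^~ y) u 1.
    by move=> _ _; have [] := df u y.
  have h3 u y : `]t0 - 1, t0 + 1[%classic u -> [set: R] y -> `|partial1of2 f u y| <= `|y - m|.
    by move=> _ _; rewrite p1E normrN normrM ler_piMr// sin_max.
  have dv := @derivable_under_integral R _ _ nu f setT measurableT t0 (t0 - 1) (t0 + 1) I0 h1 h2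
     (fun x => `|x - m|) (fun x => normr_ge0 _) iG h3.
  have ev := @differentiation_under_integral R _ _ nu f setT measurableT t0 (t0 - 1) (t0 + 1) I0 h1 h2
     (fun x => `|x - m|) (fun x => normr_ge0 _) iG h3.
  apply: DeriveDef => //; rewrite -derive1E ev.
  have [C1 C10 hC1] := power_gaussian_bound 0.
  under eq_Rintegral do rewrite p1E -mulrN.
  have st := @stein m s s_gt0 (fun x => - sin (ph + t0 * (x - m)))
    (fun x => - (t0 * cos (ph + t0 * (x - m)))) (1 + `|t0|).
  transitivity (s ^+ 2 * (\int[nu]_x (- (t0 * cos (ph + t0 * (x - m))))))%R; [apply: st|].
  - by move=> x; apply: is_derive_eq; rewrite /GRing.scale/=; ring.
  - move=> x; apply: cvgN; apply: cvgM; first exact: cvg_cst.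
    exact: (cont_aff (@continuous_cos R)).
  - move=> x; rewrite normrN (le_trans (sin_max _))//.
    by rewrite (le_trans (gw_ge1 x))// ler_peMl ?expR_ge0// lerDl.
  - move=> x; rewrite normrN normrM.
    rewrite (@le_trans _ _ ((1 + `|t0|) * 1))//.
      by rewrite mulr1 (@le_trans _ _ `|t0|) ?lerDr// ler_piMr// cos_max.
    by rewrite ler_wpM2l// addr_ge0.
  rewrite (_ : (\int[nu]_x _)%R = - t0 * F t0); first by ring.
  rewrite /F -RintegralZl//; last exact: h1.
  by apply: eq_Rintegral => x _; rewrite mulNr.
pose H (t : R) := F t * expR (t ^+ 2 * s ^+ 2 / 2).
have HE : H t = H 0.
  apply: is_derive_0_is_cst => x; rewrite /H.
  by apply: is_derive_eq; rewrite /GRing.scale/=; field.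
have : F t * expR (t ^+ 2 * s ^+ 2 / 2) = cos ph.
  rewrite -/(H t) HE /H expr0n/= !mul0r expR0 mulr1 /F.
  under eq_Rintegral do rewrite mul0r addr0.
  rewrite Rintegral_cst//.
  have := probability_setT (normal_prob m s : probability _ R) => /= ->.
  by rewrite mulr1.
by rewrite /F => <-; rewrite -mulrA -expRD subrr expR0 mulr1.
Qed.

End normal_moments.

End gauss.

(** * Expectations through the law of a random variable *)

Section gaussian_variables.
Context {R : realType} d (T : measurableType d) (P : probability T R).
Local Notation Ex f := (Rintegral P setT f).
Local Notation integ f := (P.-integrable setT (EFin \o f)).

Section law.
Variables (d' : measure_display) (T' : measurableType d').
Variables (L : probability T' R) (U : T -> T').
Hypothesis mU : measurable_fun setT U.
Hypothesis UL : forall A : set T', measurable A -> P (U @^-1` A) = L A.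

Lemma ge0_integral_law (f : T' -> \bar R) : measurable_fun [set: T'] f ->
  (forall x, 0 <= f x)%E -> (\int[P]_w f (U w) = \int[L]_x f x)%E.
Proof.
move=> mf f0.
pose X : {RV P >-> T'} := mfun_Sub (mem_set mU).
rewrite -[LHS](@ge0_integral_distribution _ _ _ _ _ P X f mf f0).
by apply: eq_measure_integral => A mA _; exact: UL.
Qed.

Lemma integrable_law (f : T' -> R) : measurable_fun [set: T'] f ->
  L.-integrable [set: T'] (EFin \o f) -> integ (fun w => f (U w)).
Proof.
move=> mf /integrableP[_ fi]; apply/integrableP; split.
  by apply/measurable_EFinP; exact: measurableT_comp.
rewrite (ge0_integral_law (f := fun x => `|(f x)%:E|%E))//.
by apply: measurableT_comp => //; exact/measurable_EFinP.
Qed.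

Lemma Rintegral_law (f : T' -> R) : measurable_fun [set: T'] f ->
  (Ex (fun w => f (U w)) = \int[L]_x f x)%R.
Proof.
move=> mf; rewrite /Rintegral; congr fine.
have mfE : measurable_fun [set: T'] (EFin \o f) by exact/measurable_EFinP.
rewrite integralE [RHS]integralE; congr (_ - _)%E.
- rewrite -ge0_integral_law//; first by apply: eq_integral => w _; rewrite !funeposE.
  exact: measurable_funepos.
- rewrite -ge0_integral_law//; first by apply: eq_integral => w _; rewrite !funenegE.
  exact: measurable_funeneg.
Qed.

End law.

(** The degenerate law is a Dirac mass and is computed directly. It obeys the same recurrence of
    moments and the same cosine formula as the others, so that no later argument distinguishes v =
    0. *)
Lemma gaussian_moments (U : T -> R) (m v : R) : measurable_fun setT U -> 0 <= v ->
  (forall A : set R, measurable A -> P (U @^-1` A) = gaussian_law m v A) ->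
  [/\ forall k, integ (fun w => (U w - m) ^+ k),
      Ex (fun w => U w - m) = 0,
      forall k, Ex (fun w => (U w - m) ^+ k.+2) = k.+1%:R * v * Ex (fun w => (U w - m) ^+ k)
    & forall ph, Ex (fun w => cos (ph + (U w - m))) = cos ph * expR (- (v / 2))].
Proof.
move=> mU v0 UL.
have mk k : measurable_fun [set: R] (fun x : R => (x - m) ^+ k).
  by apply: measurable_funX; exact: measurable_funB.
have m1 : measurable_fun [set: R] (fun x : R => x - m) by exact: measurable_funB.
have mc ph : measurable_fun [set: R] (fun x : R => cos (ph + (x - m))).
  have mcos := continuous_measurable_fun (@continuous_cos R).
  apply: (measurableT_comp (f := cos) (g := fun x : R => ph + (x - m))) => //.
  exact: measurable_funD.
have [v00|vN0] := eqVneq v 0.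
  pose L : probability R R := \d_m.
  have UL' (A : set R) : measurable A -> P (U @^-1` A) = L A.
    by move=> mA; rewrite UL// /gaussian_law v00 eqxx.
  have EL (f : R -> R) : measurable_fun [set: R] f -> (\int[L]_x f x)%R = f m.
    move=> mf; rewrite /Rintegral integral_dirac//; first by rewrite diracT mul1e.
    exact/measurable_EFinP.
  split.
  - move=> k; apply: (integrable_law mU UL' (f := fun x => (x - m) ^+ k)) => //.
    apply/integrableP; split; first exact/measurable_EFinP.
    rewrite integral_dirac//; last first.
      by apply: measurableT_comp => //; exact/measurable_EFinP.
    by rewrite diracT mul1e ltry.
  - by rewrite (Rintegral_law mU UL' (f := fun x => x - m))// EL// subrr.
  - move=> k; rewrite (Rintegral_law mU UL' (f := fun x => (x - m) ^+ k.+2))// EL//.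
    by rewrite subrr expr0n v00 mulr0 mul0r.
  - move=> ph; rewrite (Rintegral_law mU UL' (f := fun x => cos (ph + (x - m))))// EL//.
    by rewrite subrr addr0 v00 mul0r oppr0 expR0 mulr1.
have v_gt0 : 0 < v by rewrite lt_neqAle eq_sym vN0.
have s_gt0 : 0 < Num.sqrt v by rewrite sqrtr_gt0.
pose L : probability (measurableTypeR R) R := normal_prob m (Num.sqrt v).
have UL' (A : set (measurableTypeR R)) : measurable A -> P (U @^-1` A) = L A.
  by move=> mA; rewrite UL// /gaussian_law (negbTE vN0).
have mU' : measurable_fun setT (U : T -> measurableTypeR R) by exact: mU.
split.
- move=> k; apply: (integrable_law mU' UL' (f := fun x => (x - m) ^+ k)); first exact: mk.
  exact: integrable_power_normal.
- rewrite (Rintegral_law mU' UL' (f := fun x => x - m)); last exact: m1.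
  exact: normal_moment1.
- move=> k; rewrite (Rintegral_law mU' UL' (f := fun x => (x - m) ^+ k.+2)); last exact: mk.
  rewrite (Rintegral_law mU' UL' (f := fun x => (x - m) ^+ k)); last exact: mk.
  by rewrite [LHS]normal_moment_rec// sqr_sqrtr.
- move=> ph; rewrite (Rintegral_law mU' UL' (f := fun x => cos (ph + (x - m)))); last exact: mc.
  have := normal_cos m s_gt0 ph 1; rewrite expr1n mul1r sqr_sqrtr// => <-.
  by apply: eq_Rintegral => x _; rewrite mul1r.
Qed.

End gaussian_variables.

(** * Uniform approximation by trigonometric polynomials *)

Section bernstein.
Context {R : realType}.
Implicit Types u x : R.

Definition bern N u (j : nat) : R := 'C(N, j)%:R * u ^+ j * (1 - u) ^+ (N - j).

Lemma bern_ge0 N u j : 0 <= u <= 1 -> 0 <= bern N u j.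
Proof.
move=> /andP[u0 u1]; rewrite /bern !mulr_ge0 ?ler0n ?exprn_ge0//.
by rewrite subr_ge0.
Qed.

(** Pascal's rule: the mean of g under the binomial law with N + 1 trials, conditioned on one of the
    trials. *)
Lemma bern_sum_rec N u (g : nat -> R) :
  \sum_(j < N.+2) bern N.+1 u j * g j =
  u * (\sum_(j < N.+1) bern N u j * g j.+1) + (1 - u) * (\sum_(j < N.+1) bern N u j * g j).
Proof.
rewrite big_ord_recl [X in _ + (1 - u) * X]big_ord_recl/=.
rewrite (eq_bigr (fun j : 'I_N.+1 => u * (bern N u j * g j.+1) +
    'C(N, j.+1)%:R * u ^+ j.+1 * (1 - u) ^+ (N - j) * g j.+1)); last first.
  move=> j _; rewrite /bern /bump/= add1n binS natrD subSS exprS; ring.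
rewrite big_split/= -mulr_sumr addrCA; congr (_ + _).
rewrite big_ord_recr/= bin_small// !mul0r addr0 mulrDr mulr_sumr; congr (_ + _).
  by rewrite /bern !bin0 !subn0 !expr0 exprS; ring.
apply: eq_bigr => j _; rewrite /bern /bump/= add1n.
have -> : (N - j = (N - j.+1).+1)%N by rewrite -subSn ?subSS.
by rewrite [(1 - u) ^+ _.+1]exprS; ring.
Qed.

Lemma bern_sum1 N u : \sum_(j < N.+1) bern N u j = 1.
Proof.
rewrite (eq_bigr (fun j : 'I_N.+1 => bern N u j * (fun=> 1) (j : nat))); last first.
  by move=> j _; rewrite mulr1.
elim: N => [|N IH].
  by rewrite big_ord1 /bern bin0 !expr0 !mulr1.
rewrite (bern_sum_rec N u (fun=> 1)) IH; ring.
Qed.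

(** The variance of the binomial law. The shift [a] is there for the induction, in which
    conditioning on a trial moves the centre by 1 - u or by -u. *)
Lemma bern_var N u (a : R) :
  \sum_(j < N.+1) bern N u j * (j%:R + a - N%:R * u) ^+ 2 = N%:R * (u * (1 - u)) + a ^+ 2.
Proof.
elim: N a => [|N IH] a.
  by rewrite big_ord1 /bern/= bin0 !expr0; ring.
rewrite (bern_sum_rec N u (fun j => (j%:R + a - N.+1%:R * u) ^+ 2)).
have := IH (a + 1 - u); have := IH (a - u).
rewrite (eq_bigr (fun j : 'I_N.+1 => bern N u j * (j%:R + a - N.+1%:R * u) ^+ 2)); last first.
  by move=> j _; congr (_ * _ ^+ 2); rewrite -[in RHS](natr1 N); ring.
move=> ->.
rewrite (eq_bigr (fun j : 'I_N.+1 => bern N u j * (j.+1%:R + a - N.+1%:R * u) ^+ 2)); last first.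
  by move=> j _; congr (_ * _ ^+ 2); rewrite -[in RHS](natr1 N) -(natr1 j); ring.
move=> ->; rewrite -(natr1 N); ring.
Qed.

Variable k : nat.

(** The joint weights of k independent binomial variables. *)
Definition bernW N (u : 'I_k -> R) (m : {ffun 'I_k -> 'I_N.+1}) : R :=
  \prod_i bern N (u i) (m i).

Lemma bernW_ge0 N (u : 'I_k -> R) m : (forall i, 0 <= u i <= 1) -> 0 <= @bernW N u m.
Proof. by move=> u01; apply: prodr_ge0 => i _; exact: bern_ge0. Qed.

Lemma bernW_sum1 N (u : 'I_k -> R) : \sum_m @bernW N u m = 1.
Proof.
rewrite /bernW -(bigA_distr_bigA (fun i (j : 'I_N.+1) => bern N (u i) j)).
by rewrite big1// => i _; exact: bern_sum1.
Qed.

(** Marginalization: every coordinate other than [i0] sums to 1. *)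
Lemma bernW_sum_coord N (u : 'I_k -> R) (q : nat -> R) i0 :
  \sum_m @bernW N u m * q (m i0) = \sum_(j < N.+1) bern N (u i0) j * q j.
Proof.
pose F i (j : 'I_N.+1) := bern N (u i) j * (if i == i0 then q j else 1).
transitivity (\sum_(m : {ffun 'I_k -> 'I_N.+1}) \prod_i F i (m i)).
  apply: eq_bigr => m _; rewrite /F big_split/=; congr (_ * _).
  by rewrite -big_mkcond/= big_pred1_eq.
rewrite -bigA_distr_bigA (bigD1 i0)//= [X in _ * X]big1 ?mulr1.
  by apply: eq_bigr => j _; rewrite /F eqxx.
move=> i /negbTE ii0; rewrite (eq_bigr (fun j : 'I_N.+1 => bern N (u i) j)).
  exact: bern_sum1.
by move=> j _; rewrite /F ii0 mulr1.
Qed.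

Lemma bernW_var N (u : 'I_k -> R) i0 : (0 < N)%N -> 0 <= u i0 <= 1 ->
  \sum_m @bernW N u m * ((m i0 : nat)%:R / N%:R - u i0) ^+ 2 <= N%:R^-1.
Proof.
move=> N0 /andP[u0 u1].
have N0' : N%:R != 0 :> R by rewrite pnatr_eq0 -lt0n.
rewrite (bernW_sum_coord N u (fun j => (j%:R / N%:R - u i0) ^+ 2)).
rewrite (eq_bigr (fun j : 'I_N.+1 => (N%:R ^- 2) *
    (bern N (u i0) j * (j%:R + 0 - N%:R * u i0) ^+ 2))); last first.
  by move=> j _; field.
rewrite -mulr_sumr bern_var expr0n addr0.
have -> : N%:R ^- 2 * (N%:R * (u i0 * (1 - u i0))) = N%:R^-1 * (u i0 * (1 - u i0)) by field.
by rewrite ler_piMr ?invr_ge0//; nra.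
Qed.

End bernstein.

Section trig_approximation.
Context {R : realType}.

(** If a were at least b + e, then sin would grow by at least e cos 1 between b and b + e, as this
    interval lies in [-1, 1], where the derivative is at least cos 1; and sin is increasing up to
    a. *)
Lemma sin_modulus (a b e : R) : - (pi / 2) <= a <= pi / 2 -> `|b| <= 2^-1 ->
  0 < e <= 2^-1 -> `|sin a - sin b| < cos 1 * e -> `|a - b| < e.
Proof.
move=> ha hb he h.
wlog ab : a b ha hb h / b <= a.
  move=> H; have [|/ltW] := leP b a; first exact: H.
  move=> ab; suff : `|- a - - b| < e by rewrite -opprD normrN.
  apply: H; rewrite ?normrN ?sinN -?opprD ?normrN ?lerN2//.
  by move: ha => /andP[h1 h2]; apply/andP; split=> //; rewrite lerNl.
have p1 := @pihalf_ge1 R.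
move: ha he hb => /andP[a1 a2] /andP[e0 e1]; rewrite ler_norml => /andP[b1 b2].
rewrite ltNge; apply/negP; rewrite ger0_norm ?subr_ge0// => eab.
have [c cb sc] := @MVT_segment R sin cos b (b + e) (ltac:(lra))
  (fun x _ => is_derive_sin x) (continuous_subspaceT (@continuous_sin R)).
have c1 : cos 1 <= cos c.
  move: cb; rewrite in_itv/= => /andP[cb1 cb2].
  have -> : cos c = cos `|c| by case: (ler0P c); rewrite ?cosN.
  have c_le1 : `|c| <= 1 by rewrite ler_norml; apply/andP; split; lra.
  have pi1 : 1 <= pi :> R by lra.
  rewrite leNgt ltr_cos ?in_itv/= ?normr_ge0 -?leNgt// ?pi1 ?ler01//.
  exact: le_trans pi1.
have s1 : sin (b + e) <= sin a.
  rewrite leNgt ltr_sin ?in_itv/=; [|apply/andP; split; lra..].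
  by rewrite -leNgt; lra.
move: h; apply/negP; rewrite -leNgt.
apply: le_trans (ler_norm _).
rewrite (@le_trans _ _ (sin (b + e) - sin b))//; last by rewrite lerD2r.
by rewrite sc addrAC subrr add0r ler_wpM2r// ltW.
Qed.

Variable k : nat.
Local Notation V := ('I_k -> R).

(** The phase makes sines and constants available, so this is the space of real trigonometric
    polynomials with arbitrary frequencies. As an inductive predicate it reduces every statement
    linear in the function to cosines. *)
Inductive trigpoly : (V -> R) -> Prop :=
| trigpoly_cos a (t : V) : trigpoly (fun x => cos (a + \sum_i t i * x i))
| trigpoly_add f g : trigpoly f -> trigpoly g -> trigpoly (fun x => f x + g x)
| trigpoly_scale c f : trigpoly f -> trigpoly (fun x => c * f x).

Lemma trigpoly_bounded p : trigpoly p -> exists C : R, forall x, `|p x| <= C.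
Proof.
elim=> {p} [a t|g h _ [C1 h1] _ [C2 h2]|c g _ [C h]].
- by exists 1 => x; exact: cos_max.
- by exists (C1 + C2) => x; rewrite (le_trans (ler_normD _ _))// lerD.
- by exists (`|c| * C) => x; rewrite normrM ler_wpM2l.
Qed.

Lemma trigpoly_ext f g : f =1 g -> trigpoly f -> trigpoly g.
Proof. by move=> /funext ->. Qed.

Lemma trigpoly_cst c : trigpoly (fun=> c).
Proof.
apply: (@trigpoly_ext (fun x => c * cos (0 + \sum_i (fun=> 0) i * x i))).
  by move=> x; rewrite big1 ?addr0 ?cos0 ?mulr1// => i _; rewrite mul0r.
exact/trigpoly_scale/trigpoly_cos.
Qed.

(** Twice a product of cosines is the sum of the cosines of the sum and of the difference. *)
Lemma trigpoly_mul f g : trigpoly f -> trigpoly g -> trigpoly (fun x => f x * g x).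
Proof.
move=> hf; elim: hf g => {f} [a t g hg|f1 f2 _ IH1 _ IH2 g hg|c f _ IH g hg].
- elim: hg => {g} [b t'|g1 g2 _ IH1 _ IH2|c g _ IH].
  + apply: (@trigpoly_ext (fun x => 2^-1 * cos ((a + b) + \sum_i (fun i => t i + t' i) i * x i)
       + 2^-1 * cos ((a - b) + \sum_i (fun i => t i - t' i) i * x i))).
      move=> x; under eq_bigr do rewrite mulrDl.
      under [X in cos (a - b + X)]eq_bigr do rewrite mulrBl.
      rewrite big_split/= sumrB.
      set s1 := \sum_i _; set s2 := \sum_i _.
      have -> : a + b + (s1 + s2) = (a + s1) + (b + s2) by ring.
      have -> : a - b + (s1 - s2) = (a + s1) - (b + s2) by ring.
      by rewrite cosD cosB; field.
    by apply: trigpoly_add; apply: trigpoly_scale; exact: trigpoly_cos.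
  + apply: (trigpoly_ext _ (trigpoly_add IH1 IH2)) => x; by rewrite mulrDr.
  + apply: (trigpoly_ext _ (trigpoly_scale c IH)) => x; by rewrite mulrCA.
- apply: (trigpoly_ext _ (trigpoly_add (IH1 _ hg) (IH2 _ hg))) => x; by rewrite mulrDl.
- apply: (trigpoly_ext _ (trigpoly_scale c (IH _ hg))) => x; by rewrite mulrA.
Qed.

Lemma trigpoly_sum (I : Type) (r : seq I) (F : I -> V -> R) :
  (forall i, trigpoly (F i)) -> trigpoly (fun x => \sum_(i <- r) F i x).
Proof.
move=> hF; elim: r => [|i r IH].
  by apply: (trigpoly_ext _ (trigpoly_cst 0)) => x; rewrite big_nil.
by apply: (trigpoly_ext _ (trigpoly_add (hF i) IH)) => x; rewrite big_cons.
Qed.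

Lemma trigpoly_prod (I : Type) (r : seq I) (F : I -> V -> R) :
  (forall i, trigpoly (F i)) -> trigpoly (fun x => \prod_(i <- r) F i x).
Proof.
move=> hF; elim: r => [|i r IH].
  by apply: (trigpoly_ext _ (trigpoly_cst 1)) => x; rewrite big_nil.
by apply: (trigpoly_ext _ (trigpoly_mul (hF i) IH)) => x; rewrite big_cons.
Qed.

Lemma trigpoly_exp f n : trigpoly f -> trigpoly (fun x => f x ^+ n).
Proof.
move=> hf; elim: n => [|n IH].
  by apply: (trigpoly_ext _ (trigpoly_cst 1)) => x; rewrite expr0.
by apply: (trigpoly_ext _ (trigpoly_mul hf IH)) => x; rewrite exprS.
Qed.

Lemma trigpoly_sin c i : trigpoly (fun x => sin (c * x i)).
Proof.
apply: (trigpoly_ext _ (trigpoly_cos (- (pi / 2)) (fun j => if j == i then c else 0))) => x.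
rewrite (bigD1 i)//= eqxx big1 ?addr0; last by move=> j /negbTE ->; rewrite mul0r.
by rewrite addrC -sinDpihalf subrK.
Qed.

(** Only [x] is confined to the cube; [y] may leave it. The radius thus depends on the size of the
    cube alone. *)
Definition loc_unif_cont (f : V -> R) := forall L e : R, 0 < e ->
  exists2 de : R, 0 < de & forall x y : V, (forall i, `|x i| <= L) ->
    (forall i, `|y i - x i| < de) -> `|f y - f x| <= e.

(** The Bernstein polynomial of f in the variables u_i = (1 + sin(c x_i)) / 2. Its weights are
    nonnegative with sum 1 for all x, so the bound M survives outside the cube, where nothing is
    approximated. *)
Lemma trig_approx (f : V -> R) (M L e : R) : loc_unif_cont f ->
  (forall x, `|f x| <= M) -> 0 < L -> 0 < e ->
  exists p, [/\ trigpoly p, forall x, `|p x| <= M &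
    forall x, (forall i, `|x i| <= L) -> `|p x - f x| <= e].
Proof.
move=> fc fM L0 e0.
have [de de0 fde] := fc L (e / 2) (ltac:(by rewrite divr_gt0)).
(* Maps the cube to |c x_i| <= 1/2, where [sin_modulus] recovers the point from its sine. *)
pose c := (2 * L)^-1.
have c0 : 0 < c by rewrite invr_gt0 mulr_gt0.
pose e' := Num.min (c * de) 2^-1.
have e'0 : 0 < e' by rewrite lt_min mulr_gt0//= invr_gt0.
have e'1 : e' <= 2^-1 by rewrite ge_min lexx orbT.
(* Since sin(c x_i) = 2 u_i - 1, a frequency within eta of u_i belongs to a node within e' / c <= de
   of x_i. *)
pose eta := cos 1 * e' / 2.
have eta0 : 0 < eta by rewrite divr_gt0// mulr_gt0// cos1_gt0.
have M0 : 0 <= M by apply: le_trans (fM (fun=> 0)); exact: normr_ge0.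
(* Chebyshev's inequality: the error 2 M of a node with a frequency off by eta or more is at most K
   times the squared deviation. N then makes the expected total K k / N at most e / 2. *)
pose K := 2 * M / eta ^+ 2.
have K0 : 0 <= K by rewrite divr_ge0 ?sqr_ge0// mulr_ge0.
pose N := (Num.truncn (K * k%:R / (e / 2))).+1.
have NK : K * k%:R / N%:R <= e / 2.
  rewrite ler_pdivrMr ?ltr0n// [leRHS]mulrC -ler_pdivrMr ?divr_gt0//.
  exact/ltW/truncnS_gt.
pose u (x : V) (i : 'I_k) : R := (1 + sin (c * x i)) / 2.
have u01 x i : 0 <= u x i <= 1.
  rewrite /u; have := sin_le1 (c * x i); have := sin_geN1 (c * x i) => *.
  by apply/andP; split; lra.
pose node (m : {ffun 'I_k -> 'I_N.+1}) : V := fun i => asin (2 * ((m i : nat)%:R / N%:R) - 1) / c.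
have mN (m : {ffun 'I_k -> 'I_N.+1}) i : -1 <= (2 * ((m i : nat)%:R / N%:R) - 1 : R) <= 1.
  have h0 : 0 <= (m i : nat)%:R / N%:R :> R by rewrite divr_ge0.
  have h1 : (m i : nat)%:R / N%:R <= 1 :> R.
    by rewrite ler_pdivrMr ?ltr0n// mul1r ler_nat -ltnS.
  by apply/andP; split; lra.
exists (fun x => \sum_m bernW (u x) m * f (node m)); split.
- apply: trigpoly_sum => m.
  apply: (@trigpoly_ext (fun x => f (node m) * bernW (u x) m)) => [x|]; first by rewrite mulrC.
  apply: trigpoly_scale; apply: trigpoly_prod => i.
  have tu : trigpoly (u ^~ i).
    apply: (trigpoly_ext _ (trigpoly_scale 2^-1 (trigpoly_add (trigpoly_cst 1) (trigpoly_sin c i)))).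
    by move=> x; rewrite /u mulrC.
  rewrite /bern; apply: trigpoly_mul.
    by apply: trigpoly_scale; exact: trigpoly_exp.
  apply: trigpoly_exp; apply: trigpoly_add; first exact: trigpoly_cst.
  by apply: (trigpoly_ext _ (trigpoly_scale (-1) tu)) => x; rewrite mulN1r.
- move=> x; apply: (le_trans (ler_norm_sum _ _ _)).
  rewrite -[leRHS]mul1r -(bernW_sum1 N (u x)) mulr_suml.
  apply: ler_sum => m _; rewrite normrM ger0_norm ?bernW_ge0//.
  by rewrite ler_wpM2l// bernW_ge0.
- move=> x xL.
  have key m : `|f (node m) - f x| <=
      e / 2 + K * \sum_i ((m i : nat)%:R / N%:R - u x i) ^+ 2.
    have s0 : 0 <= \sum_i ((m i : nat)%:R / N%:R - u x i) ^+ 2.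
      by apply: sumr_ge0 => i _; exact: sqr_ge0.
    case: (pselect (exists i, eta <= `|(m i : nat)%:R / N%:R - u x i|)) => [[i hi]|].
      apply: (@le_trans _ _ (2 * M)).
        by rewrite mulr_natl mulr2n (le_trans (ler_normB _ _))// lerD.
      rewrite (@le_trans _ _ (K * eta ^+ 2))//.
        by rewrite divfK// lt0r_neq0// exprn_gt0.
      rewrite (@le_trans _ _ (K * \sum_i ((m i : nat)%:R / N%:R - u x i) ^+ 2))//.
        rewrite ler_wpM2l// (bigD1 i)//= -[leLHS]addr0 lerD//.
          by rewrite -[leRHS]real_normK ?num_real// lerXn2r ?nnegrE// ltW.
        by apply: sumr_ge0 => j _; exact: sqr_ge0.
      by rewrite lerDr divr_ge0// ltW.
    move=> /forallNP hm; rewrite (@le_trans _ _ (e / 2))//; last by rewrite lerDl mulr_ge0.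
    apply: fde => // i.
    have := hm i; move/negP; rewrite -ltNge => hi.
    have ce : asin (2 * ((m i : nat)%:R / N%:R) - 1) = c * node m i.
      by rewrite [RHS]mulrC /node divfK// gt_eqF.
    have : `|c * node m i - c * x i| < e'.
      apply: sin_modulus; rewrite ?e'0//.
      + by rewrite -ce asin_geNpi2// asin_lepi2.
      + rewrite normrM gtr0_norm// /c invfM -[leRHS]mulr1 -mulrA ler_wpM2l//.
        by rewrite mulrC ler_pdivrMr// mul1r.
      + rewrite -ce asinK ?in_itv//=.
        have -> : 2 * ((m i : nat)%:R / N%:R) - 1 - sin (c * x i) =
                2 * ((m i : nat)%:R / N%:R - u x i).
          by rewrite /u; field; rewrite pnatr_eq0.
        rewrite normrM gtr0_norm//; move: hi; rewrite /eta => hi; lra.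
    rewrite -mulrBr normrM (gtr0_norm c0) => hh.
    rewrite -(ltr_pM2l c0) (lt_le_trans hh)//.
    by rewrite ge_min lexx.
  have -> : f x = \sum_(m : {ffun 'I_k -> 'I_N.+1}) bernW (u x) m * f x.
    by rewrite -mulr_suml (@bernW_sum1 R k N) mul1r.
  rewrite -sumrB (le_trans (ler_norm_sum _ _ _))//.
  apply: (@le_trans _ _ (\sum_m bernW (u x) m *
     (e / 2 + K * \sum_i ((m i : nat)%:R / N%:R - u x i) ^+ 2))).
    apply: ler_sum => m _; rewrite -mulrBr normrM ger0_norm ?bernW_ge0//.
    by rewrite ler_wpM2l// bernW_ge0.
  under eq_bigr do rewrite mulrDr.
  rewrite big_split/= -mulr_suml bernW_sum1 mul1r [leRHS](splitr e) lerD2l.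
  apply: le_trans NK.
  under eq_bigr do rewrite mulrCA mulr_sumr.
  rewrite -mulr_sumr -mulrA ler_wpM2l// exchange_big/=.
  apply: (@le_trans _ _ (\sum_(i < k) N%:R^-1)).
    by apply: ler_sum => i _; apply: bernW_var.
  by rewrite sumr_const card_ord mulr_natl.
Qed.

End trig_approximation.

(** * Expectations, and factorization tested on cosines *)

Section expectation.
Context {R : realType} d (T : measurableType d) (P : probability T R).
Local Notation Ex f := (Rintegral P setT f).
Local Notation integ f := (P.-integrable setT (EFin \o f)).

Lemma bounded_integ (f : T -> R) (C : R) :
  measurable_fun setT f -> (forall w, `|f w| <= C) -> integ f.
Proof.
move=> mf fC; apply: (@le_integrable _ _ _ P setT measurableT _ (fun=> C%:E)) => //.
- exact/measurable_EFinP.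
- by move=> x _ /=; rewrite lee_fin (le_trans (fC x))// ler_norm.
- exact: finite_measure_integrable_cst.
Qed.

Lemma integ_ext (f g : T -> R) : f =1 g -> integ f -> integ g.
Proof. by move=> /funext ->. Qed.

Lemma integ_cst (c : R) : integ (fun=> c).
Proof. exact: finite_measure_integrable_cst. Qed.

Lemma integD (f g : T -> R) : integ f -> integ g -> integ (fun w => f w + g w).
Proof. exact: integrableD. Qed.

Lemma integZ (c : R) (f : T -> R) : integ f -> integ (fun w => c * f w).
Proof. exact: integrableZl. Qed.

Lemma integB (f g : T -> R) : integ f -> integ g -> integ (fun w => f w - g w).
Proof. exact: integrableB. Qed.

Lemma integ_sum (I : Type) (r : seq I) (F : I -> T -> R) :
  (forall i, integ (F i)) -> integ (fun w => \sum_(i <- r) F i w).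
Proof.
move=> hF; elim: r => [|i r IH].
  by apply: integ_ext (integ_cst 0) => w; rewrite big_nil.
by apply: integ_ext (integD (hF i) IH) => w; rewrite big_cons.
Qed.

Lemma integ_dom (f g : T -> R) : measurable_fun setT f -> integ g ->
  (forall w, `|f w| <= g w) -> integ f.
Proof.
move=> mf ig fg; apply: (@le_integrable _ _ _ P setT measurableT _ (EFin \o g)) => //.
- exact/measurable_EFinP.
- by move=> x _ /=; rewrite lee_fin (le_trans (fg x))// ler_norm.
Qed.

Lemma integ_norm (f : T -> R) : integ f -> integ (fun w => `|f w|).
Proof. exact: integrable_norm. Qed.

Lemma Ex_cst (c : R) : Ex (fun=> c) = c.
Proof. by rewrite Rintegral_cst//; have /= -> := probability_setT P; rewrite mulr1. Qed.

Lemma ExD (f g : T -> R) : integ f -> integ g -> Ex (fun w => f w + g w) = Ex f + Ex g.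
Proof. by move=> *; rewrite RintegralD. Qed.

Lemma ExB (f g : T -> R) : integ f -> integ g -> Ex (fun w => f w - g w) = Ex f - Ex g.
Proof. by move=> *; rewrite RintegralB. Qed.

Lemma ExZ (c : R) (f : T -> R) : integ f -> Ex (fun w => c * f w) = c * Ex f.
Proof. by move=> *; rewrite RintegralZl. Qed.

Lemma Ex_ext (f g : T -> R) : f =1 g -> Ex f = Ex g.
Proof. by move=> /funext ->. Qed.

Lemma Ex_sum (I : Type) (r : seq I) (F : I -> T -> R) : (forall i, integ (F i)) ->
  Ex (fun w => \sum_(i <- r) F i w) = \sum_(i <- r) Ex (F i).
Proof.
move=> hF; elim: r => [|i r IH].
  by rewrite big_nil -[RHS]Ex_cst; apply: Ex_ext => w; rewrite big_nil.
rewrite big_cons -IH -ExD//; last exact: integ_sum.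
by apply: Ex_ext => w; rewrite big_cons.
Qed.

Lemma Ex_le (f g : T -> R) : integ f -> integ g -> (forall w, f w <= g w) -> Ex f <= Ex g.
Proof. by move=> *; apply: le_Rintegral. Qed.

Lemma Ex_ge0 (f : T -> R) : (forall w, 0 <= f w) -> 0 <= Ex f.
Proof. by move=> h; apply: Rintegral_ge0. Qed.

Lemma Ex_norm_le (f g : T -> R) : integ f -> integ g -> (forall w, `|f w| <= g w) ->
  `|Ex f| <= Ex g.
Proof.
move=> hf hg fg; rewrite (le_trans (le_normr_Rintegral _ _))//.
by apply: Ex_le => //; exact: integ_norm.
Qed.

Lemma expectationE (f : T -> R) : integ f -> ('E_P[f] = (Ex f)%:E)%E.
Proof. by move=> hf; rewrite unlock /Rintegral fineK// integrable_fin_num. Qed.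

Variables (k : nat) (X : 'I_k -> T -> R).
Hypothesis mX : forall i, measurable_fun setT (X i).
Local Notation Xv w := (fun i => X i w).

Lemma measurable_lin (a : R) (t : 'I_k -> R) :
  measurable_fun setT (fun w => a + \sum_i t i * X i w).
Proof.
apply: measurable_funD => //; apply: measurable_sum => i.
exact: measurable_funM.
Qed.

Lemma measurable_trigpoly (p : ('I_k -> R) -> R) : trigpoly p ->
  measurable_fun setT (fun w => p (Xv w)).
Proof.
elim=> {p} [a t|f g _ IH1 _ IH2|c f _ IH].
- have mcos := continuous_measurable_fun (@continuous_cos R).
  by apply: (measurableT_comp (f := cos)) => //; exact: measurable_lin.
- exact: measurable_funD.
- exact: measurable_funM.
Qed.

(** The composite is a pointwise limit of trigonometric polynomials of X, the n-th being within 1 /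
    (n+1) of f on the cube of half-width n + 1. *)
Lemma measurable_loc_unif_cont (f : ('I_k -> R) -> R) (M : R) : loc_unif_cont f ->
  (forall x, `|f x| <= M) -> measurable_fun setT (fun w => f (Xv w)).
Proof.
move=> fc fM.
have H n : exists p : ('I_k -> R) -> R, [/\ trigpoly p, forall x, `|p x| <= M &
    forall x, (forall i, `|x i| <= n.+1%:R) -> `|p x - f x| <= n.+1%:R^-1].
  by apply: trig_approx => //; rewrite ?invr_gt0.
have [p hp] := choice H.
apply: (@measurable_fun_cvg _ _ _ _ (fun n w => p n (Xv w))) => //.
  by move=> n; apply: measurable_trigpoly; have [] := hp n.
move=> w _; apply/cvgrPdist_le => e e0.
near=> n.
have [_ _ h] := hp n; rewrite distrC (le_trans (h _ _))//.
  move=> i; rewrite (@le_trans _ _ (\sum_i `|X i w|))//.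
    by rewrite (bigD1 i)//= lerDl sumr_ge0.
  rewrite (@le_trans _ _ n%:R)// ?ler_nat//.
  near: n; exact: nbhs_infty_ger.
rewrite invf_ple ?posrE// (@le_trans _ _ n%:R)// ?ler_nat//.
near: n; exact: nbhs_infty_ger.
Unshelve. all: by end_near. Qed.

(* Markov's inequality enters pointwise, as [1_{Q > K} <= Q / K]. *)
Lemma approx_majorant (f p : ('I_k -> R) -> R) (M L K e : R) (Q : T -> R) :
  (forall x, `|f x| <= M) -> (forall x, `|p x| <= M) -> 0 < K -> 0 <= e ->
  (forall w, 0 <= Q w) ->
  (forall x, (forall i, `|x i| <= L) -> `|p x - f x| <= e) ->
  (forall w, Q w <= K -> forall i, `|X i w| <= L) ->
  forall w, `|p (Xv w) - f (Xv w)| <= e + 2 * M / K * Q w.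
Proof.
move=> fM pM K0 e0 Q0 pf XL w.
have M0 : 0 <= M by apply: le_trans (fM (fun=> 0)); exact: normr_ge0.
have [QK|QK] := leP (Q w) K.
  rewrite (le_trans (pf _ (XL _ QK)))// lerDl mulr_ge0//.
  by rewrite divr_ge0 ?mulr_ge0// ltW.
rewrite (@le_trans _ _ (2 * M))//.
  by rewrite mulr_natl mulr2n (le_trans (ler_normB _ _))// lerD.
rewrite (@le_trans _ _ (2 * M / K * Q w)) ?lerDr//.
by rewrite mulrAC ler_pdivlMr// ler_wpM2l ?mulr_ge0// ltW.
Qed.

(* Factorization against the cosines of linear forms stands for the independence of
   [W] and [X]. *)
Lemma factor_loc_unif_cont (W : T -> R) (B : R) (Q : T -> R)
    (f : ('I_k -> R) -> R) (M : R) :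
  measurable_fun setT W -> (forall w, `|W w| <= B) ->
  integ Q -> (forall w, 0 <= Q w) ->
  (forall K, exists2 L : R, 0 < L & forall w, Q w <= K -> forall i, `|X i w| <= L) ->
  (forall a (t : 'I_k -> R), Ex (fun w => W w * cos (a + \sum_i t i * X i w)) =
     Ex W * Ex (fun w => cos (a + \sum_i t i * X i w))) ->
  loc_unif_cont f -> (forall x, `|f x| <= M) ->
  Ex (fun w => W w * f (Xv w)) = Ex W * Ex (fun w => f (Xv w)).
Proof.
move=> mW WB iQ Q0 tight fac fc fM.
have M0 : 0 <= M by apply: le_trans (fM (fun=> 0)); exact: normr_ge0.
have iW : integ W by exact: bounded_integ WB.
have ib (g : T -> R) (C : R) : measurable_fun setT g -> (forall w, `|g w| <= C) ->
    integ g /\ integ (fun w => W w * g w).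
  move=> mg gC; split; first exact: bounded_integ gC.
  apply: (@bounded_integ _ (B * C)); first exact: measurable_funM.
  by move=> w; rewrite normrM ler_pM.
have tp p : trigpoly p -> Ex (fun w => W w * p (Xv w)) = Ex W * Ex (fun w => p (Xv w)).
  have bp := @trigpoly_bounded R k.
  elim=> {p} [a t|g h tg IH1 th IH2|c g tg IH].
  - exact: fac.
  - have [C1 h1] := bp _ tg; have [C2 h2] := bp _ th.
    have [i1 i1'] := ib _ _ (measurable_trigpoly tg) (fun w => h1 (Xv w)).
    have [i2 i2'] := ib _ _ (measurable_trigpoly th) (fun w => h2 (Xv w)).
    rewrite ExD// mulrDr -IH1 -IH2 -ExD//.
    by apply: Ex_ext => w; rewrite mulrDr.
  - have [C1 h1] := bp _ tg.
    have [i1 i1'] := ib _ _ (measurable_trigpoly tg) (fun w => h1 (Xv w)).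
    rewrite ExZ// mulrCA -IH -ExZ//.
    by apply: Ex_ext => w; rewrite mulrCA.
apply/eqP; rewrite -subr_eq0 -normr_le0; apply/ler_addgt0Pr => e e0; rewrite add0r.
have [if1 if2] := ib _ _ (measurable_loc_unif_cont fc fM) (fun w => fM (Xv w)).
have B0' : 0 <= `|B| by [].
pose q := Ex Q.
have q0 : 0 <= q by exact: Ex_ge0.
(* Replacing [f] by [p] costs at most 2 |B| e1 on either side of the identity; K below is so large
   that the event Q > K contributes at most e1 to the expected error. *)
pose e1 := e / (4 * (`|B| + 1)).
have e10 : 0 < e1 by rewrite divr_gt0// mulr_gt0// ltr_wpDl.
pose K := (2 * M * q + 1) / e1.
have K0 : 0 < K by rewrite divr_gt0// ltr_wpDl// !mulr_ge0.
have [L L0 XL] := tight K.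
have [p [tp' pM pf]] := trig_approx fc fM L0 e10.
have [ip1 ip2] := ib _ _ (measurable_trigpoly tp') (fun w => pM (Xv w)).
have maj := approx_majorant fM pM K0 (ltW e10) Q0 pf XL.
have imaj : integ (fun w => e1 + 2 * M / K * Q w).
  by apply: integD; [exact: integ_cst|exact: integZ].
have majE : Ex (fun w => e1 + 2 * M / K * Q w) <= 2 * e1.
  rewrite ExD; [|exact: integ_cst|exact: integZ].
  rewrite Ex_cst ExZ// -/q (_ : 2 * e1 = e1 + e1); last by ring.
  rewrite lerD2l.
  rewrite mulrAC ler_pdivrMr// /K mulrCA divff ?gt_eqF// mulr1.
  by rewrite lerDl.
have d1 : `|Ex (fun w => p (Xv w)) - Ex (fun w => f (Xv w))| <= 2 * e1.
  rewrite -ExB//; apply: le_trans majE; apply: Ex_norm_le => //.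
  exact: integB.
have d2 : `|Ex (fun w => W w * p (Xv w)) - Ex (fun w => W w * f (Xv w))| <= `|B| * (2 * e1).
  rewrite -ExB//.
  apply: (@le_trans _ _ (Ex (fun w => `|B| * (e1 + 2 * M / K * Q w)))).
    apply: Ex_norm_le; [exact: integB|exact: integZ|] => w.
    rewrite -mulrBr normrM; apply: ler_pM => //.
    exact: le_trans (WB w) (ler_norm _).
  by rewrite ExZ// ler_wpM2l.
have EW : `|Ex W| <= `|B|.
  rewrite -[leRHS]Ex_cst; apply: Ex_norm_le => //; first exact: integ_cst.
  by move=> w; rewrite (le_trans (WB w))// ler_norm.
have -> : Ex (fun w => W w * f (Xv w)) - Ex W * Ex (fun w => f (Xv w)) =
    - (Ex (fun w => W w * p (Xv w)) - Ex (fun w => W w * f (Xv w))) +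
    Ex W * (Ex (fun w => p (Xv w)) - Ex (fun w => f (Xv w))).
  by rewrite (tp p tp'); ring.
rewrite (le_trans (ler_normD _ _))// normrN normrM.
apply: (@le_trans _ _ (`|B| * (2 * e1) + `|B| * (2 * e1))).
  by rewrite lerD// ler_pM.
have -> : e = 4 * (`|B| + 1) * e1 by rewrite mulrC divfK// gt_eqF// mulr_gt0// ltr_wpDl.
by nra.
Qed.

End expectation.

(** * Gaussian spaces and a central limit theorem *)

Section trigonometric_bounds.
Context {R : realType}.
Implicit Types x y u : R.

(** The Taylor bounds below come from |cos| <= 1 by applying this once per derivative; the
    factorials are given up. *)
Lemma MVT_norm_le (f df : R -> R) (B : R) y :
  (forall x : R, is_derive x 1 f (df x)) -> f 0 = 0 ->
  (forall x, `|x| <= `|y| -> `|df x| <= B) -> `|f y| <= B * `|y|.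
Proof.
move=> fd f0 hB.
have fc : continuous f.
  by move=> x; apply/differentiable_continuous/derivable1_diffP; have [] := fd x.
have [y0|y0] := leP 0 y.
- have [c] := MVT_segment y0 (fun x _ => fd x) (continuous_subspaceT fc).
  rewrite in_itv/= => /andP[c0 cy]; rewrite f0 !subr0 => ->.
  rewrite normrM ler_wpM2r// hB// (ger0_norm y0) ger0_norm//.
- have [c] := MVT_segment (ltW y0) (fun x _ => fd x) (continuous_subspaceT fc).
  rewrite in_itv/= => /andP[cy c0]; rewrite f0 !sub0r => /eqP; rewrite eqr_oppLR => /eqP ->.
  rewrite -mulrN opprK normrM ler_wpM2r// hB// (ler0_norm (ltW y0)) ler0_norm//.
  by rewrite lerN2.
Qed.

Lemma sin_norm_le y : `|sin y| <= `|y|.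
Proof.
rewrite -[leRHS]mul1r; apply: (@MVT_norm_le sin cos) => //; first by rewrite sin0.
by move=> x _; exact: cos_max.
Qed.

Lemma cosB1_norm_le y : `|cos y - 1| <= `|y| * `|y|.
Proof.
apply: (@MVT_norm_le (fun y => cos y - 1) (fun x => - sin x)).
- by move=> x; apply: is_derive_eq; ring.
- by rewrite cos0 subrr.
- by move=> x hx; rewrite normrN (le_trans (sin_norm_le x)).
Qed.

Lemma sinB_norm_le y : `|sin y - y| <= `|y| ^+ 3.
Proof.
rewrite (_ : `|y| ^+ 3 = `|y| * `|y| * `|y|); last by ring.
apply: (@MVT_norm_le (fun y => sin y - y) (fun x => cos x - 1)).
- by rewrite sin0 subrr.
- by move=> x hx; rewrite (le_trans (cosB1_norm_le x))// ler_pM.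
Qed.

Lemma cosB_norm_le y : `|cos y - 1 + y ^+ 2 / 2| <= y ^+ 4.
Proof.
rewrite (_ : y ^+ 4 = `|y| ^+ 3 * `|y|); last first.
  by rewrite -exprSr -normrX ger0_norm// exprn_even_ge0.
apply: (@MVT_norm_le (fun y => cos y - 1 + y ^+ 2 / 2) (fun x => - (sin x - x))).
- move=> x; apply: is_derive_eq; rewrite /GRing.scale/=; by field.
- by rewrite cos0 subrr expr0n mul0r addr0.
- move=> x hx; rewrite normrN (le_trans (sinB_norm_le x))// lerXn2r// nnegrE//.
Qed.

Lemma cos_taylor (th y : R) :
  `|cos (th + y) - (cos th - y * sin th - y ^+ 2 / 2 * cos th)| <= `|y| ^+ 3 + y ^+ 4.
Proof.
have -> : cos (th + y) - (cos th - y * sin th - y ^+ 2 / 2 * cos th) =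
   cos th * (cos y - 1 + y ^+ 2 / 2) - sin th * (sin y - y).
  by rewrite cosD; ring.
rewrite (le_trans (ler_normB _ _))// addrC !normrM; apply: lerD.
  by rewrite -[leRHS]mul1r; apply: ler_pM => //; [exact: sin_max|exact: sinB_norm_le].
by rewrite -[leRHS]mul1r; apply: ler_pM => //; [exact: cos_max|exact: cosB_norm_le].
Qed.

Lemma expRN_taylor u : 0 <= u -> `|expR (- u) - (1 - u)| <= u ^+ 2.
Proof.
move=> u0; have h1 := expR_ge1Dx (- u); have h2 := expR_ge1Dx u.
have u1 : 0 < 1 + u by rewrite ltr_pwDl.
have h3 : expR (- u) <= (1 + u)^-1.
  by rewrite expRN lef_pV2 ?posrE ?expR_gt0.
have h4 : (1 + u)^-1 <= 1 - u + u ^+ 2.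
  rewrite -[leLHS]mul1r ler_pdivrMr//.
  have : 0 <= u ^+ 3 by rewrite exprn_ge0.
  by nra.
by rewrite ler_norml; apply/andP; split; nra.
Qed.

Lemma cos_lipschitz x y : `|cos x - cos y| <= `|x - y|.
Proof.
have := @MVT_norm_le (fun z => cos (y + z) - cos y) (fun z => - sin (y + z)) 1 (x - y).
rewrite subrKC mul1r; apply.
- by move=> z; apply: is_derive_eq; ring.
- by rewrite addr0 subrr.
- by move=> z _; rewrite normrN; exact: sin_max.
Qed.

Lemma cos_sinE x : cos (x - pi / 2) = sin x.
Proof. by rewrite -sinDpihalf subrK. Qed.

End trigonometric_bounds.

(** The general quadratic form of a pair of variables, centred when the pair is orthonormal. *)
Definition quad (R : realType) (a b c u v : R) : R :=
  a * (u ^+ 2 - 1) + b * (u * v) + c * (v ^+ 2 - 1).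

(** The form is at most (|a| + |b| + |c|) (1 + u^2 + v^2), and the fourth power of a sum of three
    terms is at most 27 = 3^3 times the sum of the fourth powers. *)
Lemma quad_pow4_le (R : realType) (a b c u v : R) :
  quad a b c u v ^+ 4 <= (27 * (`|a| + `|b| + `|c|) ^+ 4) * (1 + u ^+ 8 + v ^+ 8).
Proof.
pose s := u ^+ 2; pose t := v ^+ 2.
have s0 : 0 <= s by exact: sqr_ge0.
have t0 : 0 <= t by exact: sqr_ge0.
have hq : `|quad a b c u v| <= (`|a| + `|b| + `|c|) * (1 + s + t).
  rewrite /quad !mulrDl; apply: (le_trans (ler_normD _ _)); apply: lerD.
    apply: (le_trans (ler_normD _ _)); apply: lerD; rewrite normrM ler_wpM2l//.
      by rewrite ler_norml -/s; apply/andP; split; lra.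
    rewrite normrM /s /t -(real_normK (num_real (u))) -(real_normK (num_real (v))).
    have := normr_ge0 (u); have := normr_ge0 (v).
    move: `|u| `|v| => p r p0 r0; nra.
  rewrite normrM ler_wpM2l// ler_norml -/t; apply/andP; split; lra.
have h4 : (1 + s + t) ^+ 4 <= 27 * (1 + s ^+ 4 + t ^+ 4).
  have h2 (p r z : R) : (p + r + z) ^+ 2 <= 3 * (p ^+ 2 + r ^+ 2 + z ^+ 2).
    have := sqr_ge0 (p - r); have := sqr_ge0 (p - z); have := sqr_ge0 (r - z); nra.
  have g1 := h2 1 s t; have g2 := h2 1 (s ^+ 2) (t ^+ 2).
  rewrite (_ : (1 + s + t) ^+ 4 = ((1 + s + t) ^+ 2) ^+ 2); last by ring.
  apply: (@le_trans _ _ ((3 * (1 ^+ 2 + s ^+ 2 + t ^+ 2)) ^+ 2)).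
    by rewrite lerXn2r// ?nnegrE ?sqr_ge0// mulr_ge0// !addr_ge0// sqr_ge0.
  by rewrite exprMn; move: g2; rewrite -!exprM !expr1n; lra.
rewrite (_ : quad a b c u v ^+ 4 = `|quad a b c u v| ^+ 4); last first.
  by rewrite -normrX ger0_norm// exprn_even_ge0.
apply: (@le_trans _ _ (((`|a| + `|b| + `|c|) * (1 + s + t)) ^+ 4)).
  by rewrite lerXn2r// ?nnegrE// mulr_ge0// ?addr_ge0.
have m0 : 0 <= `|a| + `|b| + `|c| by rewrite !addr_ge0.
rewrite exprMn; move: (_ + `|c|) m0 => m m0.
rewrite (_ : 27 * m ^+ 4 * _ = m ^+ 4 * (27 * (1 + s ^+ 4 + t ^+ 4))).
  by rewrite ler_wpM2l// exprn_ge0.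
by rewrite /s /t; ring.
Qed.

Section gaussian_space.
Context {R : realType} d (T : measurableType d) (P : probability T R).
Local Notation Ex f := (Rintegral P setT f).
Local Notation integ f := (P.-integrable setT (EFin \o f)).

(** Closure under linear combinations is what turns normality of single variables into joint
    normality, so that orthogonality can stand for independence. *)
Definition gaussian_space (H : (T -> R) -> Prop) : Prop :=
  (forall (a b : R) U V, H U -> H V -> H (fun w => a * U w + b * V w)) /\
  (forall U, H U -> measurable_fun setT U /\ exists2 v : R, 0 <= v &
     forall A : set R, measurable A -> P (U @^-1` A) = gaussian_law 0 v A).

Variable H : (T -> R) -> Prop.
Hypothesis gH : gaussian_space H.

Lemma gs_lin (a b : R) U V : H U -> H V -> H (fun w => a * U w + b * V w).
Proof. exact: gH.1. Qed.

Lemma gs_add U V : H U -> H V -> H (fun w => U w + V w).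
Proof.
move=> hU hV; have := gs_lin 1 1 hU hV.
by congr H; apply/funext => w; rewrite !mul1r.
Qed.

Lemma gs_meas U : H U -> measurable_fun setT U.
Proof. by move=> /gH.2[]. Qed.

Lemma gs_facts U : H U ->
  [/\ forall k, integ (fun w => U w ^+ k),
      Ex U = 0, 0 <= Ex (fun w => U w ^+ 2),
      forall k, Ex (fun w => U w ^+ k.+2) =
        k.+1%:R * Ex (fun w => U w ^+ 2) * Ex (fun w => U w ^+ k)
    & forall ph, Ex (fun w => cos (ph + U w)) =
        cos ph * expR (- (Ex (fun w => U w ^+ 2) / 2))].
Proof.
move=> hU; have [mU [v v0 hv]] := gH.2 U hU.
have [h1 h2 h3 h4] := gaussian_moments mU v0 hv.
have E (k : nat) : (fun w => (U w - 0) ^+ k) = (fun w => U w ^+ k).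
  by apply/funext => w; rewrite subr0.
have vE : Ex (fun w => U w ^+ 2) = v.
  have := h3 0%N; rewrite !E => ->.
  by rewrite mul1r -[RHS]mulr1; congr (_ * _); exact: Ex_cst.
split.
- by move=> k; rewrite -E.
- by move: h2; under eq_Rintegral do rewrite subr0.
- by rewrite vE.
- by move=> k; rewrite vE; have := h3 k; rewrite !E.
- by move=> ph; rewrite vE -h4; apply: Ex_ext => w; rewrite subr0.
Qed.

Lemma gs_integX U k : H U -> integ (fun w => U w ^+ k).
Proof. by move=> /gs_facts[]. Qed.

Lemma gs_integ U : H U -> integ U.
Proof. by move=> /(gs_integX 1); apply: integ_ext => w; rewrite expr1. Qed.

Lemma gs_mean U : H U -> Ex U = 0. Proof. by move=> /gs_facts[]. Qed.

Lemma gs_moment4 U : H U -> Ex (fun w => U w ^+ 4) = 3 * Ex (fun w => U w ^+ 2) ^+ 2.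
Proof. by move=> /gs_facts[_ _ _ h _]; rewrite (h 2); ring. Qed.

Lemma gs_moment8 U : H U -> Ex (fun w => U w ^+ 8) = 105 * Ex (fun w => U w ^+ 2) ^+ 4.
Proof. by move=> /gs_facts[_ _ _ h _]; rewrite (h 6) (h 4) (h 2); ring. Qed.

Lemma gs_cos U ph : H U ->
  Ex (fun w => cos (ph + U w)) = cos ph * expR (- (Ex (fun w => U w ^+ 2) / 2)).
Proof. by move=> /gs_facts[]. Qed.

Lemma gs_integM U V : H U -> H V -> integ (fun w => U w * V w).
Proof.
move=> hU hV; apply: (integ_dom (g := fun w => U w ^+ 2 + V w ^+ 2)).
- by apply: measurable_funM; exact: gs_meas.
- by apply: integD; exact: gs_integX.
- move=> w; rewrite normrM -[U w ^+ 2]real_normK ?num_real// -[V w ^+ 2]real_normK ?num_real//.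
  have := normr_ge0 (U w); have := normr_ge0 (V w); nra.
Qed.

Lemma gs_cov_lin (a b : R) U V W : H U -> H V -> H W ->
  Ex (fun w => (a * U w + b * V w) * W w) =
  a * Ex (fun w => U w * W w) + b * Ex (fun w => V w * W w).
Proof.
move=> hU hV hW; rewrite -!ExZ; [|exact: gs_integM..].
rewrite -ExD; [|apply: integZ; exact: gs_integM..].
by apply: Ex_ext => w; ring.
Qed.

Lemma gs_sqr_lin (a b : R) U V : H U -> H V ->
  Ex (fun w => (a * U w + b * V w) ^+ 2) =
  a ^+ 2 * Ex (fun w => U w ^+ 2) + 2 * a * b * Ex (fun w => U w * V w)
  + b ^+ 2 * Ex (fun w => V w ^+ 2).
Proof.
move=> hU hV.
have i1 := gs_integX 2 hU; have i2 := gs_integX 2 hV; have i3 := gs_integM hU hV.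
rewrite -!ExZ// -!ExD; [|by repeat (apply: integD || apply: integZ)..].
by apply: Ex_ext => w; ring.
Qed.

(** Isserlis' formula by polarization: (U + V)^4 + (U - V)^4 = 2 U^4 + 12 U^2 V^2 + 2 V^4, and
    fourth moments are 3 times the squared variance. *)
Lemma gs_sqr2 U V : H U -> H V ->
  integ (fun w => U w ^+ 2 * V w ^+ 2) /\
  Ex (fun w => U w ^+ 2 * V w ^+ 2) =
  Ex (fun w => U w ^+ 2) * Ex (fun w => V w ^+ 2) + 2 * Ex (fun w => U w * V w) ^+ 2.
Proof.
move=> hU hV.
have h1 := gs_lin 1 1 hU hV; have h2 := gs_lin 1 (-1) hU hV.
have E1 := gs_moment4 h1; have E2 := gs_moment4 h2.
have i1 := gs_integX 4 h1; have i2 := gs_integX 4 h2.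
have i3 := gs_integX 4 hU; have i4 := gs_integX 4 hV.
rewrite (gs_sqr_lin _ _ hU hV) in E1.
rewrite (gs_sqr_lin _ _ hU hV) in E2.
have F : (fun w => U w ^+ 2 * V w ^+ 2) = (fun w => 12^-1 *
   (((1 * U w + 1 * V w) ^+ 4 + (1 * U w + -1 * V w) ^+ 4) - 2 * (U w ^+ 4 + V w ^+ 4))).
  by apply/funext => w; field.
have i5 : integ (fun w => 2 * (U w ^+ 4 + V w ^+ 4)) by apply/integZ/integD.
have i6 := integD i1 i2.
split; first by rewrite F; apply/integZ/integB.
rewrite F ExZ; last exact: integB.
rewrite ExB// ExD// ExZ; last exact: integD.
rewrite ExD// E1 E2 !gs_moment4//.
by field.
Qed.

Lemma gs_sqr_orth U V : H U -> H V -> Ex (fun w => U w * V w) = 0 ->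
  Ex (fun w => (U w + V w) ^+ 2) = Ex (fun w => U w ^+ 2) + Ex (fun w => V w ^+ 2).
Proof.
move=> hU hV uv; have := gs_sqr_lin 1 1 hU hV; rewrite uv.
rewrite !expr1n !mul1r mulr0 addr0 => <-.
by apply: Ex_ext => w; rewrite !mul1r.
Qed.

(** * A central limit theorem with rate for quadratic forms of orthonormal Gaussian pairs *)

Section block_sums.
Variables (x y : nat -> T -> R) (N : nat).
Hypothesis Hx : forall i, H (x i).
Hypothesis Hy : forall i, H (y i).
Hypothesis xx : forall i j, (i < N)%N -> (j < N)%N ->
  Ex (fun w => x i w * x j w) = (i == j)%:R.
Hypothesis yy : forall i j, (i < N)%N -> (j < N)%N ->
  Ex (fun w => y i w * y j w) = (i == j)%:R.
Hypothesis xy : forall i j, (i < N)%N -> (j < N)%N ->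
  Ex (fun w => x i w * y j w) = 0.

Let ExC (U V : T -> R) : Ex (fun w => U w * V w) = Ex (fun w => V w * U w).
Proof. by apply: Ex_ext => w; rewrite mulrC. Qed.

Let sqrE (U : T -> R) : (fun w : T => U w ^+ 2) = (fun w => U w * U w).
Proof. by apply/funext => w; rewrite expr2. Qed.

Section sums.
Variables (a b c e : R).

Definition blockS (i : nat) (w : T) : R := \sum_(j < i) e * quad a b c (x j w) (y j w).

Lemma measurable_quad i : measurable_fun setT (fun w => quad a b c (x i w) (y i w)).
Proof.
have mx := gs_meas (Hx i); have my := gs_meas (Hy i).
rewrite /quad; repeat apply: measurable_funD; apply: measurable_funM => //.
- by apply: measurable_funB => //; exact: measurable_funX.
- exact: measurable_funM.
- by apply: measurable_funB => //; exact: measurable_funX.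
Qed.

Lemma measurable_blockS i : measurable_fun setT (blockS i).
Proof.
by apply: measurable_sum => j; apply: measurable_funM => //; exact: measurable_quad.
Qed.

Let mcos (f : T -> R) : measurable_fun setT f -> measurable_fun setT (fun w => cos (f w)).
Proof.
move=> mf; have mc := continuous_measurable_fun (@continuous_cos R).
exact: (measurableT_comp (f := cos)).
Qed.

Let icos (f : T -> R) : measurable_fun setT f -> integ (fun w => cos (f w)).
Proof. by move=> mf; apply: (@bounded_integ _ _ _ _ _ 1) (mcos mf) _ => w; exact: cos_max. Qed.

Let icos2 (f g : T -> R) : measurable_fun setT f -> measurable_fun setT g ->
  integ (fun w => cos (f w) * cos (g w)).
Proof.
move=> mf mg; apply: (@bounded_integ _ _ _ _ _ 1).
  by apply: measurable_funM; exact: mcos.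
by move=> w; rewrite normrM -[leRHS]mulr1; apply: ler_pM => //; exact: cos_max.
Qed.

Let pairX i (k : 'I_2) : T -> R := if k == 0 then x i else y i.

Let loc_unif_cont_cos_quad (ph : R) :
  loc_unif_cont (fun v : 'I_2 -> R => cos (ph + e * quad a b c (v 0) (v 1))).
Proof.
move=> L eps eps0.
pose B : R := `|L| + 1.
have B1 : 1 <= B by rewrite lerDr.
pose K : R := `|e| * ((`|a| + `|b| + `|c|) * (2 * B)) + 1.
have K0 : 0 < K by rewrite ltr_wpDl// !mulr_ge0 ?addr_ge0// (le_trans ler01).
exists (Num.min 1 (eps / K)); first by rewrite lt_min ltr01 divr_gt0.
move=> u v uL uv.
have dd i : `|v i - u i| <= eps / K /\ `|u i| <= B /\ `|v i| <= B.
  have := uv i; rewrite lt_min => /andP[h1 h2]; split; first exact: ltW.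
  have h3 : `|u i| <= `|L| by rewrite (le_trans (uL i))// ler_norm.
  split; first by rewrite /B (le_trans h3)// lerDl.
  rewrite -(subrK (u i) (v i)) (le_trans (ler_normD _ _))// /B addrC lerD// ltW//.
rewrite (le_trans (cos_lipschitz _ _))//.
have -> : ph + e * quad a b c (v 0) (v 1) - (ph + e * quad a b c (u 0) (u 1)) =
  e * (a * ((v 0 - u 0) * (v 0 + u 0)) + b * ((v 0 - u 0) * v 1 + u 0 * (v 1 - u 1))
   + c * ((v 1 - u 1) * (v 1 + u 1))).
  by rewrite /quad; ring.
have [d0 [u0 v0]] := dd 0; have [d1 [u1 v1]] := dd 1.
have dB (p q r : R) : `|p| <= eps / K -> `|q| <= B -> `|r| <= B ->
   `|p * (q + r)| <= 2 * B * (eps / K).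
  move=> hp hq hr; rewrite normrM mulrC; apply: ler_pM => //.
  by rewrite (le_trans (ler_normD _ _))// mulr_natl mulr2n lerD.
have h1 := dB _ _ _ d0 v0 u0.
have h3 := dB _ _ _ d1 v1 u1.
have h2 : `|(v 0 - u 0) * v 1 + u 0 * (v 1 - u 1)| <= 2 * B * (eps / K).
  rewrite (le_trans (ler_normD _ _))//.
  rewrite (_ : 2 * B * (eps / K) = eps / K * B + B * (eps / K)); last by ring.
  by rewrite !normrM; apply: lerD; apply: ler_pM.
rewrite normrM.
apply: (@le_trans _ _ (`|e| * ((`|a| + `|b| + `|c|) * (2 * B * (eps / K))))).
  rewrite ler_wpM2l// (le_trans (ler_normD _ _))//.
  rewrite [leRHS]mulrDl; apply: lerD; last by rewrite normrM ler_wpM2l.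
  rewrite (le_trans (ler_normD _ _))//.
  by rewrite [leRHS]mulrDl; apply: lerD; rewrite normrM ler_wpM2l.
have -> : `|e| * ((`|a| + `|b| + `|c|) * (2 * B * (eps / K))) = eps * ((K - 1) / K).
  by rewrite /K; ring.
apply: ler_piMr; first exact: ltW.
by rewrite ler_pdivrMr// mul1r gerBl.
Qed.

Let blockSS i w : blockS i.+1 w = blockS i w + e * quad a b c (x i w) (y i w).
Proof. by rewrite /blockS big_ord_recr. Qed.

(** Independence of the first i pairs from every Gaussian V orthogonal to them, in the only form
    used: the cosine of V contributes exp(-E V^2 / 2), the sine contributes 0 by symmetry. *)
Definition indep_until i := forall V ph, H V ->
  (forall j, (j < i)%N -> Ex (fun w => V w * x j w) = 0 /\ Ex (fun w => V w * y j w) = 0) ->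
  Ex (fun w => cos (ph + blockS i w + V w)) =
  Ex (fun w => cos (ph + blockS i w)) * expR (- (Ex (fun w => V w ^+ 2) / 2)).

(** It suffices to test the pair i with the cosines of U = t_0 x_i + t_1 y_i. The product of cosines
    is half the sum of two cosines containing V + U and V - U; both are orthogonal to the earlier
    pairs, and both have variance E V^2 + E U^2 because V and U are orthogonal. *)
Let block_factor i V ph ph' : (i < N)%N -> indep_until i -> H V ->
  (forall j, (j < i.+1)%N -> Ex (fun w => V w * x j w) = 0 /\ Ex (fun w => V w * y j w) = 0) ->
  Ex (fun w => cos (ph + blockS i w + V w) * cos (ph' + e * quad a b c (x i w) (y i w))) =
  Ex (fun w => cos (ph + blockS i w + V w)) * Ex (fun w => cos (ph' + e * quad a b c (x i w) (y i w))).
Proof.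
move=> iN IH hV Vo.
have mS := measurable_blockS i.
have mV := gs_meas hV.
have mX (k : 'I_2) : measurable_fun setT (pairX i k).
  by rewrite /pairX; case: ifP => _; exact: gs_meas.
have mW (q : R) : measurable_fun setT (fun w => q + blockS i w + V w).
  by apply: measurable_funD => //; exact: measurable_funD.
apply: (@factor_loc_unif_cont _ _ _ _ _ (pairX i) mX (fun w => cos (ph + blockS i w + V w)) 1
  (fun w => x i w ^+ 2 + y i w ^+ 2) (fun v => cos (ph' + e * quad a b c (v 0) (v 1))) 1).
- exact: mcos.
- by move=> w; exact: cos_max.
- by apply: integD; exact: gs_integX.
- by move=> w; rewrite addr_ge0 ?sqr_ge0.
- move=> K; exists (`|K| + 1); first by rewrite ltr_wpDl.
  move=> w hK k; have := ler_norm K; rewrite /pairX; case: ifP => _ h.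
  + by rewrite ler_norml; apply/andP; split; nra.
  + by rewrite ler_norml; apply/andP; split; nra.
- move=> ph2 t.
  have tE w : \sum_k t k * pairX i k w = t 0 * x i w + t 1 * y i w.
    by rewrite big_ord_recl big_ord1 /pairX/=; congr (_ + t _ * _); exact: val_inj.
  under eq_Rintegral do rewrite tE.
  under [X in _ = _ * X]eq_Rintegral do rewrite tE.
  pose U w := t 0 * x i w + t 1 * y i w.
  have hU : H U by exact: gs_lin.
  have mU := gs_meas hU.
  have UV0 : Ex (fun w => V w * U w) = 0.
    rewrite ExC gs_cov_lin//; have [h1 h2] := Vo i (ltnSn i).
    by rewrite ExC h1 [X in _ + _ * X]ExC h2 !mulr0 addr0.
  have Uo j : (j < i)%N -> Ex (fun w => U w * x j w) = 0 /\ Ex (fun w => U w * y j w) = 0.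
    move=> ji; have jN := ltn_trans ji iN; have ij : (i == j) = false by rewrite gtn_eqF.
    rewrite !gs_cov_lin// xx// yy// xy// ij; split; first by rewrite ExC xy// !mulr0 addr0.
    by rewrite !mulr0 addr0.
  have Vo' j : (j < i)%N -> Ex (fun w => V w * x j w) = 0 /\ Ex (fun w => V w * y j w) = 0.
    by move=> ji; apply: Vo; rewrite ltnS ltnW.
  have half : Ex (fun w => cos (ph + blockS i w + V w) * cos (ph2 + U w)) =
     2^-1 * (Ex (fun w => cos (ph + ph2 + blockS i w + (1 * V w + 1 * U w))) +
             Ex (fun w => cos (ph - ph2 + blockS i w + (1 * V w + -1 * U w)))).
    have m1 s q : measurable_fun setT (fun w => q + blockS i w + (1 * V w + s * U w)).
      apply: measurable_funD; first exact: measurable_funD.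
      by apply: gs_meas; exact: gs_lin.
    rewrite -ExD; [|exact: icos..]; rewrite -ExZ; last by apply: integD; exact: icos.
    apply: Ex_ext => w.
    rewrite (_ : ph + ph2 + blockS i w + (1 * V w + 1 * U w) =
      (ph + blockS i w + V w) + (ph2 + U w)); last by ring.
    rewrite (_ : ph - ph2 + blockS i w + (1 * V w + -1 * U w) =
      (ph + blockS i w + V w) - (ph2 + U w)); last by ring.
    by move: (ph + _ + V w) (ph2 + U w) => A B; rewrite cosD cosB; field.
  rewrite -/(U _) [LHS]half.
  have orth s : forall j, (j < i)%N -> Ex (fun w => (1 * V w + s * U w) * x j w) = 0 /\
      Ex (fun w => (1 * V w + s * U w) * y j w) = 0.
    move=> j ji; have [h1 h2] := Uo j ji; have [h3 h4] := Vo' j ji.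
    rewrite (gs_cov_lin 1 s hV hU (Hx j)) (gs_cov_lin 1 s hV hU (Hy j)).
    by rewrite h1 h2 h3 h4 !mulr0 addr0.
  rewrite (IH _ (ph + ph2) (gs_lin 1 1 hV hU) (orth 1)).
  rewrite (IH _ (ph - ph2) (gs_lin 1 (-1) hV hU) (orth (-1))) (IH V ph hV Vo').
  rewrite !(gs_sqr_lin _ _ hV hU) UV0 !mulr0 !addr0 sqrrN !expr1n !mul1r.
  rewrite -mulrDl (gs_cos ph2 hU).
  have CC : Ex (fun w => cos (ph + ph2 + blockS i w)) + Ex (fun w => cos (ph - ph2 + blockS i w)) =
     2 * cos ph2 * Ex (fun w => cos (ph + blockS i w)).
    have m1 q : measurable_fun setT (fun w => q + blockS i w) by exact: measurable_funD.
    rewrite -ExD; [|exact: icos..]; rewrite -ExZ; last exact: icos.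
    apply: Ex_ext => w.
    rewrite (_ : ph + ph2 + blockS i w = (ph + blockS i w) + ph2); last by ring.
    rewrite (_ : ph - ph2 + blockS i w = (ph + blockS i w) - ph2); last by ring.
    by move: (ph + _) => A; rewrite cosD cosB; ring.
  rewrite CC; move: (Ex _) (Ex (fun w => V w ^+ 2)) (Ex (fun w => U w ^+ 2)) => C v u.
  by rewrite [(v + u) / 2]mulrDl opprD expRD; field.
- exact: loc_unif_cont_cos_quad.
- by move=> v; exact: cos_max.
Qed.

(** The addition formula of the cosine. Sines are written as cosines with phase shifted by -pi / 2,
    so that the factorization applies to both products. *)
Let step_expand i V ph : (i < N)%N -> indep_until i -> H V ->
  (forall j, (j < i.+1)%N -> Ex (fun w => V w * x j w) = 0 /\ Ex (fun w => V w * y j w) = 0) ->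
  Ex (fun w => cos (ph + blockS i.+1 w + V w)) =
  Ex (fun w => cos (ph + blockS i w + V w)) * Ex (fun w => cos (0 + e * quad a b c (x i w) (y i w)))
  - Ex (fun w => cos (ph - pi / 2 + blockS i w + V w)) *
    Ex (fun w => cos (- (pi / 2) + e * quad a b c (x i w) (y i w))).
Proof.
move=> iN IH hV Vo; rewrite -!block_factor//.
have mS := measurable_blockS i; have mV := gs_meas hV; have mq := measurable_quad i.
have m1 q : measurable_fun setT (fun w => q + blockS i w + V w).
  by apply: measurable_funD => //; exact: measurable_funD.
have m2 q : measurable_fun setT (fun w => q + e * quad a b c (x i w) (y i w)).
  by apply: measurable_funD => //; exact: measurable_funM.
rewrite -ExB; [|exact: icos2..].
apply: Ex_ext => w; rewrite blockSS add0r.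
rewrite (_ : ph - pi / 2 + blockS i w + V w = (ph + blockS i w + V w) - pi / 2); last by ring.
by rewrite (addrC (- (pi / 2)) (e * _)) !cos_sinE -cosD; congr cos; ring.
Qed.

Let H0 : H (fun=> 0).
Proof.
have := gs_lin 0 0 (Hx 0%N) (Hx 0%N); congr H; apply/funext => w; by rewrite !mul0r addr0.
Qed.

(** Expanded by [step_expand], the expectations with V and with V = 0 have the same shape, and by
    induction each term of the former is exp(-E V^2 / 2) times that of the latter. *)
Lemma blockS_indep i : (i <= N)%N -> indep_until i.
Proof.
elim: i => [_ V ph hV _|i IH iN V ph hV Vo].
  have E w : blockS 0 w = 0 by rewrite /blockS big_ord0.
  under eq_Rintegral do rewrite E addr0.
  under [X in _ = X * _]eq_Rintegral do rewrite E addr0.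
  by rewrite gs_cos// Ex_cst.
have {}IH := IH (ltnW iN).
have V0 j : (j < i.+1)%N -> Ex (fun w => 0 * x j w) = 0 /\ Ex (fun w => 0 * y j w) = 0.
  by split; under eq_Rintegral do rewrite mul0r; exact: Ex_cst.
have := @step_expand i _ ph iN IH H0 V0.
under eq_Rintegral do rewrite addr0.
under [X in _ = X * _ - _]eq_Rintegral do rewrite addr0.
under [X in _ = _ - X * _]eq_Rintegral do rewrite addr0.
move=> ->.
have Vo' j : (j < i)%N -> Ex (fun w => V w * x j w) = 0 /\ Ex (fun w => V w * y j w) = 0.
  by move=> ji; apply: Vo; rewrite ltnS ltnW.
rewrite step_expand// !IH//; ring.
Qed.

Lemma blockS_rec i ph : (i < N)%N ->
  Ex (fun w => cos (ph + blockS i.+1 w)) =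
  Ex (fun w => cos (ph + blockS i w)) * Ex (fun w => cos (0 + e * quad a b c (x i w) (y i w)))
  - Ex (fun w => cos (ph - pi / 2 + blockS i w)) *
    Ex (fun w => cos (- (pi / 2) + e * quad a b c (x i w) (y i w))).
Proof.
move=> iN; have IH := blockS_indep (ltnW iN).
have V0 j : (j < i.+1)%N -> Ex (fun w => 0 * x j w) = 0 /\ Ex (fun w => 0 * y j w) = 0.
  by split; under eq_Rintegral do rewrite mul0r; exact: Ex_cst.
have := @step_expand i _ ph iN IH H0 V0.
under eq_Rintegral do rewrite addr0.
under [X in _ = X * _ - _]eq_Rintegral do rewrite addr0.
by under [X in _ = _ - X * _]eq_Rintegral do rewrite addr0.
Qed.

End sums.

(** The mixed moments E x^3 y and E x y^3 come from Isserlis' formula for x or y paired with x + y.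
    In the last bound 105 is the eighth moment of a standard normal variable. *)
Lemma quad_moments (a b c : R) i : (i < N)%N ->
  let q := fun w => quad a b c (x i w) (y i w) in
  [/\ [/\ integ q, integ (fun w => q w ^+ 2) & integ (fun w => q w ^+ 4)],
      Ex q = 0, Ex (fun w => q w ^+ 2) = 2 * a ^+ 2 + b ^+ 2 + 2 * c ^+ 2
    & Ex (fun w => q w ^+ 4) <= (27 * (1 + 105 + 105)) * (`|a| + `|b| + `|c|) ^+ 4].
Proof.
move=> iN q.
have hx := Hx i; have hy := Hy i.
have x2 : Ex (fun w => x i w ^+ 2) = 1 by rewrite sqrE xx// eqxx.
have y2 : Ex (fun w => y i w ^+ 2) = 1 by rewrite sqrE yy// eqxx.
have xy0 := xy iN iN.
have ix2 := gs_integX 2 hx; have iy2 := gs_integX 2 hy.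
have ix4 := gs_integX 4 hx; have iy4 := gs_integX 4 hy.
have ix8 := gs_integX 8 hx; have iy8 := gs_integX 8 hy.
have ixy := gs_integM hx hy.
have x4 := gs_moment4 hx; rewrite x2 in x4.
have y4 := gs_moment4 hy; rewrite y2 in y4.
have x8 := gs_moment8 hx; rewrite x2 in x8.
have y8 := gs_moment8 hy; rewrite y2 in y8.
have [ix2y2 x2y2] := gs_sqr2 hx hy; rewrite x2 y2 xy0 in x2y2.
have hz := gs_add hx hy.
have z2 : Ex (fun w => (x i w + y i w) ^+ 2) = 2 by rewrite gs_sqr_orth// x2 y2.
have xz : Ex (fun w => x i w * (x i w + y i w)) = 1.
  transitivity (Ex (fun w => x i w ^+ 2 + x i w * y i w)); first by apply: Ex_ext => w; ring.
  by rewrite ExD// x2 xy0 addr0.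
have yz : Ex (fun w => y i w * (x i w + y i w)) = 1.
  transitivity (Ex (fun w => y i w ^+ 2 + x i w * y i w)); first by apply: Ex_ext => w; ring.
  by rewrite ExD// y2 xy0 addr0.
have [ixz x2z2] := gs_sqr2 hx hz; rewrite x2 z2 xz in x2z2.
have [iyz y2z2] := gs_sqr2 hy hz; rewrite y2 z2 yz in y2z2.
have E31 : (fun w => x i w ^+ 3 * y i w) = (fun w => 2^-1 *
    (x i w ^+ 2 * (x i w + y i w) ^+ 2 - (x i w ^+ 4 + x i w ^+ 2 * y i w ^+ 2))).
  by apply/funext => w; field.
have E13 : (fun w => x i w * y i w ^+ 3) = (fun w => 2^-1 *
    (y i w ^+ 2 * (x i w + y i w) ^+ 2 - (y i w ^+ 4 + x i w ^+ 2 * y i w ^+ 2))).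
  by apply/funext => w; field.
have i31 : integ (fun w => x i w ^+ 3 * y i w).
  by rewrite E31; apply/integZ/integB => //; exact: integD.
have i13 : integ (fun w => x i w * y i w ^+ 3).
  by rewrite E13; apply/integZ/integB => //; exact: integD.
have x3y : Ex (fun w => x i w ^+ 3 * y i w) = 0.
  rewrite E31 ExZ; last by apply: integB => //; exact: integD.
  rewrite ExB//; last exact: integD.
  by rewrite ExD// x2z2 x4 x2y2; field.
have xy3 : Ex (fun w => x i w * y i w ^+ 3) = 0.
  rewrite E13 ExZ; last by apply: integB => //; exact: integD.
  rewrite ExB//; last exact: integD.
  by rewrite ExD// y2z2 y4 x2y2; field.
have i1 := integ_cst P 1.
have qE : q = (fun w => a * x i w ^+ 2 + b * (x i w * y i w) + c * y i w ^+ 2 + (- (a + c)) * 1).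
  by apply/funext => w; rewrite /q /quad; ring.
have q2E : (fun w => q w ^+ 2) = (fun w => a ^+ 2 * x i w ^+ 4 +
   (b ^+ 2 + 2 * a * c) * (x i w ^+ 2 * y i w ^+ 2) + c ^+ 2 * y i w ^+ 4 +
   2 * a * b * (x i w ^+ 3 * y i w) + 2 * b * c * (x i w * y i w ^+ 3) +
   (- 2 * a * (a + c)) * x i w ^+ 2 + (- 2 * c * (a + c)) * y i w ^+ 2 +
   (- 2 * b * (a + c)) * (x i w * y i w) + (a + c) ^+ 2 * 1).
  by apply/funext => w; rewrite /q /quad; ring.
have iq2 : integ (fun w => q w ^+ 2).
  by rewrite q2E; repeat first [assumption | apply: integD | apply: integZ].
have bnd8 w : q w ^+ 4 <= (27 * (`|a| + `|b| + `|c|) ^+ 4) * (1 + x i w ^+ 8 + y i w ^+ 8).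
  exact: quad_pow4_le.
have i8 : integ (fun w => (27 * (`|a| + `|b| + `|c|) ^+ 4) * (1 + x i w ^+ 8 + y i w ^+ 8)).
  by repeat first [assumption | apply: integD | apply: integZ].
have mq : measurable_fun setT q by exact: measurable_quad.
have iq4 : integ (fun w => q w ^+ 4).
  apply: integ_dom i8 _; first exact: measurable_funX.
  by move=> w; rewrite ger0_norm// exprn_even_ge0.
split; [split => // | | | ].
- by rewrite qE; repeat first [assumption | apply: integD | apply: integZ].
- rewrite qE !ExD; [|by repeat first [assumption | apply: integD | apply: integZ]..].
  by rewrite !ExZ// x2 y2 xy0 Ex_cst; ring.
- rewrite q2E !ExD; [|by repeat first [assumption | apply: integD | apply: integZ]..].
  by rewrite !ExZ// x2 y2 xy0 x3y xy3 x2y2 x4 y4 Ex_cst; ring.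
- apply: (le_trans (Ex_le iq4 i8 bnd8)).
  rewrite ExZ; last by repeat first [assumption | apply: integD].
  rewrite !ExD//; last exact: integD.
  by rewrite Ex_cst x8 y8 le_eqVlt; apply/orP; left; apply/eqP; ring.
Qed.

(** Built from the variance s2 of the form and the bound M4 for its fourth moment, as 2 (s2 + 2 M4 +
    s2^2). The outer 2 counts the two products of the recursion. *)
Definition clt_const (a b c : R) : R :=
  2 * (2 * a ^+ 2 + b ^+ 2 + 2 * c ^+ 2 + 2 * ((27 * (1 + 105 + 105)) * (`|a| + `|b| + `|c|) ^+ 4) +
  (2 * a ^+ 2 + b ^+ 2 + 2 * c ^+ 2) ^+ 2).

(** Each pair multiplies the expected cosine by r = exp(-s2 / (2 N)) up to an error of order
    N^(-3/2), by a Taylor expansion to second order; over N pairs the errors add up to order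
    N^(-1/2). *)
Lemma clt_blockS (a b c ph : R) : (0 < N)%N ->
  `|Ex (fun w => cos (ph + blockS a b c (Num.sqrt N%:R)^-1 N w)) -
    cos ph * expR (- ((2 * a ^+ 2 + b ^+ 2 + 2 * c ^+ 2) / 2))| <=
  clt_const a b c / Num.sqrt N%:R.
Proof.
move=> N0.
pose s2 : R := 2 * a ^+ 2 + b ^+ 2 + 2 * c ^+ 2.
have s20 : 0 <= s2.
  by rewrite /s2; have := sqr_ge0 a; have := sqr_ge0 b; have := sqr_ge0 c; lra.
pose e : R := (Num.sqrt N%:R)^-1.
have sN0 : 0 < Num.sqrt N%:R :> R by rewrite sqrtr_gt0 ltr0n.
have e0 : 0 < e by rewrite invr_gt0.
have e1 : e <= 1.
  rewrite invf_le1//.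
  by rewrite -[X in X <= _]sqrtr1 ler_sqrt ?ler1n// ltr0n.
have Ne2 : N%:R * e ^+ 2 = 1.
  by rewrite exprVn sqr_sqrtr// divff// pnatr_eq0 -lt0n.
pose M4 : R := (27 * (1 + 105 + 105)) * (`|a| + `|b| + `|c|) ^+ 4.
have M40 : 0 <= M4 by rewrite mulr_ge0// exprn_ge0// !addr_ge0.
pose K := s2 + 2 * M4 + s2 ^+ 2.
pose r := expR (- (e ^+ 2 * s2 / 2)).
have u0 : 0 <= e ^+ 2 * s2 / 2 by rewrite divr_ge0// mulr_ge0// sqr_ge0.
have r1 : `|r| <= 1 by rewrite ger0_norm ?expR_ge0// -expR0 ler_expR oppr_le0.
have key th i : (i < N)%N ->
  `|Ex (fun w => cos (th + e * quad a b c (x i w) (y i w))) - cos th * r| <= e ^+ 3 * K.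
  move=> iN; have [[iq iq2 iq4] q1 q2 q4] := quad_moments a b c iN.
  pose q w := quad a b c (x i w) (y i w).
  have mq : measurable_fun setT q by exact: measurable_quad.
  pose g w := cos th - (e * q w) * sin th - (e * q w) ^+ 2 / 2 * cos th.
  have gE : g = (fun w => cos th * 1 + (- e * sin th) * q w + (- e ^+ 2 * cos th / 2) * q w ^+ 2).
    by apply/funext => w; rewrite /g; field.
  have ig : integ g.
    by rewrite gE; repeat first [assumption | apply: integ_cst | apply: integD | apply: integZ].
  have Eg : Ex g = cos th * (1 - e ^+ 2 * s2 / 2).
    rewrite gE !ExD; [|by repeat first [assumption | apply: integ_cst | apply: integD | apply: integZ]..].
    by rewrite !ExZ//; [rewrite Ex_cst q1 q2 -/s2; field|exact: integ_cst].
  have mc : measurable_fun setT (fun w => cos (th + e * q w)).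
    have mc := continuous_measurable_fun (@continuous_cos R).
    by apply: (measurableT_comp (f := cos)) => //; apply: measurable_funD => //; exact: measurable_funM.
  have ic : integ (fun w => cos (th + e * q w)).
    by apply: (@bounded_integ _ _ _ P _ 1) => // w; exact: cos_max.
  have h1 : `|Ex (fun w => cos (th + e * q w)) - Ex g| <= e ^+ 3 * (s2 + 2 * M4).
    rewrite -ExB//.
    have ib : integ (fun w => e ^+ 3 * (q w ^+ 2 + 2 * q w ^+ 4)).
      by repeat first [assumption | apply: integD | apply: integZ].
    apply: (@le_trans _ _ (Ex (fun w => e ^+ 3 * (q w ^+ 2 + 2 * q w ^+ 4)))).
      apply: Ex_norm_le => //; first exact: integB.
      move=> w; apply: (le_trans (cos_taylor th (e * q w))).
      rewrite normrM (gtr0_norm e0) !exprMn.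
      have hq3 : `|q w| ^+ 3 <= q w ^+ 2 + q w ^+ 4.
        rewrite -(real_normK (num_real (q w))) (_ : q w ^+ 4 = `|q w| ^+ 4); last first.
          by rewrite -normrX ger0_norm// exprn_even_ge0.
        move: (normr_ge0 (q w)); move: `|q w| => p p0.
        have : 0 <= p ^+ 2 * (p - 1) ^+ 2 by rewrite mulr_ge0 ?sqr_ge0.
        have : 0 <= p ^+ 2 by exact: sqr_ge0.
        have : 0 <= p ^+ 3 by exact: exprn_ge0.
        by nra.
      have he4 : e ^+ 4 * q w ^+ 4 <= e ^+ 3 * q w ^+ 4.
        rewrite ler_wpM2r ?exprn_even_ge0// [e ^+ 4]exprS ler_piMl// exprn_ge0// ltW//.
      have he3 : e ^+ 3 * `|q w| ^+ 3 <= e ^+ 3 * (q w ^+ 2 + q w ^+ 4).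
        by rewrite ler_wpM2l// exprn_ge0// ltW.
      by lra.
    rewrite ExZ; last by repeat first [assumption | apply: integD | apply: integZ].
    rewrite ExD//; last exact: integZ.
    rewrite ExZ// q2 -/s2 ler_wpM2l ?exprn_ge0 ?(ltW e0)//.
    by rewrite lerD2l ler_wpM2l.
  have h2 : `|Ex g - cos th * r| <= e ^+ 3 * s2 ^+ 2.
    rewrite Eg -mulrBr normrM distrC.
    apply: (@le_trans _ _ (1 * (e ^+ 2 * s2 / 2) ^+ 2)).
      apply: ler_pM => //; first exact: cos_max.
      exact: expRN_taylor.
    rewrite mul1r.
    have -> : (e ^+ 2 * s2 / 2) ^+ 2 = e ^+ 3 * s2 ^+ 2 * (e / 4) by field.
    rewrite ler_piMr// ?mulr_ge0 ?sqr_ge0 ?exprn_ge0 ?(ltW e0)//.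
    by lra.
  rewrite -/q (_ : _ - _ = (Ex (fun w => cos (th + e * q w)) - Ex g) + (Ex g - cos th * r)); last by ring.
  by rewrite (le_trans (ler_normD _ _))// /K mulrDr lerD.
have D1 i ph' : `|Ex (fun w => cos (ph' + blockS a b c e i w))| <= 1.
  have m : measurable_fun setT (fun w => cos (ph' + blockS a b c e i w)).
    have mc := continuous_measurable_fun (@continuous_cos R).
    apply: (measurableT_comp (f := cos)) => //; apply: measurable_funD => //.
    exact: measurable_blockS.
  have ic : integ (fun w => cos (ph' + blockS a b c e i w)).
    by apply: (@bounded_integ _ _ _ P _ 1) => // w; exact: cos_max.
  rewrite -[leRHS](Ex_cst P); apply: Ex_norm_le => //; first exact: integ_cst.
  by move=> w; exact: cos_max.
have K0 : 0 <= e ^+ 3 * K.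
  rewrite mulr_ge0 ?exprn_ge0 ?(ltW e0)// /K addr_ge0 ?sqr_ge0//.
  by rewrite addr_ge0// mulr_ge0.
have ind i : (i <= N)%N -> `|Ex (fun w => cos (ph + blockS a b c e i w)) - cos ph * r ^+ i| <=
    i%:R * (2 * (e ^+ 3 * K)).
  elim: i => [_|i IH iN].
    rewrite expr0 mulr1 mul0r.
    have -> : (fun w => cos (ph + blockS a b c e 0 w)) = (fun=> cos ph).
      by apply/funext => w; rewrite /blockS big_ord0 addr0.
    by rewrite Ex_cst subrr normr0.
  have {}IH := IH (ltnW iN).
  rewrite blockS_rec//.
  have k1 := key 0 i iN; have k2 := key (- (pi / 2)) i iN.
  (* At the phase -pi / 2 the main term vanishes, so the sine product of the addition formula is a
     mere error. *)
  rewrite cos0 mul1r in k1; rewrite cosN cos_pihalf mul0r subr0 in k2.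
  set A := Ex (fun w => cos (0 + _)) in k1 *; set B := Ex (fun w => cos (- _ + _)) in k2 *.
  set D := Ex (fun w => cos (ph + _)) in IH *; set D' := Ex (fun w => cos (ph - _ + _)).
  have dD : `|D| <= 1 by exact: D1.
  have dD' : `|D'| <= 1 by exact: D1.
  have -> : D * A - D' * B - cos ph * r ^+ i.+1 =
     D * (A - r) + (- D' * B + r * (D - cos ph * r ^+ i)) by rewrite exprS; ring.
  rewrite -natr1 mulrDl mul1r.
  have t1 : `|D * (A - r)| <= e ^+ 3 * K by rewrite normrM -[leRHS]mul1r; apply: ler_pM.
  have t2 : `|- D' * B| <= e ^+ 3 * K by rewrite normrM normrN -[leRHS]mul1r; apply: ler_pM.
  have t3 : `|r * (D - cos ph * r ^+ i)| <= i%:R * (2 * (e ^+ 3 * K)).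
    by rewrite normrM -[leRHS]mul1r; apply: ler_pM.
  rewrite (le_trans (ler_normD _ _))//.
  rewrite (@le_trans _ _ (e ^+ 3 * K + (e ^+ 3 * K + i%:R * (2 * (e ^+ 3 * K)))))//.
    by rewrite lerD// (le_trans (ler_normD _ _))// lerD.
  by lra.
have := ind N (leqnn N).
have -> : r ^+ N = expR (- (s2 / 2)).
  rewrite /r -expRM_natr; congr expR.
  rewrite (_ : - (e ^+ 2 * s2 / 2) * N%:R = - (N%:R * e ^+ 2 * s2 / 2)); last by ring.
  by rewrite Ne2 mul1r.
move=> /le_trans; apply.
rewrite (_ : N%:R * (2 * (e ^+ 3 * K)) = (N%:R * e ^+ 2) * (2 * K * e)); last by ring.
by rewrite Ne2 mul1r /K /M4 /s2 /e.
Qed.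

(** By Isserlis' formula the squares of orthogonal Gaussian variables are uncorrelated, and the
    variance of each is 2 v^2. *)
Lemma sum_sqr_var (u : nat -> T -> R) (v : R) : (forall i, H (u i)) ->
  (forall i j, (i < N)%N -> (j < N)%N -> Ex (fun w => u i w * u j w) = (i == j)%:R * v) ->
  integ (fun w => (\sum_(i < N) (u i w ^+ 2 - v)) ^+ 2) /\
  Ex (fun w => (\sum_(i < N) (u i w ^+ 2 - v)) ^+ 2) = N%:R * (2 * v ^+ 2).
Proof.
move=> Hu uu.
have E : (fun w => (\sum_(i < N) (u i w ^+ 2 - v)) ^+ 2) =
  (fun w => \sum_(i < N) \sum_(j < N) (u i w ^+ 2 * u j w ^+ 2 +
     (- v * u i w ^+ 2 + (- v * u j w ^+ 2 + v ^+ 2 * 1)))).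
  apply/funext => w; rewrite expr2 mulr_suml; apply: eq_bigr => i _.
  by rewrite mulr_sumr; apply: eq_bigr => j _; ring.
have i2 i := gs_integX 2 (Hu i).
have i1 := integ_cst P 1.
have i22 i j := (gs_sqr2 (Hu i) (Hu j)).1.
have it i j : integ (fun w => u i w ^+ 2 * u j w ^+ 2 +
     (- v * u i w ^+ 2 + (- v * u j w ^+ 2 + v ^+ 2 * 1))).
  by repeat first [done | apply: integD | apply: integZ].
split; first by rewrite E; do 2 apply: integ_sum => ?; exact: it.
rewrite E Ex_sum; last by move=> i; apply: integ_sum => j; exact: it.
transitivity (\sum_(i < N) (2 * v ^+ 2)); last by rewrite sumr_const card_ord [RHS]mulr_natl.
apply: eq_bigr => i _; rewrite Ex_sum//.
have Eij (j : 'I_N) : Ex (fun w => u i w ^+ 2 * u j w ^+ 2 +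
     (- v * u i w ^+ 2 + (- v * u j w ^+ 2 + v ^+ 2 * 1))) = (i == j)%:R * (2 * v ^+ 2).
  rewrite !ExD; [|by repeat first [done | apply: integD | apply: integZ]..].
  rewrite !ExZ// (gs_sqr2 (Hu i) (Hu j)).2 Ex_cst !sqrE !uu// !eqxx.
  by rewrite -val_eqE; case: eqP => _ /=; ring.
under eq_bigr do rewrite Eij.
rewrite (bigD1 i)//= eqxx mul1r big1 ?addr0// => j.
by rewrite eq_sym => /negbTE ->; rewrite mul0r.
Qed.

End block_sums.
End gaussian_space.

(** * Convergence in distribution *)

Section sqrt_nat.
Context {R : realType}.

Lemma near_sqrt_nat_ge (B : R) : \forall n \near \oo, B <= Num.sqrt n%:R.
Proof.
near=> n; rewrite (le_trans (ler_norm B))// -sqrtr_sqr ler_wsqrtr//.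
rewrite (le_trans (ltW (truncnS_gt _)))// ler_nat.
near: n; exact: nbhs_infty_ge.
Unshelve. all: by end_near. Qed.

Lemma near_div_sqrt_nat_le (B e : R) : 0 < e -> \forall n \near \oo, B / Num.sqrt n%:R <= e.
Proof.
move=> e0; near=> n.
have n0 : (0 < n)%N by near: n; exact: nbhs_infty_gt.
rewrite ler_pdivrMr ?sqrtr_gt0 ?ltr0n// [leRHS]mulrC -ler_pdivrMr//.
near: n; exact: near_sqrt_nat_ge.
Unshelve. all: by end_near. Qed.

End sqrt_nat.

(** * The theorems of Slutsky and Levy *)

Section slutsky_levy.
Context {R : realType} d (T : measurableType d) (P : probability T R).
Context d2 (T2 : measurableType d2) (P2 : probability T2 R).
Local Notation Ex f := (Rintegral P setT f).
Local Notation Ex2 f := (Rintegral P2 setT f).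
Local Notation integ f := (P.-integrable setT (EFin \o f)).
Variable k : nat.
Variables (X Y : nat -> 'I_k -> T -> R) (G : 'I_k -> T2 -> R).
Variables (Q : nat -> T -> R) (QG : T2 -> R) (C0 : R).
Hypothesis mX : forall n i, measurable_fun setT (X n i).
Hypothesis mY : forall n i, measurable_fun setT (Y n i).
Hypothesis mG : forall i, measurable_fun setT (G i).
Hypothesis Q0 : forall n w, 0 <= Q n w.
Hypothesis QC : \forall n \near \oo, integ (Q n) /\ Ex (Q n) <= C0.
Hypothesis iQG : P2.-integrable setT (EFin \o QG).
Hypothesis QG0 : forall w, 0 <= QG w.
Hypothesis G_tight : forall K, exists L : R, forall w, QG w <= K -> forall i, `|G i w| <= L.
Hypothesis XY : forall K, exists C : R, \forall n \near \oo, forall w, Q n w <= K ->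
  forall i, `|X n i w| <= C /\ `|X n i w - Y n i w| <= C / Num.sqrt n%:R.
Hypothesis cfY : forall a (t : 'I_k -> R),
  Ex (fun w => cos (a + \sum_i t i * Y n i w)) @[n --> \oo] -->
  Ex2 (fun w => cos (a + \sum_i t i * G i w)).

Let C1 : R := `|C0| + 1.
Let C1_gt0 : 0 < C1. Proof. by rewrite ltr_wpDl. Qed.

(** Slutsky's part, on cosines: X and Y are within C / sqrt n of each other where Q <= K, and
    elsewhere the cosines differ by at most 2 <= 2 Q / K. *)
Let cfX a (t : 'I_k -> R) :
  Ex (fun w => cos (a + \sum_i t i * X n i w)) @[n --> \oo] -->
  Ex2 (fun w => cos (a + \sum_i t i * G i w)).
Proof.
have icos (Z : 'I_k -> T -> R) : (forall i, measurable_fun setT (Z i)) ->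
    integ (fun w => cos (a + \sum_i t i * Z i w)).
  move=> mZ; apply: (@bounded_integ _ _ _ P _ 1) => [|w]; last exact: cos_max.
  have mc := continuous_measurable_fun (@continuous_cos R).
  by apply: (measurableT_comp (f := cos)) => //; exact: measurable_lin.
apply/cvgrPdist_le => e e0.
(* Makes 2 C1 / K equal to e / 3. *)
pose K := 6 * C1 / e.
have K0 : 0 < K by rewrite divr_gt0// mulr_gt0.
have [C XYC] := XY K.
pose tt := \sum_i `|t i|.
have tt0 : 0 <= tt by apply: sumr_ge0.
have CC0 : 0 <= tt * `|C| by rewrite mulr_ge0.
have e3 : 0 < e / 3 by rewrite divr_gt0.
have /cvgrPdist_le/(_ _ e3) cfYn := @cfY a t.
near=> n.
have n0 : (0 < n)%N by near: n; exact: nbhs_infty_gt.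
have [iQ EQ] : integ (Q n) /\ Ex (Q n) <= C0 by near: n.
have hXY : forall w, Q n w <= K ->
  forall i, `|X n i w| <= C /\ `|X n i w - Y n i w| <= C / Num.sqrt n%:R by near: n.
have sn0 : 0 < Num.sqrt n%:R :> R by rewrite sqrtr_gt0 ltr0n.
have hn : tt * `|C| / Num.sqrt n%:R <= e / 3.
  by near: n; apply: near_div_sqrt_nat_le; rewrite divr_gt0.
have h1 : `|Ex2 (fun w => cos (a + \sum_i t i * G i w)) -
    Ex (fun w => cos (a + \sum_i t i * Y n i w))| <= e / 3.
  by near: n; exact: cfYn.
have h2 : `|Ex (fun w => cos (a + \sum_i t i * Y n i w)) -
    Ex (fun w => cos (a + \sum_i t i * X n i w))| <= e / 3 + e / 3.
  have [iX iY] := (icos _ (mX n), icos _ (mY n)).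
  have im : integ (fun w => e / 3 + 2 / K * Q n w).
    by apply: integD; [exact: integ_cst|exact: integZ].
  rewrite -ExB//; apply: (@le_trans _ _ (Ex (fun w => e / 3 + 2 / K * Q n w))).
    apply: Ex_norm_le => //; first exact: integB.
    move=> w; have [QK|QK] := leP (Q n w) K.
      apply: (le_trans (cos_lipschitz _ _)).
      rewrite opprD addrACA subrr add0r -sumrB.
      apply: (@le_trans _ _ (tt * `|C| / Num.sqrt n%:R)); last first.
        by rewrite (le_trans hn)// lerDl mulr_ge0// divr_ge0// ltW.
      rewrite (le_trans (ler_norm_sum _ _ _))// /tt !mulr_suml; apply: ler_sum => i _.
      rewrite -mulrBr normrM -mulrA ler_wpM2l// distrC.
      have [_ h] := hXY _ QK i; rewrite (le_trans h)// ler_wpM2r ?ler_norm//.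

    apply: (@le_trans _ _ 2).
      rewrite (le_trans (ler_normB _ _))// (_ : 2 = 1 + 1)//.
      by rewrite lerD// cos_max.
    apply: (@le_trans _ _ (2 / K * Q n w)); last by rewrite lerDr divr_ge0// ltW.
    by rewrite mulrAC ler_pdivlMr// ler_wpM2l// ltW.
  rewrite ExD; [|exact: integ_cst|exact: integZ].
  rewrite Ex_cst ExZ// lerD2l mulrAC ler_pdivrMr//.
  rewrite (_ : e / 3 * K = 2 * C1); last by rewrite /K; field; rewrite gt_eqF.
  by rewrite ler_wpM2l// (le_trans EQ)// /C1 (le_trans (ler_norm _))// lerDl.
rewrite -(subrKA (Ex (fun w => cos (a + \sum_i t i * Y n i w)))).
rewrite (le_trans (ler_normD _ _))//.
rewrite (_ : e = e / 3 + (e / 3 + e / 3)); last by field.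
exact: lerD.
Unshelve. all: by end_near. Qed.

Let Xv n w := fun i => X n i w.
Let Gv w := fun i => G i w.

Let cvg_trigpoly p : trigpoly p ->
  Ex (fun w => p (Xv n w)) @[n --> \oo] --> Ex2 (fun w => p (Gv w)).
Proof.
have ip q n : trigpoly q -> integ (fun w => q (Xv n w)).
  move=> tq; have [C hC] := trigpoly_bounded tq.
  by apply: (@bounded_integ _ _ _ P _ C) => //; exact: measurable_trigpoly.
have ip2 q : trigpoly q -> P2.-integrable setT (EFin \o (fun w => q (Gv w))).
  move=> tq; have [C hC] := trigpoly_bounded tq.
  by apply: (@bounded_integ _ _ _ P2 _ C) => //; exact: measurable_trigpoly.
elim=> {p} [a t|f g tf IH1 tg IH2|c f tf IH].
- exact: cfX.
- rewrite ExD; [|exact: ip2..].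
  rewrite (_ : (fun n => _) = (fun n => Ex (fun w => f (Xv n w)) + Ex (fun w => g (Xv n w)))).
    exact: cvgD.
  by apply/funext => n; rewrite ExD//; exact: ip.
- rewrite ExZ; last exact: ip2.
  rewrite (_ : (fun n => _) = (fun n => c * Ex (fun w => f (Xv n w)))).
    by apply: cvgM => //; exact: cvg_cst.
  by apply/funext => n; rewrite ExZ//; exact: ip.
Qed.

(** Levy's part: f is replaced under both laws by one trigonometric polynomial, for which
    convergence follows from that of the cosines by linearity. *)
Lemma slutsky_levy (f : ('I_k -> R) -> R) (M : R) : loc_unif_cont f ->
  (forall x, `|f x| <= M) ->
  Ex (fun w => f (Xv n w)) @[n --> \oo] --> Ex2 (fun w => f (Gv w)).
Proof.
move=> fc fM; apply/cvgrPdist_le => e e0.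
have M0 : 0 <= M by apply: le_trans (fM (fun=> 0)); exact: normr_ge0.
have q0 : 0 <= Ex2 QG by exact: Ex_ge0.
(* One error comes from the convergence for [p], and two from replacing [f] by [p] under each of the
   two laws: the approximation on the cube, and the complement of the tightness event. *)
pose e1 := e / 5.
have e10 : 0 < e1 by rewrite divr_gt0.
pose K := (2 * M * (C1 + Ex2 QG) + 1) / e1.
have K0 : 0 < K by rewrite divr_gt0// ltr_wpDl// !mulr_ge0// addr_ge0// ltW.
have [L2 GL2] := G_tight K.
have [L1 XL1] := XY K.
pose L := `|L1| + `|L2| + 1.
have L0 : 0 < L by rewrite ltr_wpDl// addr_ge0.
have [p [tp pM pf]] := trig_approx fc fM L0 e10.
have small q : 0 <= q -> q <= C1 + Ex2 QG -> 2 * M / K * q <= e1.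
  move=> q1 q2; rewrite mulrAC ler_pdivrMr// /K mulrCA divff ?gt_eqF// mulr1.
  rewrite (@le_trans _ _ (2 * M * (C1 + Ex2 QG)))// ?lerDl//.
  by rewrite ler_wpM2l// mulr_ge0.
have GL w : QG w <= K -> forall i, `|G i w| <= L.
  move=> /GL2 h i; rewrite (le_trans (h i))// (le_trans (ler_norm _))// /L.
  by rewrite addrAC lerDr addr_ge0.
have /cvgrPdist_le/(_ _ e10) cvp := cvg_trigpoly tp.
near=> n.
have [iQ EQ] : integ (Q n) /\ Ex (Q n) <= C0 by near: n.
have hXY : forall w, Q n w <= K ->
  forall i, `|X n i w| <= L1 /\ `|X n i w - Y n i w| <= L1 / Num.sqrt n%:R by near: n.
have XL w : Q n w <= K -> forall i, `|X n i w| <= L.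
  move=> /hXY h i; have [h1 _] := h i.
  by rewrite (le_trans h1)// (le_trans (ler_norm _))// /L -addrA lerDl addr_ge0.
have h1 : `|Ex2 (fun w => p (Gv w)) - Ex (fun w => p (Xv n w))| <= e1.
  by near: n; exact: cvp.
have h2 : `|Ex (fun w => p (Xv n w)) - Ex (fun w => f (Xv n w))| <= e1 + e1.
  have i1 : integ (fun w => p (Xv n w)).
    by apply: (@bounded_integ _ _ _ P _ M) => //; exact: measurable_trigpoly.
  have i2 : integ (fun w => f (Xv n w)).
    by apply: (@bounded_integ _ _ _ P _ M) => //; exact: measurable_loc_unif_cont fM.
  have im : integ (fun w => e1 + 2 * M / K * Q n w).
    by apply: integD; [exact: integ_cst|exact: integZ].
  rewrite -ExB//; apply: (@le_trans _ _ (Ex (fun w => e1 + 2 * M / K * Q n w))).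
    apply: Ex_norm_le => //; first exact: integB.
    exact: (approx_majorant fM pM K0 (ltW e10) (Q0 n) pf XL).
  rewrite ExD; [|exact: integ_cst|exact: integZ].
  rewrite Ex_cst ExZ// lerD2l small//; first exact: Ex_ge0.
  by rewrite (le_trans EQ)// /C1 (le_trans (ler_norm _))// -addrA lerDl addr_ge0.
have h3 : `|Ex2 (fun w => p (Gv w)) - Ex2 (fun w => f (Gv w))| <= e1 + e1.
  have i1 : P2.-integrable setT (EFin \o (fun w => p (Gv w))).
    by apply: (@bounded_integ _ _ _ P2 _ M) => //; exact: measurable_trigpoly.
  have i2 : P2.-integrable setT (EFin \o (fun w => f (Gv w))).
    by apply: (@bounded_integ _ _ _ P2 _ M) => //; exact: measurable_loc_unif_cont fM.
  have im : P2.-integrable setT (EFin \o (fun w => e1 + 2 * M / K * QG w)).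
    by apply: integD; [exact: integ_cst|exact: integZ].
  rewrite -ExB//; apply: (@le_trans _ _ (Ex2 (fun w => e1 + 2 * M / K * QG w))).
    apply: Ex_norm_le => //; first exact: integB.
    exact: (approx_majorant fM pM K0 (ltW e10) QG0 pf GL).
  rewrite ExD; [|exact: integ_cst|exact: integZ].
  by rewrite Ex_cst ExZ// lerD2l small// lerDr ltW.
rewrite (_ : e = (e1 + e1) + (e1 + (e1 + e1))); last by rewrite /e1; field.
rewrite (_ : _ - _ = - (Ex2 (fun w => p (Gv w)) - Ex2 (fun w => f (Gv w))) +
  ((Ex2 (fun w => p (Gv w)) - Ex (fun w => p (Xv n w))) +
   (Ex (fun w => p (Xv n w)) - Ex (fun w => f (Xv n w))))); last by ring.
rewrite (le_trans (ler_normD _ _))//; apply: lerD; first by rewrite normrN.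
by rewrite (le_trans (ler_normD _ _))//; apply: lerD.
Unshelve. all: by end_near. Qed.

End slutsky_levy.

(** * Continuity expressed by coordinates *)

Section continuity.
Context {R : realType} (k : nat).

(** The Heine-Cantor theorem, by the covering form of compactness. The cube is taken among row
    vectors, where it is compact as a product of segments. *)
Lemma ptwise_loc_unif_cont (g : ('I_k -> R) -> R) :
  (forall x e, 0 < e -> exists2 de, 0 < de &
     forall y, (forall i, `|y i - x i| < de) -> `|g y - g x| <= e) ->
  loc_unif_cont g.
Proof.
move=> gc L e e0.
pose A := [set v : 'rV[R]_k | forall i, `[- L, L]%classic (v ord0 i)].
have cA : compact A.
  by apply: (@rV_compact _ k (fun=> `[- L, L]%classic)) => _; exact: segment_compact.
pose Pr (de : R) (v : 'rV[R]_k) := forall y : 'I_k -> R,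
  (forall i, `|y i - v ord0 i| < de) -> `|g y - g (v ord0)| <= e.
have /compact_near_coveringP/(_ _ (at_right (0 : R)) Pr _) H := cA.
have : \forall de \near (0 : R)^'+, A `<=` Pr de.
  apply: H => v _.
  have [de de0 hde] := gc (v ord0) _ (divr_gt0 e0 (ltr0n _ 2)).
  exists (ball v (de / 2), [set t | 0 < t < de / 2]) => /=.
    split; first by apply: nbhsx_ballx; rewrite divr_gt0.
    near=> t => /=; apply/andP; split => //.
    by near: t; apply: nbhs_right_lt; rewrite divr_gt0.
  move=> [v' t] /= [[_ bv] /andP[t0 td]] y hy.
  have hv i : `|v' ord0 i - v ord0 i| < de / 2 by rewrite distrC; exact: bv.
  have h1 := hde y; have h2 := hde (v' ord0).
  rewrite -(subrKA (g (v ord0))) (le_trans (ler_normD _ _))// (splitr e) lerD//.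
    apply: h1 => i; rewrite -(subrKA (v' ord0 i)) (le_lt_trans (ler_normD _ _))//.
    by rewrite (splitr de) ltrD// (lt_trans (hy i)).
  rewrite distrC; apply: h2 => i; rewrite (lt_trans (hv i))//.
  by rewrite ltr_pdivrMr// mulr_natr mulr2n ltrDl.
rewrite near_withinE => /nbhs_ballP [r /= r0 hr].
exists (r / 2); first by rewrite divr_gt0.
move=> x y xL xy.
have r2 : `|0 - r / 2| < r.
  by rewrite sub0r normrN gtr0_norm ?divr_gt0// ltr_pdivrMr// mulr_natr mulr2n ltrDl.
have := hr (r / 2) r2 (divr_gt0 r0 (ltr0n _ 2)) (\row_i x i).
have rx : (\row_i x i) ord0 = x by apply/funext => i; rewrite mxE.
move=> /(_ _ y); rewrite /Pr rx; apply => // i.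
by rewrite rx /= in_itv/= -ler_norml; exact: xL.
Unshelve. all: by end_near. Qed.

(** [emb] carries coordinate functions to the type in which convergence is stated: column vectors,
    or [R] itself in the scalar case. *)
Lemma continuous_loc_unif_cont (E : pseudoMetricType R) (emb : ('I_k -> R) -> E)
    (f : E -> R) :
  (forall x e, 0 < e -> exists2 de, 0 < de &
     forall y, (forall i, `|y i - x i| < de) -> ball (emb x) e (emb y)) ->
  continuous f -> loc_unif_cont (f \o emb).
Proof.
move=> embc fc; apply: ptwise_loc_unif_cont => x e e0.
have /cvgrPdist_le/(_ _ e0)/nbhs_ballP[r /= r0 hr] := fc (emb x).
have [de de0 hde] := embc x r r0.
exists de => // y hy; rewrite distrC; exact/hr/hde.
Qed.

End continuity.

Section slutsky_distribution.
Context {R : realType} d (T : measurableType d) (P : probability T R).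
Context d2 (T2 : measurableType d2) (P2 : probability T2 R).
Local Notation Ex f := (Rintegral P setT f).
Local Notation Ex2 f := (Rintegral P2 setT f).
Local Notation integ f := (P.-integrable setT (EFin \o f)).

Lemma slutsky_distribution (k : nat) (X Y : nat -> 'I_k -> T -> R) (G : 'I_k -> T2 -> R)
    (Q : nat -> T -> R) (QG : T2 -> R) (C0 : R)
    (E : pseudoMetricType R) (emb : ('I_k -> R) -> E) :
  (forall x e, 0 < e -> exists2 de, 0 < de &
     forall y, (forall i, `|y i - x i| < de) -> ball (emb x) e (emb y)) ->
  (forall n i, measurable_fun setT (X n i)) ->
  (forall n i, measurable_fun setT (Y n i)) ->
  (forall i, measurable_fun setT (G i)) ->
  (forall n w, 0 <= Q n w) ->
  (\forall n \near \oo, integ (Q n) /\ Ex (Q n) <= C0) ->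
  P2.-integrable setT (EFin \o QG) ->
  (forall w, 0 <= QG w) ->
  (forall K, exists L : R, forall w, QG w <= K -> forall i, `|G i w| <= L) ->
  (forall K, exists C : R, \forall n \near \oo, forall w, Q n w <= K ->
     forall i, `|X n i w| <= C /\ `|X n i w - Y n i w| <= C / Num.sqrt n%:R) ->
  (forall a (t : 'I_k -> R), Ex (fun w => cos (a + \sum_i t i * Y n i w)) @[n --> \oo] -->
     Ex2 (fun w => cos (a + \sum_i t i * G i w))) ->
  cvg_in_distribution P P2 (fun n w => emb (fun i => X n i w))
    (fun w => emb (fun i => G i w)).
Proof.
move=> embc mX mY mG Q0 QC iQG QG0 QGt XY cf f fc [M fM].
have luc := continuous_loc_unif_cont embc fc.
have fM' x : `|(f \o emb) x| <= M by exact: fM.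
have h := slutsky_levy mX mY mG Q0 QC iQG QG0 QGt XY cf luc fM'.
rewrite expectationE; last first.
  by apply: (@bounded_integ _ _ _ P2 _ M) => [|w]; [exact: (measurable_loc_unif_cont mG luc fM')|exact: fM].
rewrite (_ : (fun n => _) = (fun n => (Ex (fun w => f (emb (fun i => X n i w))))%:E)).
  by apply: cvg_EFin; [exact: nearW|exact: h].
apply/funext => n; rewrite expectationE//.
by apply: (@bounded_integ _ _ _ P _ M) => [|w]; [exact: (measurable_loc_unif_cont (mX n) luc fM')|exact: fM].
Qed.

End slutsky_distribution.

Lemma ball_emb_col {R : realType} k (x : 'I_k -> R) (e : R) : 0 < e -> exists2 de, 0 < de &
  forall y : 'I_k -> R, (forall i, `|y i - x i| < de) ->
    ball (\col_i x i : 'cV[R]_k) e (\col_i y i).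
Proof.
move=> e0; exists e => // y hy; split => // i j; rewrite !mxE.
by rewrite /ball /= distrC; exact: hy.
Qed.

Lemma ball_emb_real {R : realType} (x : 'I_1 -> R) (e : R) : 0 < e -> exists2 de, 0 < de &
  forall y : 'I_1 -> R, (forall i, `|y i - x i| < de) ->
    ball (x ord0 : R) e (y ord0).
Proof. by move=> e0; exists e => // y hy; rewrite /ball /= distrC; exact: hy. Qed.

(** * The likelihood *)

Lemma ord2_ind (P : 'I_2 -> Prop) : P 0 -> P 1 -> forall i, P i.
Proof.
move=> P0 P1 [[|[|//]] h]; [suff -> : Ordinal h = 0 by []|suff -> : Ordinal h = 1 by []];
  exact/val_inj.
Qed.

Lemma sum_ord2 (V : nmodType) (F : 'I_2 -> V) : \sum_i F i = F 0 + F 1.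
Proof.
rewrite big_ord_recl big_ord1; congr (F _ + F _); exact/val_inj.
Qed.

Section likelihood_algebra.
Context {R : realType}.

(** The inverse of S maps M y to the inverse transpose of M applied to y divided entrywise by d, so
    that M cancels in the quadratic form. *)
Lemma quad_form_ldl n (M : 'M[R]_n) (d : 'rV[R]_n) (y : 'cV[R]_n) :
  \det M = 1 -> (forall k, 0 < d 0 k) ->
  let S := M *m diag_mx d *m M^T in
  ln (\det S) = \sum_k ln (d 0 k) /\
  ((M *m y)^T *m invmx S *m (M *m y)) 0 0 = \sum_k y k 0 ^+ 2 / d 0 k.
Proof.
move=> M1 d0 S.
have uM : M \in unitmx by rewrite unitmxE M1 unitr1.
have dS : \det S = \prod_k d 0 k by rewrite /S !det_mulmx det_tr M1 mul1r mulr1 det_diag.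
have ln_prod (F : 'I_n -> R) (r : seq 'I_n) : (forall k, 0 < F k) ->
    ln (\prod_(k <- r) F k) = \sum_(k <- r) ln (F k).
  move=> F0; elim: r => [|k r IH]; first by rewrite !big_nil ln1.
  by rewrite !big_cons lnM ?IH ?posrE ?prodr_gt0.
have uS : S \in unitmx.
  by rewrite unitmxE dS unitfE gt_eqF// prodr_gt0.
split; first by rewrite dS ln_prod.
pose e : 'rV[R]_n := \row_k (d 0 k)^-1.
have de : diag_mx d *m diag_mx e = 1%:M.
  rewrite mulmx_diag; apply/matrixP => i j; rewrite !mxE.
  by case: eqP => // _; rewrite !mulr1n divff ?gt_eqF.
have SZ : invmx S *m (M *m y) = invmx M^T *m (diag_mx e *m y).
  rewrite -[RHS](mulKmx uS); congr (_ *m _); rewrite /S -!mulmxA; congr (_ *m _).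
  rewrite [M^T *m _]mulmxA mulmxV ?unitmx_tr// mul1mx.
  by rewrite [RHS]mulmxA de mul1mx.
rewrite -mulmxA SZ trmx_mul -mulmxA [M^T *m _]mulmxA mulmxV ?unitmx_tr// mul1mx.
rewrite mul_diag_mx mxE; apply: eq_bigr => k _.
by rewrite !mxE expr2 [_^-1 * _]mulrC mulrA.
Qed.

Section markov.
Variables (th : R) (t : nat -> R).

(** A signed difference in place of the distance makes this multiplicative along any three indices,
    whatever their order; it is the correlation when t j <= t i. *)
Definition decay i j : R := expR (- th * (t i - t j)).

(** The conditional variance, in unit variance, of the value at time k given the earlier ones; by
    the Markov property only the last of them counts. Index 0 has no predecessor and keeps the
    marginal variance. *)
Definition innov_var k : R := if k is k'.+1 then 1 - decay k k' ^+ 2 else 1.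

Definition innov (u : nat -> R) k : R :=
  if k is k'.+1 then u k - decay k k' * u k' else u 0%N.

Lemma decayD i j k : decay i j * decay j k = decay i k.
Proof. by rewrite /decay -expRD; congr expR; ring. Qed.

Lemma decayii i : decay i i = 1.
Proof. by rewrite /decay subrr mulr0 expR0. Qed.

(** An entry of the factorization of the correlation matrix into a unit triangular matrix, the
    innovation variances and the transpose. Passing from l to l + 1 multiplies the old terms by one
    decay. *)
Lemma sum_decay_var j l :
  \sum_(k < l.+1) decay j k * decay l k * innov_var k = decay j l.
Proof.
elim: l => [|l IH]; first by rewrite big_ord1 /= decayii !mulr1.
rewrite big_ord_recr /= decayii mulr1.
rewrite (eq_bigr (fun k : 'I_l.+1 => decay l.+1 l * (decay j k * decay l k * innov_var k))).
  rewrite -mulr_sumr IH -(decayD j l.+1 l); ring.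
by move=> k _; rewrite -(decayD l.+1 l k); ring.
Qed.

Lemma sum_decay_innov u l : \sum_(k < l.+1) decay l k * innov u k = u l.
Proof.
elim: l => [|l IH]; first by rewrite big_ord1 /= decayii mul1r.
rewrite big_ord_recr /= decayii mul1r.
rewrite (eq_bigr (fun k : 'I_l.+1 => decay l.+1 l * (decay l k * innov u k))).
  by rewrite -mulr_sumr IH; ring.
by move=> k _; rewrite -(decayD l.+1 l k) mulrA.
Qed.

End markov.

Lemma sum_ord_le n (F : nat -> R) (l : 'I_n) :
  \sum_(k < n) (if (k <= l)%N then F k else 0) = \sum_(k < l.+1) F k.
Proof. by rewrite (big_ord_widen n F (ltn_ord l)) [RHS]big_mkcond. Qed.

Lemma sum_mxtens m n (F : 'I_m -> 'I_n -> R) :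
  \sum_(k < m * n) F (mxtens_unindex k).1 (mxtens_unindex k).2 = \sum_i \sum_j F i j.
Proof.
rewrite pair_bigA /= (reindex (@mxtens_unindex m n))//.
by exists (@mxtens_index m n) => i _; rewrite (mxtens_indexK, mxtens_unindexK).
Qed.

(** With [regr], the triangular factorization of [Amx psi]: the second component is regressed on the
    first, and these are the variances of the first component and of the residual. *)
Definition cond_var (psi : param R) (i : 'I_2) : R :=
  sigma2 psi i * (if i == 0 then 1 else 1 - rho psi ^+ 2).

Definition regr (psi : param R) : R := rho psi * sigma psi 1 / sigma psi 0.

Definition resid (psi : param R) (t : nat -> R) (z : 'I_2 -> nat -> R) (i : 'I_2) k : R :=
  innov (theta psi) t (z i) k -
  (if i == 0 then 0 else regr psi * innov (theta psi) t (z 0) k).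

(** The Kronecker product of the triangular factorizations of [Amx] and [Rmx] is one of [Sigmamx]:
    the product M of the unit triangular factors is lower triangular in the row-major order with
    ones on the diagonal. It maps the residuals to the observations, which inverts regression and
    innovation at once. *)
Lemma negloglik_resid m (s : 'I_m.+1 -> R) (z : 'I_2 -> R -> R) (psi : param R) :
  (forall i j : 'I_m.+1, (i < j)%N -> s i < s j) ->
  0 < theta psi -> (forall i, 0 < sigma2 psi i) -> -1 < rho psi < 1 ->
  let t k := s (inord k) in
  negloglik s z psi = (2 * m.+1)%:R * ln (2 * pi) +
    \sum_i \sum_(j < m.+1) ln (cond_var psi i * innov_var (theta psi) t j) +
    \sum_i \sum_(j < m.+1) resid psi t (fun i k => z i (t k)) i j ^+ 2 /
        (cond_var psi i * innov_var (theta psi) t j).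
Proof.
move=> s_incr th0 s20 rho1 t.
have s0 i : 0 < sigma psi i by rewrite sqrtr_gt0.
have ss i : sigma psi i ^+ 2 = sigma2 psi i by rewrite sqr_sqrtr// ltW.
have cv0 i : 0 < cond_var psi i.
  rewrite /cond_var mulr_gt0//; case: ifP => // _.
  nra.
pose th := theta psi.
have ts (i : 'I_m.+1) : t i = s i by rewrite /t inord_val.
have iv0 (j : 'I_m.+1) : 0 < innov_var th t j.
  case: j => [[|j] hj] //=.
  rewrite subr_gt0 expr_lt1 ?expR_ge0// -[ltRHS]expR0 ltr_expR.
  have h : t j < t j.+1.
    have -> : t j = s (Ordinal (ltnW hj)) by rewrite -ts.
    have -> : t j.+1 = s (Ordinal hj) by rewrite -ts.
    exact: s_incr.
  by rewrite mulNr oppr_lt0 mulr_gt0// subr_gt0.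
pose U : 'M[R]_2 := \matrix_(i, j) if i == j then 1 else if i == 0 then 0 else regr psi.
pose L : 'M[R]_m.+1 := \matrix_(j, k) if (k <= j)%N then decay th t j k else 0.
pose dd : 'rV[R]_(2 * m.+1) := \row_k
  (cond_var psi (mxtens_unindex k).1 * innov_var th t (mxtens_unindex k).2).
pose y : 'cV[R]_(2 * m.+1) := \col_k
  resid psi t (fun i k => z i (t k)) (mxtens_unindex k).1 (mxtens_unindex k).2.
have AE : Amx psi = U *m diag_mx (\row_i cond_var psi i) *m U^T.
  apply/matrixP => i j; rewrite mul_mx_diag [RHS]mxE sum_ord2 !mxE.
  elim/ord2_ind: i; elim/ord2_ind: j; rewrite /cond_var /regr /= -?ss; field;
    by rewrite ?gt_eqF.
have RE : Rmx psi s = L *m diag_mx (\row_j innov_var th t j) *m L^T.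
  have ij_le (i j : 'I_m.+1) : (j <= i)%N ->
      Rmx psi s i j = (L *m diag_mx (\row_j innov_var th t j) *m L^T) i j.
    move=> ji; rewrite mul_mx_diag !mxE.
    have -> : expR (- theta psi * `|s i - s j|) = decay th t i j.
      rewrite /decay !ts ger0_norm// subr_ge0.
      by move: ji; rewrite leq_eqVlt => /orP[/val_eqP ->//|/s_incr/ltW].
    rewrite -sum_decay_var.
    rewrite -(sum_ord_le (fun k => decay th t i k * decay th t j k * innov_var th t k)).
    apply: eq_bigr => k _; rewrite !mxE.
    case: ifPn => kj; last by rewrite mulr0.
    by rewrite (leq_trans kj ji) mulrAC.
  apply/matrixP => i j; case: (leqP j i) => [|/ltnW]; first exact: ij_le.
  move=> /ij_le h; transitivity (Rmx psi s j i); first by rewrite !mxE distrC.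
  rewrite h mul_mx_diag [LHS]mxE [RHS]mxE; apply: eq_bigr => k _.
  by rewrite !mxE mulrC [RHS]mulrC; ring.
pose M := U *t L.
have SE : Sigmamx psi s = M *m diag_mx dd *m M^T.
  rewrite /Sigmamx AE RE -!tensmx_mul trmx_tens; congr (_ *m _ *m _).
  apply/matrixP => i j.
  case: (mxtens_indexP i) => i1 i2; case: (mxtens_indexP j) => j1 j2.
  rewrite tensmxE !mxE !mxtens_indexK /= (can_eq (@mxtens_indexK _ _)) xpair_eqE.
  by case: eqP => [->|]; case: eqP => [->|]; rewrite ?(mulr1n,mulr0n,mul0r,mulr0).
have M1 : \det M = 1.
  rewrite det_trig; last first.
    apply/is_trig_mxP => k l.
    case: (mxtens_indexP k) => i1 i2; case: (mxtens_indexP l) => j1 j2.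
    rewrite tensmxE !mxE /= => hk.
    have [|ij] := leqP j2 i2; last by rewrite mulr0.
    have ji : (i2 < m.+1 + j2)%N by rewrite ltn_addr.
    move: hk; elim/ord2_ind: i1; elim/ord2_ind: j1 => /=; rewrite ?mul0r//.
    + by rewrite !mul0n !add0n ltnNge => /negbTE ->.
    + by rewrite mul1n mul0n add0n ltnNge => /negP + ij; rewrite (leq_trans ij)// leq_addl.
    + by rewrite ltn_add2l ltnNge => /negbTE ->.
  apply: big1 => k _; case: (mxtens_indexP k) => i j.
  by rewrite tensmxE !mxE eqxx leqnn mul1r decayii.
have dd0 k : 0 < dd 0 k by rewrite mxE mulr_gt0.
have ZE : obs_vec s z = M *m y.
  apply/colP => k; case: (mxtens_indexP k) => i j.
  rewrite !mxE mxtens_indexK /=.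
  rewrite (eq_bigr (fun k => (U i (mxtens_unindex k).1 * L j (mxtens_unindex k).2 *
    resid psi t (fun i k => z i (t k)) (mxtens_unindex k).1 (mxtens_unindex k).2))); last first.
    by move=> l _; rewrite !mxE mxtens_indexK.
  rewrite (sum_mxtens (fun a b => U i a * L j b * resid psi t (fun i k => z i (t k)) a b)).
  have EL a : \sum_(k < m.+1) L j k * innov th t (fun k => z a (t k)) k = z a (s j).
    rewrite -ts -[RHS](sum_decay_innov th t (fun k => z a (t k))).
    rewrite -(sum_ord_le (fun k => decay th t j k * innov th t (fun k => z a (t k)) k)).
    apply: eq_bigr => l _; rewrite mxE.
    by case: ifP => // _; rewrite mul0r.
  rewrite sum_ord2 /resid /=.
  transitivity (U i 0 * (\sum_k L j k * innov th t (fun k => z 0 (t k)) k) + U i 1 *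
    ((\sum_k L j k * innov th t (fun k => z 1 (t k)) k) -
     regr psi * (\sum_k L j k * innov th t (fun k => z 0 (t k)) k))).
    rewrite !EL; elim/ord2_ind: i; rewrite !mxE /=; ring.
  rewrite [regr psi * _]mulr_sumr -sumrB !mulr_sumr; congr (_ + _); apply: eq_bigr => l _.
    by rewrite subr0 mulrA.
  by rewrite mulrCA -mulrBr mulrA.
have [dE qE] := quad_form_ldl y M1 dd0.
rewrite /negloglik SE ZE dE qE.
rewrite (eq_bigr (fun k => ln (cond_var psi (mxtens_unindex k).1 *
  innov_var (theta psi) t (mxtens_unindex k).2))); last by move=> k _; rewrite mxE.
rewrite (sum_mxtens (fun i j => ln (cond_var psi i * innov_var (theta psi) t j))).
congr (_ + _ + _).
rewrite -sum_mxtens; apply: eq_bigr => k _; by rewrite !mxE.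
Qed.
End likelihood_algebra.

(** * The logarithm of sinh x / x *)

Section log_sinhc.
Context {R : realType}.
Implicit Types x y : R.

Lemma expRN_le1 x : 0 <= x -> expR (- x) <= 1.
Proof. by move=> x0; rewrite -[leRHS]expR0 ler_expR oppr_le0. Qed.

Lemma expRN_lipschitz x y : 0 <= x -> 0 <= y -> `|expR (- x) - expR (- y)| <= `|x - y|.
Proof.
wlog xy : x y / x <= y => [H x0 y0|x0 y0].
  by have [/H|/ltW /H] := leP x y; [exact|rewrite distrC (distrC x); exact].
rewrite ger0_norm ?subr_ge0 ?ler_expR ?lerN2// distrC ger0_norm ?subr_ge0//.
have h := expR_ge1Dx (x - y); have e1 := expRN_le1 x0; have e0 := expR_gt0 (- x).
have -> : expR (- y) = expR (- x) * expR (x - y) by rewrite -expRD; congr expR; ring.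
nra.
Qed.

Lemma subr_expRN_gt0 x : 0 < x -> 0 < 1 - expR (- (2 * x)).
Proof. by move=> x0; rewrite subr_gt0 -[ltRHS]expR0 ltr_expR oppr_lt0 mulr_gt0. Qed.

(* [ln (sinh x / (x / 2))] *)
Definition log_sinhc x : R := ln (1 - expR (- (2 * x))) + x - ln x.

(** For x <= y the two bounds are the logarithms of b x <= a y, that is, (1 - exp(-2 x)) / x
    decreases, and of a y exp(2 (x - y)) <= b x. Both follow from exp z >= 1 + z. *)
Lemma log_sinhc_lipschitz x y : 0 < x -> 0 < y ->
  `|log_sinhc x - log_sinhc y| <= `|x - y|.
Proof.
wlog xy : x y / x <= y => [H x0 y0|x0 y0].
  by have [/H|/ltW /H] := leP x y; [exact|rewrite distrC (distrC x); exact].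
rewrite distrC (distrC x) (ger0_norm (_ : 0 <= y - x)) ?subr_ge0//.
set a := 1 - expR (- (2 * x)); set b := 1 - expR (- (2 * y)).
have a0 : 0 < a by exact: subr_expRN_gt0.
have b0 : 0 < b by exact: subr_expRN_gt0.
have ex : expR (- (2 * x)) = 1 - a by rewrite /a; ring.
have bE : expR (- (2 * y)) = (1 - a) * expR (- (2 * (y - x))).
  by rewrite -ex -expRD; congr expR; ring.
have h1 := expR_ge1Dx (2 * x); have h2 := expR_ge1Dx (- (2 * (y - x))).
have h3 := expR_ge1Dx (- (2 * x)).
have h4 : expR (2 * x) * (1 - a) = 1 by rewrite -ex -expRD addrN expR0.
have a1 : a < 1 by rewrite -subr_gt0 -ex expR_gt0.
have k0 : 0 <= y - x by rewrite subr_ge0.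
have k1 : 0 <= a - 2 * x * (1 - a).
  by have := ler_wpM2r (ltW (expR_gt0 (- (2 * x)))) h1; rewrite ex h4; lra.
have up : b * x <= a * y.
  have q0 : 0 <= x * (1 - a) by rewrite mulr_ge0 ?ltW// subr_gt0.
  have p1 : 0 <= x * (1 - a) * (expR (- (2 * (y - x))) - (1 - 2 * (y - x))).
    by rewrite mulr_ge0// subr_ge0.
  have p2 := mulr_ge0 k0 k1.
  rewrite /b bE; lra.
have lo : a * y * expR (2 * (x - y)) <= b * x.
  have -> : expR (2 * (x - y)) = expR (- (2 * (y - x))) by congr expR; ring.
  set E := expR (- (2 * (y - x))) in bE h2 *.
  have E0 : 0 < E by exact: expR_gt0.
  have h5 := expR_ge1Dx (2 * (y - x)).
  have h6 : expR (2 * (y - x)) * E = 1 by rewrite /E -expRD addrN expR0.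
  have h7 : (1 + 2 * (y - x)) * E <= 1 by have := ler_wpM2r (ltW E0) h5; rewrite h6.
  rewrite ex in h3.
  have p1 : 0 <= E * (y - x) * (2 * x - a).
    by rewrite !mulr_ge0 ?(ltW E0)//; lra.
  have p2 : 0 <= x * (1 - (1 + 2 * (y - x)) * E) by rewrite mulr_ge0 ?(ltW x0)// subr_ge0.
  rewrite /b bE; lra.
have := ler_ln (mulr_gt0 b0 x0) (mulr_gt0 a0 y0).
rewrite up => /[!lnM]; rewrite ?posrE// => lu.
have lo0 : 0 < a * y * expR (2 * (x - y)) by rewrite !mulr_gt0// expR_gt0.
have := ler_ln lo0 (mulr_gt0 b0 x0).
rewrite lo => ll; move: ll lu; rewrite !lnM ?posrE ?mulr_gt0 ?expR_gt0// expRK.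
rewrite /log_sinhc -/a -/b => ll lu.
by rewrite ler_norml; apply/andP; split; move: (ln a) (ln b) (ln x) (ln y) ll lu => p q r s; rewrite /is_true => *; lra.
Qed.

Lemma log_sinhc_ge0 x : 0 < x -> 0 <= log_sinhc x.
Proof.
move=> x0; have a0 := subr_expRN_gt0 x0.
rewrite /log_sinhc subr_ge0 -[X in _ + X]expRK -lnM ?posrE ?expR_gt0//.
rewrite ler_ln ?posrE ?mulr_gt0 ?expR_gt0// mulrBl mul1r -expRD.
rewrite (_ : - (2 * x) + x = - x); last by ring.
by have h1 := expR_ge1Dx x; have h2 := expRN_le1 (ltW x0); lra.
Qed.

Lemma expR_log_sinhc x : 0 < x ->
  expR (- log_sinhc x) = x * expR (- x) / (1 - expR (- (2 * x))).
Proof.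
move=> x0; have a0 := subr_expRN_gt0 x0.
rewrite /log_sinhc; move: a0; set a := 1 - _ => a0.
rewrite (_ : - (ln a + x - ln x) = ln x + - x + - ln a); last by ring.
by rewrite 2!expRD (expRN (ln a)) !lnK ?posrE.
Qed.

Lemma log_var_sinhc (th D : R) : 0 < th -> 0 < D ->
  ln (1 - expR (- th * D) ^+ 2) = log_sinhc (th * D) - th * D + ln th + ln D.
Proof.
move=> th0 D0; rewrite /log_sinhc lnM ?posrE// -expRM_natl.
rewrite (_ : 2 * (- th * D) = - (2 * (th * D))); ring.
Qed.

Lemma ln_lipschitz (lo x y : R) : 0 < lo -> lo <= x -> lo <= y ->
  `|ln x - ln y| <= lo^-1 * `|x - y|.
Proof.
move=> lo0; wlog xy : x y / x <= y => [H hx hy|hx hy].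
  by have [/H|/ltW /H] := leP x y; [exact|rewrite distrC (distrC x); exact].
have x0 := lt_le_trans lo0 hx; have y0 := lt_le_trans lo0 hy.
rewrite distrC (distrC x) !ger0_norm ?subr_ge0 ?ler_ln ?posrE//.
have := @le_ln1Dx R (y / x - 1); rewrite subrKC ln_div ?posrE// => h.
apply: (@le_trans _ _ (y / x - 1)).
  by apply: h; rewrite ltrBDr addrC subrr divr_gt0.
rewrite (_ : y / x - 1 = x^-1 * (y - x)); last by field; rewrite gt_eqF.
by rewrite ler_wpM2r ?subr_ge0// lef_pV2 ?posrE.
Qed.

End log_sinhc.

(** * Dependence on theta along a fixed path *)

Section lipschitz_in_theta.
Context {R : realType}.
Variables (t : nat -> R) (m : nat) (lo hi : R).
Hypothesis lo0 : 0 < lo.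
Hypothesis t_incr : forall i, (i < m)%N -> t i < t i.+1.
Hypothesis t_le1 : t m - t 0%N <= 1.

(** The factor [th] compensates the innovation variance, which is about 2 th D at a small spacing D:
    the quotient is about 1 / (2 D) and free of [th] to leading order. *)
Definition quadN (th : R) (u v : nat -> R) : R :=
  th * \sum_(j < m.+1) innov th t u j * innov th t v j / innov_var th t j.

(** A Riemann sum of u^2 and the discrete quadratic variation, with the end points: what multiplies
    the Lipschitz constants of the coefficients in [quadNE]. *)
Definition roughness (u : nat -> R) : R :=
  u 0%N ^+ 2 + u m ^+ 2 +
  \sum_(i < m) ((t i.+1 - t i) * (u i.+1 ^+ 2 + u i ^+ 2) + (u i.+1 - u i) ^+ 2).

Lemma roughness_ge0 u : 0 <= roughness u.
Proof.
rewrite /roughness addr_ge0 ?addr_ge0 ?sqr_ge0//; apply: sumr_ge0 => i _.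
rewrite addr_ge0 ?sqr_ge0//; apply: mulr_ge0; last by rewrite addr_ge0// sqr_ge0.
by rewrite subr_ge0 ltW// t_incr.
Qed.

(** The log-determinant for two components, less one ln th for each observation; those are the terms
    absorbed by the coordinates theta sigma_1^2 and theta sigma_2^2 (1 - rho^2). *)
Definition log_var (th : R) : R :=
  2 * \sum_(j < m.+1) ln (innov_var th t j) - 2 * m.+1%:R * ln th.

Lemma sum_increments : \sum_(i < m) (t i.+1 - t i) = t m - t 0%N.
Proof. by rewrite -(telescope_sumr _ (leq0n m)) big_mkord. Qed.

(** Per spacing D, [log_sinhc] (th D) and th D each have Lipschitz constant D; with two components
    and total length at most 1 this gives 4. The initial innovation has variance 1, which leaves 2
    ln th uncompensated and gives 2 / lo. *)
Lemma log_var_lipschitz th th' : lo <= th -> lo <= th' ->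
  `|log_var th - log_var th'| <= (4 + 2 / lo) * `|th - th'|.
Proof.
move=> h h'; have th0 := lt_le_trans lo0 h; have th'0 := lt_le_trans lo0 h'.
have E x : 0 < x -> log_var x = \sum_(i < m)
    2 * (log_sinhc (x * (t i.+1 - t i)) - x * (t i.+1 - t i) + ln (t i.+1 - t i)) - 2 * ln x.
  move=> x0; rewrite /log_var big_ord_recl /= ln1 add0r.
  rewrite (eq_bigr (fun i : 'I_m => (log_sinhc (x * (t i.+1 - t i)) - x * (t i.+1 - t i)
    + ln (t i.+1 - t i)) + ln x)); last first.
    move=> i _; rewrite /bump /= add1n add0n log_var_sinhc//; first by rewrite addrAC.
    by rewrite subr_gt0 t_incr.
  rewrite -mulr_sumr big_split /= sumr_const card_ord -[m.+1%:R]natr1.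
  by rewrite -[ln x *+ m]mulr_natl; ring.
rewrite !E// opprD addrACA -sumrB.
have D0 (i : 'I_m) : 0 < t i.+1 - t i by rewrite subr_gt0 t_incr.
rewrite [leRHS]mulrDl; apply: (le_trans (ler_normD _ _)); apply: lerD.
  rewrite (le_trans (ler_norm_sum _ _ _))//.
  apply: (@le_trans _ _ (\sum_(i < m) (4 * `|th - th'|) * (t i.+1 - t i))).
    apply: ler_sum => i _; rewrite -mulrBr normrM.
    rewrite (ger0_norm (ler0n _ 2)).
    set a := th * _; set b := th' * _.
    have h1 : `|log_sinhc a - log_sinhc b| <= `|a - b|.
      by apply: log_sinhc_lipschitz; rewrite mulr_gt0.
    have h2 : `|a - b| = `|th - th'| * (t i.+1 - t i).
      by rewrite /a /b -mulrBl normrM (gtr0_norm (D0 i)).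
    rewrite (_ : log_sinhc a - a + _ - _ = (log_sinhc a - log_sinhc b) - (a - b)); last by ring.
    have := ler_normB (log_sinhc a - log_sinhc b) (a - b).
    by rewrite -mulrA -h2 => h3; lra.
  by rewrite -mulr_sumr sum_increments ler_piMr.
rewrite (_ : - _ + _ = 2 * (ln th' - ln th)); last by ring.
rewrite normrM ger0_norm// -mulrA ler_wpM2l// distrC.
exact: ln_lipschitz.
Qed.

(* In terms of the increments of the paths the singular factors [1 / innov_var] become
   functions of [th] which are Lipschitz uniformly in the design. *)
Lemma quadNE th u v : 0 < th -> quadN th u v =
  th * ((u 0%N * v 0%N + u m * v m) / 2) + \sum_(i < m)
   (let r := expR (- (th * (t i.+1 - t i))) in
    th * ((1 - r) / (2 * (1 + r))) * (u i.+1 * v i.+1 + u i * v i) +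
    expR (- log_sinhc (th * (t i.+1 - t i))) / (t i.+1 - t i) *
      ((u i.+1 - u i) * (v i.+1 - v i))).
Proof.
move=> th0; rewrite /quadN big_ord_recl /= divr1.
(* The first part, half the increment of u v, telescopes into the end point terms. *)
rewrite (eq_bigr (fun i : 'I_m => (u i.+1 * v i.+1 - u i * v i) / 2 + (let r := expR (- (th * (t i.+1 - t i))) in
    ((1 - r) / (2 * (1 + r))) * (u i.+1 * v i.+1 + u i * v i) +
    expR (- log_sinhc (th * (t i.+1 - t i))) / (t i.+1 - t i) / th *
      ((u i.+1 - u i) * (v i.+1 - v i))))); last first.
  move=> i _; rewrite /bump /= add1n add0n /decay.
  have D0 : 0 < t i.+1 - t i by rewrite subr_gt0 t_incr.
  have x0 : 0 < th * (t i.+1 - t i) by rewrite mulr_gt0.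
  rewrite expR_log_sinhc// mulNr.
  have -> : expR (- (2 * (th * (t i.+1 - t i)))) = expR (- (th * (t i.+1 - t i))) ^+ 2.
    by rewrite -expRM_natl; congr expR; ring.
  have := subr_expRN_gt0 x0.
  have -> : expR (- (2 * (th * (t i.+1 - t i)))) = expR (- (th * (t i.+1 - t i))) ^+ 2.
    by rewrite -expRM_natl; congr expR; ring.
  have := expR_gt0 (- (th * (t i.+1 - t i))).
  move: (expR _) D0 => r D0 r0 r1.
  by field; rewrite ?gt_eqF// ?addr_gt0.
rewrite big_split /= -mulr_suml (_ : \sum_(i < m) _ = u m * v m - u 0%N * v 0%N); last first.
  by rewrite -(telescope_sumr (fun i => u i * v i) (leq0n m)) big_mkord.
rewrite addrA mulrDr mulr_sumr; congr (_ + _); first by field.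
apply: eq_bigr => i _ /=; have D0 : 0 < t i.+1 - t i by rewrite subr_gt0 t_incr.
by field; rewrite !gt_eqF// addr_gt0// expR_gt0.
Qed.

(** The coefficient of the squared increments has Lipschitz constant 1, that of the values has 2 hi
    D; the spacing D is the weight that the values carry in [roughness]. Products are split by the
    inequality of the means. *)
Lemma quadN_lipschitz th th' u v : lo <= th <= hi -> lo <= th' <= hi ->
  `|quadN th u v - quadN th' u v| <=
    (1 + hi) * (roughness u + roughness v) * `|th - th'|.
Proof.
move=> /andP[h hh] /andP[h' hh'].
have th0 := lt_le_trans lo0 h; have th'0 := lt_le_trans lo0 h'.
have hi0 := lt_le_trans th0 hh.
have amgm (a b : R) : `|a * b| <= (a ^+ 2 + b ^+ 2) / 2.
  rewrite normrM -(real_normK (num_real a)) -(real_normK (num_real b)).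
  have := sqr_ge0 (`|a| - `|b|); nra.
rewrite !quadNE// opprD addrACA -mulrBl -sumrB.
rewrite (le_trans (ler_normD _ _))//.
rewrite (_ : (1 + hi) * (roughness u + roughness v) * `|th - th'| =
  (1 + hi) * (u 0%N ^+ 2 + u m ^+ 2 + (v 0%N ^+ 2 + v m ^+ 2)) * `|th - th'| +
  \sum_(i < m) (1 + hi) *
     (((t i.+1 - t i) * (u i.+1 ^+ 2 + u i ^+ 2) + (u i.+1 - u i) ^+ 2) +
     ((t i.+1 - t i) * (v i.+1 ^+ 2 + v i ^+ 2) + (v i.+1 - v i) ^+ 2)) * `|th - th'|); last first.
  rewrite -mulr_suml -mulr_sumr big_split /= /roughness; ring.
apply: lerD.
  rewrite normrM mulrC ler_wpM2r//.
  set S := _ + (_ + _); have S0 : 0 <= S by rewrite !addr_ge0// sqr_ge0.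
  apply: (@le_trans _ _ S); last by rewrite ler_peMl// lerDl ltW.
  rewrite normrM [X in _ * X]ger0_norm ?invr_ge0//.
  have := ler_normD (u 0%N * v 0%N) (u m * v m).
  by have := amgm (u 0%N) (v 0%N); have := amgm (u m) (v m); rewrite /S in S0 *; lra.
rewrite (le_trans (ler_norm_sum _ _ _))//; apply: ler_sum => i _ /=.
set D := t i.+1 - t i; have D0 : 0 < D by rewrite subr_gt0 t_incr.
set r := expR _; set r' := expR (- (th' * D)).
set k := expR _; set k' := expR (- log_sinhc (th' * D)).
have x0 : 0 < th * D by rewrite mulr_gt0.
have x'0 : 0 < th' * D by rewrite mulr_gt0.
have hk : `|k / D - k' / D| <= `|th - th'|.
  rewrite -mulrBl normrM normfV (gtr0_norm D0) ler_pdivrMr//.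
  rewrite (le_trans (expRN_lipschitz _ _)) ?log_sinhc_ge0//.
  rewrite (le_trans (log_sinhc_lipschitz _ _))// -mulrBl normrM (gtr0_norm D0)//.
have hr : `|r - r'| <= `|th - th'| * D.
  rewrite (le_trans (expRN_lipschitz (ltW x0) (ltW x'0)))//.
  by rewrite -mulrBl normrM (gtr0_norm D0).
have r0 : 0 < r by exact: expR_gt0.
have r'0 : 0 < r' by exact: expR_gt0.
have r1 : 0 <= 1 - r by rewrite subr_ge0 expRN_le1// ltW.
have r1D : 1 - r <= th * D by have := expR_ge1Dx (- (th * D)); rewrite -/r; lra.
have hkap : `|th * ((1 - r) / (2 * (1 + r))) - th' * ((1 - r') / (2 * (1 + r')))| <=
    2 * hi * D * `|th - th'|.
  rewrite (_ : _ - _ = (th - th') * ((1 - r) / (2 * (1 + r))) +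
     th' * (r' - r) / ((1 + r) * (1 + r'))); last by field; rewrite !gt_eqF ?addr_gt0.
  rewrite (le_trans (ler_normD _ _))// !normrM.
  have a1 : `|(2 * (1 + r))^-1| <= 1.
    by rewrite normfV invf_le1 ger0_norm; nra.
  have a2 : `|((1 + r) * (1 + r'))^-1| <= 1.
    by rewrite normfV invf_le1 ger0_norm; nra.
  rewrite (ger0_norm r1) (gtr0_norm th'0) (distrC r').
  apply: (@le_trans _ _ (`|th - th'| * (hi * D * 1) + hi * (`|th - th'| * D) * 1)).
    apply: lerD.
      apply: ler_wpM2l => //; apply: ler_pM => //.
      by apply: (le_trans r1D); apply: ler_wpM2r => //; exact: ltW.
    apply: ler_pM => //; first by rewrite mulr_ge0// ltW.
    by apply: ler_pM => //; exact: ltW.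
  by rewrite le_eqVlt; apply/orP; left; apply/eqP; ring.
rewrite (_ : _ - _ =
  (th * ((1 - r) / (2 * (1 + r))) - th' * ((1 - r') / (2 * (1 + r')))) *
    (u i.+1 * v i.+1 + u i * v i) +
  (k / D - k' / D) * ((u i.+1 - u i) * (v i.+1 - v i))); last by ring.
apply: (le_trans (ler_normD _ _)); rewrite !normrM.
set A := (u i.+1 ^+ 2 + u i ^+ 2) + (v i.+1 ^+ 2 + v i ^+ 2).
set B := (u i.+1 - u i) ^+ 2 + (v i.+1 - v i) ^+ 2.
have B0 : 0 <= B by rewrite !addr_ge0// sqr_ge0.
have A0 : 0 <= A by rewrite !addr_ge0// sqr_ge0.
have hP : `|u i.+1 * v i.+1 + u i * v i| <= A / 2.
  apply: (le_trans (ler_normD _ _)).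
  by have := amgm (u i.+1) (v i.+1); have := amgm (u i) (v i); rewrite /A; lra.
have hd : `|u i.+1 - u i| * `|v i.+1 - v i| <= B.
  rewrite -normrM; apply: (le_trans (amgm _ _)); rewrite -/B; lra.
apply: (@le_trans _ _ (2 * hi * D * `|th - th'| * (A / 2) + `|th - th'| * B)).
  by apply: lerD; rewrite ler_pM// mulr_ge0.
rewrite (_ : _ * _ + _ = (hi * (D * A) + B) * `|th - th'|); last by field.
apply: ler_wpM2r => //.
rewrite [X in _ <= _ * X](_ : _ = D * A + B); last by rewrite /A /B; ring.
have p1 := mulr_ge0 (ltW hi0) B0; have p2 := mulr_ge0 (ltW D0) A0; lra.
Qed.
End lipschitz_in_theta.

(** * Comparison of parameters *)

Section coordinates.
Context {R : realType}.

Definition quadH (x11 x12 x22 al om be : R) : R :=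
  al * x11 + om * (x22 - 2 * be * x12 + be ^+ 2 * x11).

(** The reciprocals of b and v: in these and [regr] the likelihood is polynomial up to
    logarithms. *)
Definition prec (psi : param R) (i : 'I_2) : R := (theta psi * cond_var psi i)^-1.

Definition valid_param (psi : param R) : Prop :=
  [/\ 0 < theta psi, forall i, 0 < sigma2 psi i & -1 < rho psi < 1].

Lemma cond_var_gt0 psi i : valid_param psi -> 0 < cond_var psi i.
Proof.
move=> [_ s20 r1]; rewrite /cond_var mulr_gt0//; case: ifP => // _; nra.
Qed.

Definition path (t : nat -> R) (z : 'I_2 -> R -> R) (i : 'I_2) (k : nat) : R := z i (t k).

Lemma negloglik_coord m (s : 'I_m.+1 -> R) (z : 'I_2 -> R -> R) (psi : param R) :
  (forall i j : 'I_m.+1, (i < j)%N -> s i < s j) -> valid_param psi ->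
  let t k := s (inord k) in
  let N i j := quadN t m (theta psi) (path t z i) (path t z j) in
  negloglik s z psi = (2 * m.+1)%:R * ln (2 * pi) + log_var t m (theta psi)
    - m.+1%:R * (ln (prec psi 0) + ln (prec psi 1)) +
    quadH (N 0 0) (N 0 1) (N 1 1) (prec psi 0) (prec psi 1) (regr psi).
Proof.
move=> s_incr vp t N; have [th0 s20 rho1] := vp.
have cv0 i := cond_var_gt0 i vp.
have iv0 (j : 'I_m.+1) : 0 < innov_var (theta psi) t j.
  case: j => [[|j] hj] //=; rewrite /decay.
  rewrite subr_gt0 expr_lt1 ?expR_ge0// -[ltRHS]expR0 ltr_expR.
  have h : t j < t j.+1 by apply: s_incr; rewrite !inordK// ltnW.
  by rewrite mulNr oppr_lt0 mulr_gt0// subr_gt0.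
rewrite (negloglik_resid z s_incr th0 s20 rho1) -/t; congr (_ + _).
  rewrite -addrA; congr (_ + _); rewrite /log_var sum_ord2.
  have E i : \sum_(j < m.+1) ln (cond_var psi i * innov_var (theta psi) t j) =
      m.+1%:R * ln (cond_var psi i) + \sum_(j < m.+1) ln (innov_var (theta psi) t j).
    rewrite (eq_bigr (fun j : 'I_m.+1 => ln (cond_var psi i) + ln (innov_var (theta psi) t j))).
      by rewrite big_split /= sumr_const card_ord mulr_natl.
    by move=> j _; rewrite lnM ?posrE.
  have P i : ln (prec psi i) = - (ln (theta psi) + ln (cond_var psi i)).
    have c0 : 0 < theta psi * cond_var psi i by rewrite mulr_gt0.
    rewrite /prec; move: (theta psi) (cond_var psi i) th0 (cv0 i) => a b a0 b0.
    by rewrite lnV ?lnM ?posrE// mulr_gt0.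
  by rewrite !E !P; ring.
pose w i := innov (theta psi) t (path t z i).
pose S i j := \sum_(k < m.+1) w i k * w j k / innov_var (theta psi) t k.
have NS i j : N i j = theta psi * S i j by [].
have -> : \sum_i \sum_(j < m.+1) resid psi t (fun i k => z i (t k)) i j ^+ 2 /
    (cond_var psi i * innov_var (theta psi) t j) =
    (cond_var psi 0)^-1 * S 0 0 +
    (cond_var psi 1)^-1 * (S 1 1 - 2 * regr psi * S 0 1 + regr psi ^+ 2 * S 0 0).
  rewrite sum_ord2; congr (_ + _); last first.
    rewrite /S !mulr_sumr -sumrB -big_split /= mulr_sumr.
    apply: eq_bigr => j _; rewrite /resid /= invfM.
    by rewrite -/(path t z 0) -/(path t z 1) -/(w 0 j) -/(w 1 j); ring.
  rewrite /S mulr_sumr; apply: eq_bigr => j _; rewrite /resid /= invfM.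
  by rewrite subr0 -/(path t z 0) -/(w 0 j); ring.
by rewrite /quadH !NS /prec; field; rewrite !gt_eqF.
Qed.

(** From ln y = 2 ln (sqrt y) <= 2 (sqrt y - 1) the right side is at least (sqrt y - 1)^2. This
    quadratic bound holds for all y > 0, not only near 1. *)
Lemma ln_gap (y : R) : 0 < y -> (y - 1) ^+ 2 / (2 * (y + 1)) <= y - 1 - ln y.
Proof.
move=> y0; have s0 : 0 < Num.sqrt y by rewrite sqrtr_gt0.
have sy : Num.sqrt y ^+ 2 = y by rewrite sqr_sqrtr// ltW.
move: (Num.sqrt y) s0 sy => r r0 ry; rewrite -ry in y0 *.
have h : ln (r ^+ 2) <= 2 * (r - 1).
  have := @le_ln1Dx R (r - 1); rewrite subrKC lnXn// mulr_natl => h.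
  by rewrite ler_wMn2r// h// ltrBDr addrC subrr.
apply: (@le_trans _ _ ((r - 1) ^+ 2)); last by lra.
rewrite ler_pdivrMr; last by rewrite mulr_gt0// addr_gt0.
have q := sqr_ge0 (r - 1); have q2 := mulr_ge0 q q.
rewrite (_ : (r ^+ 2 - 1) ^+ 2 = (r - 1) ^+ 2 * (r + 1) ^+ 2); last by ring.
by rewrite ler_wpM2l//; lra.
Qed.

Definition gap_const (lo hi : R) : R := Num.min (4 * hi ^+ 2)^-1 (lo / hi).

(** When the moments are those fitted by the primed coordinates, the excess is exactly the sum of y
    - 1 - ln y at y = al / al' and at y = om / om', and of om / al' times (be - be')^2. *)
Lemma coord_gap (lo hi al om be al' om' be' : R) : 0 < lo ->
  lo <= al <= hi -> lo <= om <= hi -> lo <= al' <= hi -> lo <= om' <= hi ->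
  gap_const lo hi * ((al - al') ^+ 2 + (om - om') ^+ 2 + (be - be') ^+ 2) <=
  (quadH al'^-1 (be' / al') (om'^-1 + be' ^+ 2 / al') al om be - ln al - ln om)
  - (2 - ln al' - ln om').
Proof.
move=> lo0 /andP[a1 a2] /andP[w1 w2] /andP[b1 b2] /andP[p1 p2].
have a0 := lt_le_trans lo0 a1; have w0 := lt_le_trans lo0 w1.
have b0 := lt_le_trans lo0 b1; have p0 := lt_le_trans lo0 p1.
have hi0 := lt_le_trans a0 a2.
have sub x x' : 0 < x -> 0 < x' -> x <= hi -> x' <= hi ->
    gap_const lo hi * (x - x') ^+ 2 <= x / x' - 1 - (ln x - ln x').
  move=> x0 x'0 xh x'h; rewrite -ln_div ?posrE//.
  apply: le_trans (ln_gap (divr_gt0 x0 x'0)).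
  have -> : (x / x' - 1) ^+ 2 / (2 * (x / x' + 1)) = (2 * x' * (x + x'))^-1 * (x - x') ^+ 2.
    by field; rewrite !gt_eqF ?addr_gt0.
  rewrite ler_wpM2r ?sqr_ge0//; apply: (@le_trans _ _ (4 * hi ^+ 2)^-1).
    by rewrite /gap_const ge_min lexx.
  have q1 := mulr_ge0 (ltW x'0) (_ : 0 <= 2 * hi - (x + x')).
  have q2 := mulr_ge0 (ltW hi0) (_ : 0 <= hi - x').
  rewrite lef_pV2 ?posrE ?mulr_gt0 ?exprn_gt0 ?addr_gt0//.
  by have := q1 (ltac:(lra)); have := q2 (ltac:(lra)); lra.
have h1 := sub _ _ a0 b0 a2 b2; have h2 := sub _ _ w0 p0 w2 p2.
have h3 : gap_const lo hi * (be - be') ^+ 2 <= om / al' * (be - be') ^+ 2.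
  rewrite ler_wpM2r ?sqr_ge0//; apply: (@le_trans _ _ (lo / hi)).
    by rewrite /gap_const ge_min lexx orbT.
  by apply: ler_pM; rewrite ?invr_ge0 ?(ltW lo0) ?(ltW hi0)// lef_pV2 ?posrE.
rewrite 2!mulrDr (_ : _ - (2 - _ - _) = (al / al' - 1 - (ln al - ln al')) +
  (om / om' - 1 - (ln om - ln om')) + om / al' * (be - be') ^+ 2).
  by rewrite !lerD.
by rewrite /quadH; field; rewrite !gt_eqF.
Qed.

Lemma quadH_lipschitz (hi B x11 x12 x22 al om be al' om' be' : R) :
  `|x11| <= B -> `|x12| <= B -> `|x22| <= B ->
  0 <= om' <= hi -> `|be| <= hi -> `|be'| <= hi ->
  `|quadH x11 x12 x22 al om be - quadH x11 x12 x22 al' om' be'| <=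
    2 * (1 + hi) ^+ 2 * B * (`|al - al'| + `|om - om'| + `|be - be'|).
Proof.
move=> h11 h12 h22 /andP[w0 w1] b1 b2.
have B0 : 0 <= B by exact: le_trans (normr_ge0 _) h11.
have hi0 : 0 <= hi by exact: le_trans w0 w1.
have -> : quadH x11 x12 x22 al om be - quadH x11 x12 x22 al' om' be' =
  (al - al') * x11 + (om - om') * (x22 - 2 * be * x12 + be ^+ 2 * x11) +
  (be - be') * (om' * ((be + be') * x11 - 2 * x12)) by rewrite /quadH; ring.
apply: (le_trans (ler_normD _ _)); rewrite [leRHS]mulrDr; apply: lerD.
  apply: (le_trans (ler_normD _ _)); rewrite [leRHS]mulrDr; apply: lerD; rewrite normrM mulrC ler_wpM2r//.
    by rewrite (le_trans h11)// ler_peMl//; nra.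
  apply: (le_trans (ler_normD _ _)).
  apply: (@le_trans _ _ (B + 2 * hi * B + hi ^+ 2 * B)); last by nra.
  apply: lerD.
    apply: (le_trans (ler_normB _ _)); apply: lerD => //.
    by rewrite !normrM (ger0_norm (ler0n _ 2)) ler_pM// ?mulr_ge0// ler_wpM2l.
  by rewrite normrM normrX ler_pM// ?exprn_ge0// lerXn2r ?nnegrE.
rewrite normrM mulrC ler_wpM2r// normrM ger0_norm//.
apply: (@le_trans _ _ (hi * ((hi + hi) * B + 2 * B))); last by nra.
apply: ler_pM => //; apply: (le_trans (ler_normB _ _)); rewrite !normrM (ger0_norm (ler0n _ 2)).
apply: lerD; last by rewrite ler_wpM2l.
by apply: ler_pM => //; apply: (le_trans (ler_normD _ _)); exact: lerD.
Qed.

Lemma quadH_norm_le (hi B x11 x12 x22 al om be : R) :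
  `|x11| <= B -> `|x12| <= B -> `|x22| <= B ->
  0 <= al <= hi -> 0 <= om <= hi -> `|be| <= hi ->
  `|quadH x11 x12 x22 al om be| <= 6 * (1 + hi) ^+ 3 * B.
Proof.
move=> h11 h12 h22 /andP[a0 a1] /andP[w0 w1] b1.
have hi0 : 0 <= hi by exact: le_trans w0 w1.
have B0 : 0 <= B by exact: le_trans (normr_ge0 _) h11.
have := @quadH_lipschitz hi B x11 x12 x22 al om be 0 0 0 h11 h12 h22.
rewrite {2}/quadH !mul0r addr0 !subr0 lexx normr0 hi0 => /(_ isT b1 isT) h.
apply: (le_trans h); rewrite (ger0_norm a0) (ger0_norm w0).
have q : 0 <= 2 * (1 + hi) ^+ 2 * B by rewrite mulr_ge0// mulr_ge0// sqr_ge0.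
rewrite (_ : 6 * _ * B = 2 * (1 + hi) ^+ 2 * B * (3 * (1 + hi))); last by ring.
by rewrite ler_wpM2l//; lra.
Qed.

Lemma quadHB x11 x12 x22 y11 y12 y22 al om be :
  quadH (x11 - y11) (x12 - y12) (x22 - y22) al om be =
  quadH x11 x12 x22 al om be - quadH y11 y12 y22 al om be.
Proof. by rewrite /quadH; ring. Qed.

Definition coord_bounds (lo hi : R) (psi : param R) : Prop :=
  [/\ valid_param psi, lo <= theta psi <= hi, lo <= prec psi 0 <= hi,
      lo <= prec psi 1 <= hi & `|regr psi| <= hi].

Definition coord_dist (psi psi' : param R) : R :=
  `|prec psi 0 - prec psi' 0| + `|prec psi 1 - prec psi' 1| + `|regr psi - regr psi'|.

Lemma coord_dist_ge0 psi psi' : 0 <= coord_dist psi psi'.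
Proof. by rewrite !addr_ge0. Qed.

(** The three summands bound the change of [log_var], the effect of moving theta from psi' to psi
    inside the moments, and that of moving it to th0. The factor 3 compares the squared sum of three
    distances with the sum of squares. *)
Definition close_const (lo hi C1 : R) : R :=
  3 * ((4 + 2 / lo) * C1 + 6 * (1 + hi) ^+ 3 * (2 * (1 + hi)) * C1 +
       2 * (1 + hi) ^+ 2 * (2 * (1 + hi) * hi)) / gap_const lo hi.

Lemma gap_const_gt0 (lo hi : R) : 0 < lo -> 0 < hi -> 0 < gap_const lo hi.
Proof.
by move=> l h; rewrite /gap_const lt_min invr_gt0 divr_gt0// mulr_gt0// exprn_gt0.
Qed.

(* The two equations on [H] say that [psi'] fits the moments [p] as far as [H] can see, so
   that the likelihood at [psi] exceeds the one at [psi'] by the convex gap of [coord_gap],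
   of order [m * dist^2], up to the effect of replacing the innovations at [theta psi] and
   [theta psi'] by those at [th0], of order [(1 + roughness) * dist]. *)
Lemma estimator_close m (s : 'I_m.+1 -> R) (z : 'I_2 -> R -> R) (lo hi C1 th0 : R)
    (psi psi' : param R) :
  (forall i j : 'I_m.+1, (i < j)%N -> s i < s j) -> (forall i, 0 <= s i <= 1) ->
  0 < lo -> 0 <= C1 -> lo <= th0 <= hi ->
  coord_bounds lo hi psi -> coord_bounds lo hi psi' ->
  negloglik s z psi <= negloglik s z psi' ->
  let t k := s (inord k) in
  let p i j := quadN t m th0 (path t z i) (path t z j) / m.+1%:R in
  let H := quadH (p 0 0) (p 0 1) (p 1 1) in
  H (prec psi 0) (prec psi 1) (regr psi) =
    quadH (prec psi' 0)^-1 (regr psi' / prec psi' 0)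
      ((prec psi' 1)^-1 + regr psi' ^+ 2 / prec psi' 0)
      (prec psi 0) (prec psi 1) (regr psi) ->
  H (prec psi' 0) (prec psi' 1) (regr psi') = 2 ->
  `|theta psi - theta psi'| <= C1 * coord_dist psi psi' ->
  m.+1%:R * coord_dist psi psi' <= close_const lo hi C1 *
    (1 + roughness t m (path t z 0) + roughness t m (path t z 1)).
Proof.
move=> s_incr s01 lo0 C10 th0b [vp tb ab ob bb] [vp' tb' ab' ob' bb'] ll t p H Hh H' hth.
set N := fun th i j => quadN t m th (path t z i) (path t z j).
have t_incr i : (i < m)%N -> t i < t i.+1.
  by move=> im; apply: s_incr; rewrite !inordK// ltnS ltnW.
have t_le1 : t m - t 0%N <= 1.
  have /andP[] := s01 (inord m); have /andP[] := s01 (inord 0); rewrite /t; lra.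
have hi0 : 0 < hi by case/andP: th0b; lra.
set L := 1 + _ + _.
have rough0 u := roughness_ge0 t_incr u.
have L1 : 1 <= L by rewrite /L -addrA lerDl addr_ge0.
have NL th th' i j : lo <= th <= hi -> lo <= th' <= hi ->
    `|N th i j - N th' i j| <= 2 * (1 + hi) * L * `|th - th'|.
  move=> h h'; apply: (le_trans (quadN_lipschitz lo0 t_incr _ _ h h')).
  have hi1 : 0 <= 1 + hi by rewrite addr_ge0// ltW.
  rewrite ler_wpM2r// [2 * _]mulrC -mulrA ler_wpM2l//.
  have a0 := rough0 (path t z 0); have a1 := rough0 (path t z 1).
  have aL k : roughness t m (path t z k) <= L.
    by elim/ord2_ind: k; rewrite /L; move: (roughness _ _ _) (roughness _ _ _) a0 a1 => *; lra.
  by rewrite mulr_natl mulr2n lerD.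
set e := coord_dist psi psi'; have e0 : 0 <= e by exact: coord_dist_ge0.
set n : R := m.+1%:R; have n0 : 0 < n by rewrite ltr0n.
have gap := @coord_gap lo hi _ _ (regr psi) _ _ (regr psi') lo0 ab ob ab' ob'.
rewrite -Hh in gap.
have eB : e ^+ 2 <= 3 * ((prec psi 0 - prec psi' 0) ^+ 2 +
    (prec psi 1 - prec psi' 1) ^+ 2 + (regr psi - regr psi') ^+ 2).
  rewrite /e /coord_dist.
  rewrite -(real_normK (num_real (prec psi 0 - _))) -(real_normK (num_real (prec psi 1 - _))).
  rewrite -(real_normK (num_real (regr psi - _))).
  move: `|_| `|_| `|_| => x y w'.
  have := sqr_ge0 (x - y); have := sqr_ge0 (x - w'); have := sqr_ge0 (y - w'); lra.
have c0 := gap_const_gt0 lo0 hi0.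
(* The gap is quadratic in the distance [e] and this bound is linear, so the claim follows on
   division by [e], the case e = 0 apart. *)
suff main : n * ((H (prec psi 0) (prec psi 1) (regr psi) - ln (prec psi 0) - ln (prec psi 1)) -
    (2 - ln (prec psi' 0) - ln (prec psi' 1))) <=
    ((4 + 2 / lo) * C1 + 6 * (1 + hi) ^+ 3 * (2 * (1 + hi)) * C1 +
       2 * (1 + hi) ^+ 2 * (2 * (1 + hi) * hi)) * L * e.
  have [->|en] := eqVneq e 0.
    rewrite mulr0 mulr_ge0 ?(le_trans ler01 L1)// /close_const.
    rewrite !divr_ge0 ?(ltW c0)// mulr_ge0// !addr_ge0// !mulr_ge0 ?addr_ge0 ?exprn_ge0//
      ?addr_ge0 ?divr_ge0 ?ltW//.
  have ep : 0 < e by rewrite lt_def en.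
  rewrite -(ler_pM2r ep) -mulrA -expr2 /close_const.
  apply: (le_trans (ler_wpM2l (ltW n0) eB)).
  have := ler_wpM2l (ltW n0) gap; move=> /le_trans /(_ main).
  set K := _ + _ + _; set S := _ + _ + _; move=> h.
  rewrite (_ : 3 * S / _ * L * e = (3 * (S * L * e)) / gap_const lo hi); last by ring.
  rewrite ler_pdivlMr//; lra.
have E q : n * H (prec q 0) (prec q 1) (regr q) =
    quadH (N th0 0 0) (N th0 0 1) (N th0 1 1) (prec q 0) (prec q 1) (regr q).
  by rewrite /H /quadH /p -/n /N; field; rewrite gt_eqF.
move: ll; rewrite !negloglik_coord// -/t -/n; set cc := _ * ln (2 * pi).
rewrite -/(N (theta psi) 0 0) -/(N (theta psi) 0 1) -/(N (theta psi) 1 1).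
rewrite -/(N (theta psi') 0 0) -/(N (theta psi') 0 1) -/(N (theta psi') 1 1) => ll.
have /andP[tl th] := tb; have /andP[tl' th'] := tb'.
have g : log_var t m (theta psi') - log_var t m (theta psi) <= (4 + 2 / lo) * C1 * L * e.
  apply: (le_trans (ler_norm _)).
  apply: (le_trans (log_var_lipschitz lo0 t_incr t_le1 tl' tl)).
  have lo2 : 0 <= 4 + 2 / lo by rewrite addr_ge0// divr_ge0// ltW.
  rewrite distrC -2!mulrA ler_wpM2l//.
  by apply: (le_trans hth); rewrite ler_wpM2l// ler_peMl.
have L0 : 0 <= L by exact: le_trans L1.
have hi1 : 0 <= 1 + hi by rewrite addr_ge0// ltW.
have h2L : 0 <= 2 * (1 + hi) * L by rewrite mulr_ge0// mulr_ge0.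
(* At fixed coordinates, the moments change by a multiple of the difference of the thetas, which
   [C1] bounds by the distance. *)
have k1 : quadH (N (theta psi') 0 0 - N (theta psi) 0 0)
    (N (theta psi') 0 1 - N (theta psi) 0 1) (N (theta psi') 1 1 - N (theta psi) 1 1)
    (prec psi 0) (prec psi 1) (regr psi) <=
    6 * (1 + hi) ^+ 3 * (2 * (1 + hi)) * C1 * L * e.
  apply: (le_trans (ler_norm _)).
  have B i j := NL _ _ i j tb' tb.
  have [a1 a2] := andP ab; have [w1 w2] := andP ob.
  apply: (le_trans (quadH_norm_le (hi := hi) (B 0 0) (B 0 1) (B 1 1) _ _ _)) => //.
  - by rewrite (le_trans (ltW lo0) a1).
  - by rewrite (le_trans (ltW lo0) w1).
  rewrite (_ : 6 * (1 + hi) ^+ 3 * (2 * (1 + hi)) * C1 * L * e =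
    6 * (1 + hi) ^+ 3 * (2 * (1 + hi) * L * (C1 * e))); last by ring.
  rewrite distrC !ler_wpM2l// mulr_ge0// exprn_ge0// addr_ge0// ltW.
(* The error of replacing [theta psi'] by [th0] is merely bounded, as these need not be close; but
   it enters at both parameters, and its difference is again proportional to their distance. *)
have k2 : quadH (N th0 0 0 - N (theta psi') 0 0)
    (N th0 0 1 - N (theta psi') 0 1) (N th0 1 1 - N (theta psi') 1 1)
    (prec psi 0) (prec psi 1) (regr psi) -
  quadH (N th0 0 0 - N (theta psi') 0 0)
    (N th0 0 1 - N (theta psi') 0 1) (N th0 1 1 - N (theta psi') 1 1)
    (prec psi' 0) (prec psi' 1) (regr psi') <=
    2 * (1 + hi) ^+ 2 * (2 * (1 + hi) * hi) * L * e.
  apply: (le_trans (ler_norm _)).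
  have B i j : `|N th0 i j - N (theta psi') i j| <= 2 * (1 + hi) * L * hi.
    apply: (le_trans (NL _ _ i j th0b tb')); rewrite ler_wpM2l//.
    have /andP[q1 q2] := th0b; rewrite ler_norml; move: q1 q2 tl' th' lo0 hi0; clear.
    by move=> *; apply/andP; split; lra.
  have [w1 w2] := andP ob'.
  have w'0 : 0 <= prec psi' 1 <= hi by rewrite (le_trans (ltW lo0) w1).
  apply: le_trans (quadH_lipschitz _ _ _ (B 0 0) (B 0 1) (B 1 1) w'0 bb bb') _.
  rewrite -/(coord_dist psi psi') -/e le_eqVlt; apply/orP; left; apply/eqP; ring.
move: k1 k2; rewrite !quadHB => k1 k2.
have -> : n * (H (prec psi 0) (prec psi 1) (regr psi) - ln (prec psi 0) - ln (prec psi 1) -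
   (2 - ln (prec psi' 0) - ln (prec psi' 1))) =
   n * H (prec psi 0) (prec psi 1) (regr psi) - n * (ln (prec psi 0) + ln (prec psi 1)) -
   (n * H (prec psi' 0) (prec psi' 1) (regr psi') - n * (ln (prec psi' 0) + ln (prec psi' 1))).
  by rewrite H'; ring.
rewrite !E; move: (n * (ln _ + _)) (n * (ln (prec psi' 0) + _)) ll => x y ll.
by rewrite !mulrDl; lra.
Qed.

End coordinates.

(** * Fitted moments, and the way back from coordinates to parameters *)

Section comparison.
Context {R : realType}.
Implicit Types psi : param R.

(* [1 - rho^2] times the trace of [A(psi)^-1 x], for the symmetric matrix [x]. *)
Definition contrast (x11 x12 x22 : R) (psi : param R) : R :=
  x11 / sigma2 psi 0 - 2 * rho psi * x12 / (sigma psi 0 * sigma psi 1) + x22 / sigma2 psi 1.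

Lemma sigma_gt0 psi i : valid_param psi -> 0 < sigma psi i.
Proof. by move=> [_ s20 _]; rewrite sqrtr_gt0. Qed.

Lemma sigma_sqr psi i : valid_param psi -> sigma psi i ^+ 2 = sigma2 psi i.
Proof. by move=> [_ s20 _]; rewrite sqr_sqrtr// ltW. Qed.

(** Theta only enters as a scalar factor, which drops out of the fitting equations. *)
Lemma quadH_contrast psi x11 x12 x22 : valid_param psi ->
  quadH x11 x12 x22 (prec psi 0) (prec psi 1) (regr psi) =
  contrast x11 x12 x22 psi / (theta psi * (1 - rho psi ^+ 2)).
Proof.
move=> vp; have [th0 s20 r1] := vp; have [s0 s1] := (sigma_gt0 0 vp, sigma_gt0 1 vp).
have r0 : 0 < 1 - rho psi ^+ 2 by nra.
rewrite /contrast /quadH /prec /cond_var /regr /= -!(sigma_sqr _ vp).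
by field; rewrite !gt_eqF.
Qed.

(** With [prec1E] and [regrE]: the fitted moments of [coord_gap] are the entries of theta times
    [Amx psi]. *)
Lemma prec0E psi : valid_param psi -> (prec psi 0)^-1 = theta psi * sigma2 psi 0.
Proof. by rewrite /prec /cond_var /= mulr1 invrK. Qed.

Lemma prec1E psi : valid_param psi ->
  (prec psi 1)^-1 + regr psi ^+ 2 / prec psi 0 = theta psi * sigma2 psi 1.
Proof.
move=> vp; have [th0 s20 r1] := vp; have [s0 s1] := (sigma_gt0 0 vp, sigma_gt0 1 vp).
rewrite prec0E// invrK /cond_var /regr /= -!(sigma_sqr _ vp).
by field; rewrite !gt_eqF.
Qed.

Lemma regrE psi : valid_param psi ->
  regr psi / prec psi 0 = theta psi * (rho psi * (sigma psi 0 * sigma psi 1)).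
Proof.
move=> vp; have [th0 s20 r1] := vp; have [s0 s1] := (sigma_gt0 0 vp, sigma_gt0 1 vp).
rewrite prec0E// /regr -!(sigma_sqr _ vp).
by field; rewrite !gt_eqF.
Qed.

Lemma inv_lipschitz (lo x y : R) : 0 < lo -> lo <= x -> lo <= y ->
  `|x^-1 - y^-1| <= (lo ^+ 2)^-1 * `|x - y|.
Proof.
move=> lo0 hx hy; have x0 := lt_le_trans lo0 hx; have y0 := lt_le_trans lo0 hy.
rewrite (_ : x^-1 - y^-1 = (x * y)^-1 * (y - x)); last by field; rewrite !gt_eqF.
rewrite normrM distrC ler_wpM2r// ger0_norm; last by rewrite invr_ge0 mulr_ge0// ltW.
rewrite lef_pV2 ?posrE ?mulr_gt0 ?exprn_gt0// expr2.
by apply: ler_pM => //; exact: ltW.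
Qed.

Lemma sqrt_lipschitz (lo x y : R) : 0 < lo -> lo <= x -> lo <= y ->
  `|Num.sqrt x - Num.sqrt y| <= (Num.sqrt lo)^-1 * `|x - y|.
Proof.
move=> lo0 hx hy; have x0 := lt_le_trans lo0 hx; have y0 := lt_le_trans lo0 hy.
have sx : Num.sqrt lo <= Num.sqrt x by exact: ler_wsqrtr.
have sl : 0 < Num.sqrt lo by rewrite sqrtr_gt0.
have sy : 0 <= Num.sqrt y by exact: sqrtr_ge0.
rewrite mulrC ler_pdivlMr//.
rewrite -[x in leRHS]sqr_sqrtr ?(ltW x0)// -[y in leRHS]sqr_sqrtr ?(ltW y0)//.
rewrite subr_sqr normrM ler_wpM2l// ger0_norm; lra.
Qed.

(** C2 serves the products theta sigma_k^2, the last summand rho. The roots come from 1/hi <= theta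
    sigma_k^2 for both k and theta sigma_1^2 <= 1/lo. *)
Definition lip_const (lo hi : R) : R :=
  let C2 := (lo ^+ 2)^-1 + 2 * hi / lo + hi ^+ 2 / lo ^+ 2 in
  1 + C2 + (Num.sqrt lo^-1 + hi * (Num.sqrt hi^-1)^-1 * C2 + (Num.sqrt hi^-1)^-1 * C2) *
  (Num.sqrt hi^-1)^-1.

(** The coordinates determine theta sigma_1^2, theta sigma_2^2 and rho, but not theta. For rho the
    relation is rho sqrt(theta sigma_2^2) = regr sqrt(theta sigma_1^2), where the second root is
    bounded away from 0. *)
Lemma coord_lipschitz (lo hi : R) psi psi' : 0 < lo ->
  coord_bounds lo hi psi -> coord_bounds lo hi psi' ->
  let C := lip_const lo hi in
  [/\ `|theta psi * sigma2 psi 0 - theta psi' * sigma2 psi' 0| <= C * coord_dist psi psi',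
      `|theta psi * sigma2 psi 1 - theta psi' * sigma2 psi' 1| <= C * coord_dist psi psi'
    & `|rho psi - rho psi'| <= C * coord_dist psi psi'].
Proof.
move=> lo0 cb cb' C.
have [vp /andP[t1 t2] /andP[a1 a2] /andP[w1 w2] bb] := cb.
have [vp' /andP[t1' t2'] /andP[a1' a2'] /andP[w1' w2'] bb'] := cb'.
set e := coord_dist psi psi'; have e0 : 0 <= e by exact: coord_dist_ge0.
have hi0 : 0 < hi by lra.
have [ea ew eb] : [/\ `|prec psi 0 - prec psi' 0| <= e, `|prec psi 1 - prec psi' 1| <= e &
    `|regr psi - regr psi'| <= e].
  rewrite /e /coord_dist; have := normr_ge0 (prec psi 0 - prec psi' 0).
  have := normr_ge0 (prec psi 1 - prec psi' 1); have := normr_ge0 (regr psi - regr psi').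
  by move: `|_| `|_| `|_| => *; split; lra.
pose C2 := (lo ^+ 2)^-1 + 2 * hi / lo + hi ^+ 2 / lo ^+ 2.
have i1 : 0 <= (lo ^+ 2)^-1 by rewrite invr_ge0 sqr_ge0.
have i2 : 0 <= 2 * hi / lo by rewrite divr_ge0 ?mulr_ge0 ?(ltW hi0) ?(ltW lo0).
have i3 : 0 <= hi ^+ 2 / lo ^+ 2 by rewrite divr_ge0 ?sqr_ge0.
have C20 : 0 <= C2 by rewrite !addr_ge0.
set qh := Num.sqrt hi^-1; have qh0 : 0 < qh by rewrite sqrtr_gt0 invr_gt0.
have iqh0 : 0 <= qh^-1 by rewrite invr_ge0 ltW.
pose C3 := (Num.sqrt lo^-1 + hi * qh^-1 * C2 + qh^-1 * C2) * qh^-1.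
have C30 : 0 <= C3.
  by rewrite mulr_ge0// addr_ge0 ?addr_ge0 ?sqrtr_ge0 ?mulr_ge0// ltW.
have CE : C = 1 + C2 + C3 by [].
have ha : `|(prec psi 0)^-1 - (prec psi' 0)^-1| <= (lo ^+ 2)^-1 * e.
  by apply: (le_trans (inv_lipschitz lo0 a1 a1')); rewrite ler_wpM2l.
have hw : `|(prec psi 1)^-1 - (prec psi' 1)^-1| <= (lo ^+ 2)^-1 * e.
  by apply: (le_trans (inv_lipschitz lo0 w1 w1')); rewrite ler_wpM2l.
have h1 : `|theta psi * sigma2 psi 0 - theta psi' * sigma2 psi' 0| <= C2 * e.
  by rewrite -!prec0E//; apply: (le_trans ha); rewrite ler_wpM2r// /C2; lra.
have h2 : `|theta psi * sigma2 psi 1 - theta psi' * sigma2 psi' 1| <= C2 * e.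
  rewrite -!prec1E//.
  rewrite (_ : _ - _ = ((prec psi 1)^-1 - (prec psi' 1)^-1) +
    ((regr psi - regr psi') * ((regr psi + regr psi') / prec psi 0) +
      regr psi' ^+ 2 * ((prec psi 0)^-1 - (prec psi' 0)^-1))); last by ring.
  rewrite (_ : C2 * e = (lo ^+ 2)^-1 * e + (2 * hi / lo * e + hi ^+ 2 / lo ^+ 2 * e)); last first.
    by rewrite /C2; ring.
  apply: (le_trans (ler_normD _ _)); apply: lerD => //.
  apply: (le_trans (ler_normD _ _)); apply: lerD; rewrite normrM.
    rewrite mulrC; apply: ler_pM => //.
    rewrite normrM; apply: ler_pM => //.
      by apply: (le_trans (ler_normD _ _)); lra.
    have pr0 := lt_le_trans lo0 a1.
    by rewrite normfV (gtr0_norm pr0) lef_pV2.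
  rewrite -mulrA; apply: ler_pM => //; rewrite normrX.
  by rewrite lerXn2r ?nnegrE// ltW.
have B0 q : coord_bounds lo hi q -> hi^-1 <= theta q * sigma2 q 0 <= lo^-1.
  move=> [vq _ /andP[l1 l2] _ _]; rewrite -prec0E// !lef_pV2 ?posrE//; first exact/andP.
  - exact: lt_le_trans l1.
  - exact: lt_le_trans l1.
have B1 q : coord_bounds lo hi q -> hi^-1 <= theta q * sigma2 q 1.
  move=> [vq _ /andP[k1 k2] /andP[l1 l2] _]; rewrite -prec1E//.
  apply: (@le_trans _ _ (prec q 1)^-1).
    by rewrite lef_pV2 ?posrE//; exact: lt_le_trans l1.
  by rewrite lerDl divr_ge0 ?sqr_ge0//; lra.
have RE (q : param R) : valid_param q -> rho q * Num.sqrt (theta q * sigma2 q 1) =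
    regr q * Num.sqrt (theta q * sigma2 q 0).
  move=> vq; have [t0 s0 _] := vq; rewrite !sqrtrM ?(ltW t0)// -/(sigma q 0) -/(sigma q 1).
  by have := sigma_gt0 0 vq; rewrite /regr => h0; field; rewrite gt_eqF.
split; first by rewrite (le_trans h1)// ler_wpM2r// CE; lra.
  by rewrite (le_trans h2)// ler_wpM2r// CE; lra.
apply: (@le_trans _ _ (C3 * e)); last by rewrite ler_wpM2r// CE; lra.
have [/andP[k1 k2] /andP[k1' _]] := (B0 _ cb, B0 _ cb').
have [l1 l1'] := (B1 _ cb, B1 _ cb').
have ihi0 : 0 < hi^-1 by rewrite invr_gt0.
have d1 := sqrt_lipschitz ihi0 k1 k1'; have d2 := sqrt_lipschitz ihi0 l1 l1'.
have q1 : Num.sqrt (theta psi * sigma2 psi 0) <= Num.sqrt lo^-1 by exact: ler_wsqrtr.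
have q2 : qh <= Num.sqrt (theta psi * sigma2 psi 1) by exact: ler_wsqrtr.
have p1 := RE _ vp; have p2 := RE _ vp'.
have D1 := le_trans d1 (ler_wpM2l iqh0 h1); have D2 := le_trans d2 (ler_wpM2l iqh0 h2).
have rho1 : `|rho psi'| <= 1.
  by have [_ _ /andP[m1 m2]] := vp'; rewrite ler_norml !ltW.
have s10 : 0 <= Num.sqrt (theta psi * sigma2 psi 0) by exact: sqrtr_ge0.
move: (Num.sqrt (theta psi * _)) (Num.sqrt (theta psi' * _)) (Num.sqrt (theta psi * _))
  (Num.sqrt (theta psi' * _)) D1 D2 q1 q2 p1 p2 s10 => S2 S2' S1 S1' D1 D2 q1 q2 p1 p2 s10.
have S20 := lt_le_trans qh0 q2.
rewrite (_ : rho psi - rho psi' = ((regr psi - regr psi') * S1 + regr psi' * (S1 - S1') -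
   rho psi' * (S2 - S2')) / S2); last first.
  rewrite (_ : _ + _ - _ = regr psi * S1 - regr psi' * S1' - rho psi' * (S2 - S2')); last by ring.
  by rewrite -p1 -p2; field; rewrite gt_eqF.
rewrite normrM normfV (gtr0_norm S20) /C3 [C3 * e]mulrAC.
apply: ler_pM => //; rewrite ?invr_ge0 ?(ltW S20)//; last first.
  by rewrite lef_pV2 ?posrE.
rewrite (_ : _ * e = e * Num.sqrt lo^-1 + hi * (qh^-1 * (C2 * e)) + 1 * (qh^-1 * (C2 * e))); last by ring.
apply: (le_trans (ler_normB _ _)); apply: lerD; last by rewrite normrM ler_pM.
apply: (le_trans (ler_normD _ _)); apply: lerD; rewrite normrM.
  by rewrite (ger0_norm s10); apply: ler_pM.
by apply: ler_pM.
Qed.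

(** The fitting equations are asked only at the two parameters compared: with known variances there
    are fewer free parameters than moments, and the contrast on the box need not see them all. *)
Lemma estimator_core m (s : 'I_m.+1 -> R) (z : 'I_2 -> R -> R) (lo hi C1 th0 : R) psi psi' :
  (forall i j : 'I_m.+1, (i < j)%N -> s i < s j) -> (forall i, 0 <= s i <= 1) ->
  0 < lo -> 0 <= C1 -> lo <= th0 <= hi ->
  coord_bounds lo hi psi -> coord_bounds lo hi psi' ->
  negloglik s z psi <= negloglik s z psi' ->
  let t k := s (inord k) in
  let p i j := quadN t m th0 (path t z i) (path t z j) / m.+1%:R in
  (forall q, q = psi \/ q = psi' -> contrast (p 0 0) (p 0 1) (p 1 1) q =
    contrast (theta psi' * sigma2 psi' 0) (theta psi' * (rho psi' * (sigma psi' 0 * sigma psi' 1)))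
      (theta psi' * sigma2 psi' 1) q) ->
  `|theta psi - theta psi'| <= C1 * coord_dist psi psi' ->
  let B := lip_const lo hi * close_const lo hi C1 *
    (1 + roughness t m (path t z 0) + roughness t m (path t z 1)) / m.+1%:R in
  [/\ `|theta psi * sigma2 psi 0 - theta psi' * sigma2 psi' 0| <= B,
      `|theta psi * sigma2 psi 1 - theta psi' * sigma2 psi' 1| <= B
    & `|rho psi - rho psi'| <= B].
Proof.
move=> s_incr s01 lo0 C10 th0b cb cb' ll t p eqp hth B.
have [vp _ _ _ _] := cb; have [vp' _ _ _ _] := cb'.
have n0 : 0 < m.+1%:R :> R by rewrite ltr0n.
have h : m.+1%:R * coord_dist psi psi' <= close_const lo hi C1 *
    (1 + roughness t m (path t z 0) + roughness t m (path t z 1)).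
  apply: (estimator_close s_incr s01 lo0 C10 th0b cb cb' ll _ _ hth).
    by rewrite prec1E// regrE// prec0E// !quadH_contrast// -eqp//; left.
  rewrite !quadH_contrast// eqp; last by right.
  have [s0 s1] := (sigma_gt0 0 vp', sigma_gt0 1 vp').
  have [t0 _ r1] := vp'; have r0 : 0 < 1 - rho psi' ^+ 2 by nra.
  by rewrite /contrast -!(sigma_sqr _ vp'); field; rewrite !gt_eqF.
have [h1 h2 h3] := coord_lipschitz lo0 cb cb'.
have l0 : 0 <= lip_const lo hi.
  rewrite /lip_const /=; have hi0 : 0 <= hi by case/andP: th0b; lra.
  have i1 : 0 <= (Num.sqrt hi^-1)^-1 by rewrite invr_ge0 sqrtr_ge0.
  have i2 : 0 <= (lo ^+ 2)^-1 + 2 * hi / lo + hi ^+ 2 / lo ^+ 2.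
    have j1 : 0 <= (lo ^+ 2)^-1 by rewrite invr_ge0 sqr_ge0.
    have j2 : 0 <= 2 * hi / lo by apply: divr_ge0; [exact: mulr_ge0|exact: ltW].
    have j3 : 0 <= hi ^+ 2 / lo ^+ 2 by rewrite divr_ge0 ?sqr_ge0.
    by rewrite addr_ge0// addr_ge0.
  have i3 : 0 <= Num.sqrt lo^-1 by exact: sqrtr_ge0.
  move: (_ + _ + _) (Num.sqrt lo^-1) (_^-1) i1 i2 i3 => x y w x0 y0 w0.
  by rewrite addr_ge0 ?mulr_ge0 ?addr_ge0 ?mulr_ge0.
have hB : lip_const lo hi * coord_dist psi psi' <= B.
  rewrite /B; move: (lip_const _ _) (close_const _ _ _) l0 h => x y x0 h.
  by rewrite -2!mulrA ler_wpM2l// mulrA ler_pdivlMr// mulrC.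
by split; apply: le_trans hB.
Qed.

Lemma box_coord_bounds a b psi0 : 0 < theta a -> (forall i, 0 < sigma2 a i) ->
  -1 < rho a -> rho b < 1 -> in_box a b psi0 ->
  exists lo hi : R, 0 < lo /\ forall psi, in_box a b psi -> coord_bounds lo hi psi.
Proof.
move=> ta0 sa0 ra rb [/andP[t1 t2] s12 /andP[r1 r2]].
have tb0 : 0 < theta b by lra.
have sb0 i : 0 < sigma2 b i by have /andP[h1 h2] := s12 i; exact: lt_le_trans (le_trans h1 h2).
(* A lower bound on the box for 1 - rho^2 = (1 - rho) (1 + rho). *)
pose k := (1 - rho b) * (1 + rho a).
have k0 : 0 < k by rewrite mulr_gt0//; lra.
pose lo := Num.min (theta a) (Num.min (theta b * sigma2 b 0)^-1 (theta b * sigma2 b 1)^-1).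
pose hi := theta b + (theta a * sigma2 a 0)^-1 + (theta a * (sigma2 a 1 * k))^-1 +
  sigma b 1 / sigma a 0.
have c1 : 0 < (theta a * sigma2 a 0)^-1 by rewrite invr_gt0 mulr_gt0.
have c2 : 0 < (theta a * (sigma2 a 1 * k))^-1 by rewrite invr_gt0 mulr_gt0// mulr_gt0.
have c3 : 0 <= sigma b 1 / sigma a 0 by rewrite divr_ge0 ?sqrtr_ge0.
exists lo, hi; split.
  by rewrite /lo !lt_min ta0 !invr_gt0 !mulr_gt0.
move=> psi [/andP[p1 p2] ps /andP[q1 q2]].
have th0 := lt_le_trans ta0 p1.
have s20 i : 0 < sigma2 psi i by have /andP[h1 _] := ps i; exact: lt_le_trans h1.
have /andP[x1 x2] := ps 0; have /andP[y1 y2] := ps 1.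
have rk : k <= 1 - rho psi ^+ 2.
  have e1 : 0 <= (rho b - rho psi) * (1 + rho a) by apply: mulr_ge0; lra.
  have e2 : 0 <= (rho psi - rho a) * (1 - rho psi) by apply: mulr_ge0; lra.
  rewrite /k; lra.
clearbody k.
have rk1 : 1 - rho psi ^+ 2 <= 1 by rewrite gerBl sqr_ge0.
have vp : valid_param psi by split => //; apply/andP; split; lra.
have m0 : theta a * sigma2 a 0 <= theta psi * sigma2 psi 0 by apply: ler_pM => //; exact: ltW.
have M0 : theta psi * sigma2 psi 0 <= theta b * sigma2 b 0 by apply: ler_pM => //; exact: ltW.
have m1 : theta a * (sigma2 a 1 * k) <= theta psi * (sigma2 psi 1 * (1 - rho psi ^+ 2)).
  apply: ler_pM => //; rewrite ?mulr_ge0 ?(ltW ta0) ?(ltW (sa0 _)) ?(ltW k0)//.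
  by apply: ler_pM => //; exact: ltW.
have M1 : theta psi * (sigma2 psi 1 * (1 - rho psi ^+ 2)) <= theta b * sigma2 b 1.
  apply: ler_pM => //; rewrite ?mulr_ge0 ?(ltW th0) ?(ltW (s20 _)) ?(le_trans (ltW k0))//.
  rewrite -[leRHS]mulr1; apply: ler_pM => //; first exact: ltW.
  exact: le_trans (ltW k0) rk.
have g0 : 0 < theta a * sigma2 a 0 by rewrite mulr_gt0.
have g1 : 0 < theta a * (sigma2 a 1 * k) by rewrite mulr_gt0// mulr_gt0.
split => //.
- by rewrite /lo /hi ge_min p1 /=; lra.
- rewrite /prec /cond_var /= mulr1; apply/andP; split.
    rewrite /lo !ge_min; apply/orP; right; apply/orP; left.
    by rewrite lef_pV2 ?posrE// (lt_le_trans g0)// (le_trans m0).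
  apply: (@le_trans _ _ (theta a * sigma2 a 0)^-1); last by rewrite /hi; lra.
  by rewrite lef_pV2 ?posrE// (lt_le_trans g0).
- rewrite /prec /cond_var /=; apply/andP; split.
    rewrite /lo !ge_min; apply/orP; right; apply/orP; right.
    by rewrite lef_pV2 ?posrE ?(lt_le_trans g1)// (le_trans m1).
  apply: (@le_trans _ _ (theta a * (sigma2 a 1 * k))^-1); last by rewrite /hi; lra.
  by rewrite lef_pV2 ?posrE// (lt_le_trans g1).
apply: (@le_trans _ _ (sigma b 1 / sigma a 0)); last by rewrite /hi; lra.
have sp i : 0 < sigma psi i by exact: sigma_gt0.
have sa : 0 < sigma a 0 by rewrite sqrtr_gt0.
rewrite /regr normrM normfV (gtr0_norm (sp 0)) normrM (gtr0_norm (sp 1)).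
apply: ler_pM; rewrite ?invr_ge0 ?mulr_ge0 ?(ltW (sp _))//; last first.
  by rewrite lef_pV2 ?posrE// ler_wsqrtr.
rewrite -[leRHS]mul1r; apply: ler_pM => //; rewrite ?(ltW (sp _))//; last exact: ler_wsqrtr.
by rewrite ler_norml; apply/andP; split; lra.
Qed.

(** With the variances known, a bound for theta sigma_1^2 is one for theta; this supplies the
    control of theta by the coordinate distance. *)
Lemma known_sigma_close a b psi0 : 0 < theta a -> (forall i, 0 < sigma2 a i) ->
  -1 < rho a -> rho b < 1 -> in_box a b psi0 ->
  exists C : R, forall m (s : 'I_m.+1 -> R) (z : 'I_2 -> R -> R) psi psi',
  (forall i j : 'I_m.+1, (i < j)%N -> s i < s j) -> (forall i, 0 <= s i <= 1) ->
  in_box a b psi -> in_box a b psi' ->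
  (forall i, sigma2 psi i = sigma2 psi0 i) -> (forall i, sigma2 psi' i = sigma2 psi0 i) ->
  negloglik s z psi <= negloglik s z psi' ->
  let t k := s (inord k) in
  let p i j := quadN t m (theta psi0) (path t z i) (path t z j) / m.+1%:R in
  (forall q, q = psi \/ q = psi' -> contrast (p 0 0) (p 0 1) (p 1 1) q =
    contrast (theta psi' * sigma2 psi' 0) (theta psi' * (rho psi' * (sigma psi' 0 * sigma psi' 1)))
      (theta psi' * sigma2 psi' 1) q) ->
  let B := C * (1 + roughness t m (path t z 0) + roughness t m (path t z 1)) / m.+1%:R in
  `|theta psi - theta psi'| <= B /\ `|rho psi - rho psi'| <= B.
Proof.
move=> ta0 sa0 ra rb bx0.
have [lo [hi [lo0 cb]]] := box_coord_bounds ta0 sa0 ra rb bx0.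
have [vp0 t0b _ _ _] := cb _ bx0; have [th0 s20 _] := vp0.
pose C1 := `|lip_const lo hi| / sigma2 psi0 0.
have C10 : 0 <= C1 by rewrite divr_ge0// ltW.
pose C := `|lip_const lo hi * close_const lo hi C1| * (1 + (sigma2 psi0 0)^-1).
exists C => m s z psi psi' s_incr s01 bx bx' hs hs' ll t p eqp B.
have i0 : 0 < (sigma2 psi0 0)^-1 by rewrite invr_gt0.
have thE x : `|theta psi * sigma2 psi 0 - theta psi' * sigma2 psi' 0| <= x ->
    `|theta psi - theta psi'| <= x / sigma2 psi0 0.
  by rewrite hs hs' -mulrBl normrM (gtr0_norm (s20 0)) ler_pdivlMr.
have hth : `|theta psi - theta psi'| <= C1 * coord_dist psi psi'.
  have [h _ _] := coord_lipschitz lo0 (cb _ bx) (cb _ bx').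
  apply: (le_trans (thE _ h)); rewrite /C1 mulrAC; apply: ler_wpM2r; first exact: coord_dist_ge0.
  by apply: ler_wpM2r; [exact: ltW|exact: ler_norm].
have [h1 _ h3] := estimator_core s_incr s01 lo0 C10 t0b (cb _ bx) (cb _ bx') ll eqp hth.
have t_incr i : (i < m)%N -> t i < t i.+1.
  by move=> im; apply: s_incr; rewrite !inordK// ltnS ltnW.
set L := 1 + _ + _ in h1 h3 B *.
have L0 : 0 <= L by rewrite /L addr_ge0 ?roughness_ge0// addr_ge0// roughness_ge0.
have Ln0 : 0 <= L / m.+1%:R by rewrite divr_ge0.
set k := lip_const lo hi * close_const lo hi C1.
have kn : k * L / m.+1%:R <= `|k| * (L / m.+1%:R) by rewrite -mulrA ler_wpM2r// ler_norm.
have kn0 : 0 <= `|k| * (L / m.+1%:R) by rewrite mulr_ge0.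
split.
  apply: (le_trans (thE _ h1)); rewrite /B /C.
  apply: (@le_trans _ _ (`|k| * (L / m.+1%:R) * (sigma2 psi0 0)^-1)).
    by rewrite ler_wpM2r// ltW.
  rewrite (_ : _ * L / _ = `|k| * (L / m.+1%:R) * (1 + (sigma2 psi0 0)^-1)); last by rewrite /k; ring.
  by rewrite ler_wpM2l//; lra.
apply: (le_trans h3); apply: (le_trans kn); rewrite /B /C.
rewrite (_ : _ * L / _ = `|k| * (L / m.+1%:R) * (1 + (sigma2 psi0 0)^-1)); last by rewrite /k; ring.
by rewrite ler_peMr//; lra.
Qed.

End comparison.

Lemma cubic_inv_le {R : realType} (g m : R) : 3 / 4 <= g -> 3 / 4 <= m ->
  `|(4 * (g * m * (m + g)))^-1| <= 4 / 5.
Proof.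
move=> g34 m2.
have gm : 3 / 4 * (3 / 4) <= g * m by apply: ler_pM => //; lra.
have gm2 : 3 / 4 * (3 / 4) * (3 / 4 + 3 / 4) <= g * m * (m + g).
  by apply: ler_pM => //; lra.
have k0 : 0 < 4 * (g * m * (m + g)) by lra.
rewrite normfV (gtr0_norm k0) -[leRHS]invrK lef_pV2 ?posrE ?invf_div//; lra.
Qed.

(** * Linearization of the fitted parameters *)

Section linearization.
Context {R : realType}.
Variables (r c : R).
Hypothesis rc : c ^+ 2 = 1 - r ^+ 2.
Implicit Types X W Y h : R.

(* With [x], [y] the standardized independent innovations of the two components, [1 + X],
   [cross X W] and [1 + second X W Y] are the normalized empirical second moments of the
   innovations when [X], [W], [Y] are the empirical means of [x^2 - 1], [x y], [y^2 - 1]. *)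
Definition cross X W : R := r + r * X + c * W.
Definition second X W Y : R := r ^+ 2 * X + 2 * r * c * W + c ^+ 2 * Y.
(** The mean of the two normalized second moments: the fitted theta divided by theta_0 when only the
    variances are known. *)
Definition mean2 X W Y : R := 1 + (X + second X W Y) / 2.
(** The first-order term common to both fitted correlations, with the arithmetic mean of the second
    moments as denominator or the geometric one. *)
Definition rho_lin X W Y : R := r * c ^+ 2 / 2 * X + c ^+ 3 * W - r * c ^+ 2 / 2 * Y.

Let r1 : `|r| <= 1.
Proof.
have h := sqr_ge0 c; rewrite rc in h; rewrite ler_norml.
by apply/andP; split; nra.
Qed.

Let c1 : `|c| <= 1.
Proof.
have h : 0 <= 1 - c ^+ 2 by rewrite rc opprB addrCA subrr addr0 sqr_ge0.
by rewrite ler_norml; apply/andP; split; nra.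
Qed.

Let normM1 (x y h : R) : `|x| <= 1 -> `|y| <= h -> `|x * y| <= h.
Proof. by move=> x1 yh; rewrite normrM -[leRHS]mul1r ler_pM. Qed.

Lemma second_norm_le X W Y h : `|X| <= h -> `|W| <= h -> `|Y| <= h -> `|second X W Y| <= 4 * h.
Proof.
move=> hX hW hY.
have h1 : `|r * (r * X)| <= h by do 2 apply: normM1 => //.
have h2 : `|r * (c * W)| <= h by do 2 apply: normM1 => //.
have h3 : `|c * (c * Y)| <= h by do 2 apply: normM1 => //.
rewrite (_ : second X W Y = r * (r * X) + (r * (c * W) + r * (c * W)) + c * (c * Y)); last first.
  by rewrite /second; ring.
apply: (le_trans (ler_normD _ _)); have := ler_normD (r * (r * X)) (r * (c * W) + r * (c * W)).
have := ler_normD (r * (c * W)) (r * (c * W)); lra.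
Qed.

Lemma rho_lin_norm_le X W Y h : `|X| <= h -> `|W| <= h -> `|Y| <= h -> `|rho_lin X W Y| <= 2 * h.
Proof.
move=> hX hW hY.
have h1 : `|r * (c * (c * X))| <= h by do 3 apply: normM1 => //.
have h2 : `|c * (c * (c * W))| <= h by do 3 apply: normM1 => //.
have h3 : `|r * (c * (c * Y))| <= h by do 3 apply: normM1 => //.
rewrite (_ : rho_lin X W Y = r * (c * (c * X)) / 2 + c * (c * (c * W)) - r * (c * (c * Y)) / 2).
  move: h1 h2 h3; rewrite !ler_norml => /andP[? ?] /andP[? ?] /andP[? ?]; apply/andP; split; lra.
by rewrite /rho_lin; field.
Qed.

Lemma mean2_bounds X W Y h : h <= 16^-1 -> `|X| <= h -> `|W| <= h -> `|Y| <= h ->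
  `|mean2 X W Y - 1| <= 5 / 2 * h /\ 3 / 4 <= mean2 X W Y.
Proof.
move=> h16 hX hW hY; have := second_norm_le hX hW hY; move: hX.
rewrite /mean2 !ler_norml => /andP[? ?] /andP[? ?]; split; [apply/andP; split|]; lra.
Qed.

(** The identity [cross] = r [mean2] + [rho_lin] is exact, so the error is [rho_lin] (1 - [mean2]) /
    [mean2], a product of two small factors. The bound 1/16 keeps [mean2] above 3/4. *)
Lemma rho_linearization X W Y h : h <= 16^-1 -> `|X| <= h -> `|W| <= h -> `|Y| <= h ->
  `|cross X W / mean2 X W Y - r - rho_lin X W Y| <= 20 * h ^+ 2.
Proof.
move=> h16 hX hW hY; have [m1 m2] := mean2_bounds h16 hX hW hY.
have m0 : 0 < mean2 X W Y by lra.
have h0 : 0 <= h by exact: le_trans hX.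
have -> : cross X W / mean2 X W Y - r - rho_lin X W Y =
   rho_lin X W Y * (1 - mean2 X W Y) * (mean2 X W Y)^-1.
  have -> : cross X W = r * mean2 X W Y + rho_lin X W Y.
    rewrite /cross /mean2 /second /rho_lin.
    rewrite (_ : c ^+ 3 = c * (1 - r ^+ 2)); last by rewrite -rc; ring.
    by rewrite rc; field.
  by field; rewrite gt_eqF.
rewrite (_ : 20 * h ^+ 2 = 2 * h * (5 / 2 * h) * 4); last by field.
rewrite normrM; apply: ler_pM => //.
  by rewrite normrM; apply: ler_pM => //; [exact: rho_lin_norm_le|rewrite distrC].
rewrite normfV (gtr0_norm m0) -[leRHS]invrK lef_pV2 ?posrE//; lra.
Qed.

(** The squares of the arithmetic mean m and the geometric mean g of 1 + X and 1 + E differ by (X -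
    E)^2 / 4, so that exchanging the denominators costs only second order. *)
Lemma rho_sqrt_linearization X W Y h : h <= 16^-1 -> `|X| <= h -> `|W| <= h -> `|Y| <= h ->
  `|cross X W / Num.sqrt ((1 + X) * (1 + second X W Y)) - r - rho_lin X W Y| <= 60 * h ^+ 2.
Proof.
move=> h16 hX hW hY; have [m1 m2] := mean2_bounds h16 hX hW hY.
have hl := rho_linearization h16 hX hW hY.
have hE := second_norm_le hX hW hY.
have h0 : 0 <= h by exact: le_trans hX.
set E := second X W Y in hE *; set m := mean2 X W Y in m1 m2 hl.
have mE : m = 1 + (X + E) / 2 by [].
have m0 : 0 < m by lra.
have [X1 E1] : 15 / 16 <= 1 + X /\ 3 / 4 <= 1 + E.
  by move: hX hE; rewrite !ler_norml => /andP[? ?] /andP[? ?]; split; lra.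
have p0 : (3 / 4) ^+ 2 <= (1 + X) * (1 + E).
  by apply: (@le_trans _ _ (15 / 16 * (3 / 4))); [lra|apply: ler_pM => //; lra].
set g := Num.sqrt _.
have g34 : 3 / 4 <= g.
  by rewrite -(@ger0_norm _ (3 / 4))// -sqrtr_sqr; exact: ler_wsqrtr.
have g0 : 0 < g by lra.
have gE : g ^+ 2 = (1 + X) * (1 + E) by rewrite sqr_sqrtr//; lra.
have cr : `|cross X W| <= 2.
  have := normM1 r1 hX; have := normM1 c1 hW; move: r1; rewrite /cross !ler_norml.
  by move=> /andP[? ?] /andP[? ?] /andP[? ?]; apply/andP; split; lra.
have XE : `|X - E| <= 5 * h.
  by move: hX hE; rewrite !ler_norml => /andP[? ?] /andP[? ?]; apply/andP; split; lra.
have -> : cross X W / g - r - rho_lin X W Y =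
    (cross X W / m - r - rho_lin X W Y) +
    cross X W * ((X - E) ^+ 2 * (4 * (g * m * (m + g)))^-1).
  have -> : (X - E) ^+ 2 = 4 * (m ^+ 2 - g ^+ 2) by rewrite gE mE; field.
  by field; rewrite !gt_eqF// addr_gt0.
apply: (le_trans (ler_normD _ _)).
rewrite (_ : 60 * h ^+ 2 = 20 * h ^+ 2 + 2 * ((5 * h) ^+ 2 * (4 / 5))); last by field.
apply: lerD => //; rewrite normrM; apply: ler_pM => //.
rewrite normrM normrX; apply: ler_pM => //; first by rewrite lerXn2r ?nnegrE// mulr_ge0.
exact: cubic_inv_le.
Qed.

End linearization.

Lemma projection_dist {R : realType} (lo up x d : R) : lo <= up -> 0 <= d ->
  lo - x <= d -> x - up <= d ->
  let y := Num.max lo (Num.min x up) in lo <= y <= up /\ `|x - y| <= d.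
Proof.
move=> lu d0 h1 h2 /=; rewrite ler_norml.
by case: (leP x up) => h3; [case: (leP lo x)|case: (leP lo up)] => h4;
  split; apply/andP; split; lra.
Qed.

Section elementary_bounds.
Context {R : realType}.
Implicit Types x y h d a b g th : R.

Lemma addr1_gt0 x h : `|x| <= h -> h < 1 -> 0 < 1 + x.
Proof. by rewrite ler_norml => /andP[? ?] ?; lra. Qed.

Lemma perturb_bounds x d g a b : `|d| <= g -> g <= x - a -> g <= b - x -> a <= x + d <= b.
Proof. by rewrite ler_norml => /andP[? ?] ? ?; apply/andP; split; lra. Qed.

Lemma mean2_scale th h g : 0 < th -> 0 <= g -> h <= g / th / 3 -> th * (5 / 2 * h) <= g.
Proof.
move=> th0 g0 hg; rewrite mulrC -ler_pdivlMr//.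
have q0 : 0 <= g / th by rewrite divr_ge0// ltW.
lra.
Qed.

Lemma rho_near x y l h : `|x - y - l| <= 60 * h ^+ 2 -> `|l| <= 2 * h -> 0 <= h ->
  h <= 16^-1 -> `|x - y| <= 6 * h.
Proof.
move=> h1 h2 h0 h16; have q : 60 * h ^+ 2 <= 4 * h by rewrite expr2 mulrA ler_wpM2r//; lra.
move: h1 h2; rewrite !ler_norml => /andP[? ?] /andP[? ?]; apply/andP; split; lra.
Qed.

Lemma ratio_sub_le th x y a b : 0 < th -> 0 < a -> a <= x -> x <= b ->
  y / b - th <= `|th * x - y| / a.
Proof.
move=> th0 a0 ax xb; have b0 : 0 < b by lra.
apply: (@le_trans _ _ (`|th * x - y| / b)); last first.
  by rewrite ler_wpM2l// lef_pV2 ?posrE//; lra.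
rewrite ler_pdivlMr// mulrBl divfK ?gt_eqF//.
have := ler_norm (y - th * x); rewrite distrC.
have : th * x <= th * b by rewrite ler_wpM2l// ltW.
lra.
Qed.

Lemma sub_ratio_le th x y a : 0 < th -> 0 < a -> a <= x ->
  th - y / a <= `|th * x - y| / a.
Proof.
move=> th0 a0 ax; rewrite ler_pdivlMr// mulrBl divfK ?gt_eqF//.
have := ler_norm (th * x - y); have : th * a <= th * x by rewrite ler_wpM2l// ltW.
lra.
Qed.

Lemma max3_sub_le th a x y d1 d2 : a <= th -> x - th <= d1 -> y - th <= d2 ->
  0 <= d1 -> 0 <= d2 -> Num.max a (Num.max x y) - th <= d1 + d2.
Proof. by move=> *; rewrite lerBlDr !ge_max; apply/and3P; split; lra. Qed.

Lemma sub_min3_le th a x y d1 d2 : th <= a -> th - x <= d1 -> th - y <= d2 ->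
  0 <= d1 -> 0 <= d2 -> th - Num.min a (Num.min x y) <= d1 + d2.
Proof. by move=> *; rewrite lerBlDl -lerBlDr !le_min; apply/and3P; split; lra. Qed.

End elementary_bounds.

(** * The comparison points of the three cases *)

Section cases.
Context {R : realType}.
Variables (psi0 a b : param R) (c : R).
Hypotheses (ta0 : 0 < theta a) (sa0 : forall i, 0 < sigma2 a i).
Hypotheses (ra : -1 < rho a) (rb : rho b < 1) (bx0 : in_box a b psi0).
Hypothesis rc : c ^+ 2 = 1 - rho psi0 ^+ 2.

Local Notation th0 := (theta psi0).
Local Notation r := (rho psi0).

Definition design m (s : 'I_m.+1 -> R) : Prop :=
  (forall i j : 'I_m.+1, (i < j)%N -> s i < s j) /\ (forall i, 0 <= s i <= 1).

Definition times m (s : 'I_m.+1 -> R) (k : nat) : R := s (inord k).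

Definition moment m (s : 'I_m.+1 -> R) z (i j : 'I_2) : R :=
  quadN (times s) m th0 (path (times s) z i) (path (times s) z j) / m.+1%:R.

Definition expanded m (s : 'I_m.+1 -> R) z X W Y : Prop :=
  [/\ moment s z 0 0 = th0 * sigma2 psi0 0 * (1 + X),
      moment s z 0 1 = th0 * (sigma psi0 0 * sigma psi0 1) * cross r c X W
    & moment s z 1 1 = th0 * sigma2 psi0 1 * (1 + second r c X W Y)].

Definition rough_total m (s : 'I_m.+1 -> R) z : R :=
  1 + roughness (times s) m (path (times s) z 0) + roughness (times s) m (path (times s) z 1).

Definition minimizes m (s : 'I_m.+1 -> R) z psi : Prop :=
  in_box a b psi /\ forall psi', in_box a b psi' -> negloglik s z psi <= negloglik s z psi'.

Let valid0 : valid_param psi0.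
Proof. by have [lo [hi [_ cb]]] := box_coord_bounds ta0 sa0 ra rb bx0; case: (cb _ bx0). Qed.

Let th0_gt0 : 0 < th0. Proof. by case: valid0. Qed.
Let s20 i : 0 < sigma2 psi0 i. Proof. by case: valid0 => _ h _. Qed.
Let s0 i : 0 < sigma psi0 i. Proof. exact: sigma_gt0. Qed.
Let ss i : sigma psi0 i ^+ 2 = sigma2 psi0 i. Proof. exact: sigma_sqr. Qed.

(** At the true variances and correlation the contrast of the moments is a multiple of 2 + X + Y:
    the cross term W cancels, and theta alone can fit it. The radius [h0] keeps the fitted theta in
    the box. *)
Lemma known_sigma_rho_close : theta a < th0 < theta b ->
  exists C h0 : R, 0 < h0 /\ forall m (s : 'I_m.+1 -> R) z psi X W Y,
  design s -> minimizes s z psi ->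
  (forall i, sigma2 psi i = sigma2 psi0 i) -> rho psi = r ->
  expanded s z X W Y -> `|X| <= h0 -> `|Y| <= h0 ->
  `|theta psi - th0 * (1 + (X + Y) / 2)| <= C * rough_total s z / m.+1%:R.
Proof.
move=> /andP[ga gb]; have [C hC] := known_sigma_close ta0 sa0 ra rb bx0.
pose g := Num.min (th0 - theta a) (theta b - th0).
have g0 : 0 < g by rewrite lt_min !subr_gt0 ga.
have [ga' gb'] : g <= th0 - theta a /\ g <= theta b - th0.
  by rewrite /g !ge_min !lexx orbT.
exists C, (g / th0); split; first by rewrite divr_gt0.
move=> m s z psi X W Y [s_incr s01] [bx mn] hs hr [E1 E2 E3] hX hY.
pose psi' := Param (th0 * (1 + (X + Y) / 2)) (sigma2 psi0) r.
have bx' : in_box a b psi'.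
  have [_ h2 h3] := bx0; split => //=.
  have h1 : `|th0 * X| <= g by rewrite normrM (gtr0_norm th0_gt0) mulrC -ler_pdivlMr.
  have h4 : `|th0 * Y| <= g by rewrite normrM (gtr0_norm th0_gt0) mulrC -ler_pdivlMr.
  move: h1 h4; rewrite !ler_norml => /andP[? ?] /andP[? ?].
  by apply/andP; split; lra.
apply: (proj1 (hC m s z psi psi' s_incr s01 bx bx' hs _ (mn _ bx') _)) => // q hq.
have sq i : sigma2 q i = sigma2 psi0 i by case: hq => ->.
have rq : rho q = r by case: hq => ->.
rewrite -/(moment s z 0 0) -/(moment s z 0 1) -/(moment s z 1 1) E1 E2 E3.
rewrite /contrast /sigma !sq -/(sigma psi0 0) -/(sigma psi0 1) rq -!ss /= /cross /second.
rewrite -/(sigma psi0 0) -/(sigma psi0 1).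
have [n0 n1] : sigma psi0 0 != 0 /\ sigma psi0 1 != 0 by rewrite !gt_eqF.
move: n0 n1; move: (sigma psi0 0) (sigma psi0 1) => x y n0 n1.
by rewrite rc; field; rewrite n0 n1.
Qed.

(** With known variances the contrast sees the sum of the normalized second moments and the cross
    moment; they are fitted by theta and by theta rho, hence by the two values given. *)
Lemma known_sigma_only_close : theta a < th0 < theta b -> rho a < r < rho b ->
  exists C h0 : R, 0 < h0 /\ forall m (s : 'I_m.+1 -> R) z psi X W Y,
  design s -> minimizes s z psi -> (forall i, sigma2 psi i = sigma2 psi0 i) ->
  expanded s z X W Y -> `|X| <= h0 -> `|W| <= h0 -> `|Y| <= h0 ->
  `|theta psi - th0 * mean2 r c X W Y| <= C * rough_total s z / m.+1%:R /\
  `|rho psi - cross r c X W / mean2 r c X W Y| <= C * rough_total s z / m.+1%:R.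
Proof.
move=> /andP[ga gb] /andP[gra grb]; have [C hC] := known_sigma_close ta0 sa0 ra rb bx0.
pose g := Num.min (th0 - theta a) (theta b - th0).
have g0 : 0 < g by rewrite lt_min !subr_gt0 ga.
have [ga' gb'] : g <= th0 - theta a /\ g <= theta b - th0.
  by rewrite /g !ge_min !lexx orbT.
pose k := Num.min (r - rho a) (rho b - r).
have k0 : 0 < k by rewrite lt_min !subr_gt0 gra.
have [ka kb] : k <= r - rho a /\ k <= rho b - r.
  by rewrite /k !ge_min !lexx orbT.
(* The bound 1/16 is for the linearization. Theta moves by at most 5/2 th0 h and rho by at most 6 h,
   so the other two keep the comparison point in the box. *)
pose h0 := Num.min 16^-1 (Num.min (g / th0 / 3) (k / 6)).
have [h1 h2 h3] : [/\ h0 <= 16^-1, h0 <= g / th0 / 3 & h0 <= k / 6].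
  by rewrite /h0 !ge_min !lexx !orbT.
have h00 : 0 < h0 by rewrite /h0 !lt_min !divr_gt0// invr_gt0 ltr0n.
clearbody h0 g k.
exists C, h0; split => // m s z psi X W Y [s_incr s01] [bx mn] hs [E1 E2 E3] hX hW hY.
have [m1 m2] := mean2_bounds rc h1 hX hW hY.
have hl := rho_linearization rc h1 hX hW hY.
have hn := rho_lin_norm_le rc hX hW hY.
have m0 : 0 < mean2 r c X W Y by rewrite (lt_le_trans _ m2)// divr_gt0.
pose psi' := Param (th0 * mean2 r c X W Y) (sigma2 psi0) (cross r c X W / mean2 r c X W Y).
have bx' : in_box a b psi'.
  have [_ b2 _] := bx0; split => //=.
    rewrite (_ : th0 * _ = th0 + th0 * (mean2 r c X W Y - 1)); last by ring.
    apply: perturb_bounds ga' gb'; rewrite normrM (gtr0_norm th0_gt0).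
    by apply: (le_trans (ler_wpM2l (ltW th0_gt0) m1)); rewrite mean2_scale// ltW.
  rewrite -[_ / _](subrKC r); apply: perturb_bounds ka kb.
  apply: (le_trans (rho_near _ hn (ltW h00) h1)); last by rewrite mulrC -ler_pdivlMr.
  by apply: (le_trans hl); rewrite ler_wpM2r ?sqr_ge0// ler_nat.
apply: (hC m s z psi psi' s_incr s01 bx bx' hs _ (mn _ bx') _) => // q hq.
have sq i : sigma2 q i = sigma2 psi0 i by case: hq => ->.
rewrite -/(moment s z 0 0) -/(moment s z 0 1) -/(moment s z 1 1) E1 E2 E3.
rewrite /contrast /sigma !sq -/(sigma psi0 0) -/(sigma psi0 1) -!ss /=.
rewrite -/(sigma psi0 0) -/(sigma psi0 1).
have [n0 n1] : sigma psi0 0 != 0 /\ sigma psi0 1 != 0 by rewrite !gt_eqF.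
move: m0; rewrite /mean2.
move: (cross _ _ _ _) (second _ _ _ _ _) => u v m0.
move: n0 n1; move: (sigma psi0 0) (sigma psi0 1) => x y n0 n1.
have m0' : 2 + (X + v) != 0.
  by rewrite (_ : 2 + (X + v) = 2 * (1 + (X + v) / 2)) ?mulf_neq0 ?gt_eqF//; field.
by field; rewrite n0 n1 m0'.
Qed.

(* The comparison point fits [theta sigma_1^2], [theta sigma_2^2] and [rho] exactly; the
   value of [theta] does not matter, and is the projection of the estimate onto the values
   for which the point stays in the box. *)
Lemma free_sigma_close : theta a < th0 < theta b -> rho a < r < rho b ->
  (forall i, sigma2 a i < sigma2 psi0 i < sigma2 b i) ->
  exists C h0 : R, 0 < h0 /\ forall m (s : 'I_m.+1 -> R) z psi X W Y,
  design s -> minimizes s z psi ->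
  expanded s z X W Y -> `|X| <= h0 -> `|W| <= h0 -> `|Y| <= h0 ->
  let B := C * rough_total s z / m.+1%:R in
  [/\ `|theta psi * sigma2 psi 0 - th0 * sigma2 psi0 0 * (1 + X)| <= B,
      `|theta psi * sigma2 psi 1 - th0 * sigma2 psi0 1 * (1 + second r c X W Y)| <= B
    & `|rho psi - cross r c X W / Num.sqrt ((1 + X) * (1 + second r c X W Y))| <= B].
Proof.
move=> /andP[ga gb] /andP[gra grb] gs.
have [lo [hi [lo0 cb]]] := box_coord_bounds ta0 sa0 ra rb bx0.
have [_ t0b _ _ _] := cb _ bx0.
pose C1 := `|lip_const lo hi| * ((sigma2 a 0)^-1 + (sigma2 a 1)^-1).
have i0 i : 0 < (sigma2 a i)^-1 by rewrite invr_gt0.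
have C10 : 0 <= C1 by rewrite mulr_ge0// addr_ge0// ltW.
have /andP[ga0 gb0] := gs 0; have /andP[ga1 gb1] := gs 1.
pose g := Num.min (Num.min (sigma2 psi0 0 - sigma2 a 0) (sigma2 b 0 - sigma2 psi0 0))
   (Num.min (sigma2 psi0 1 - sigma2 a 1) (sigma2 b 1 - sigma2 psi0 1)).
have g0 : 0 < g by rewrite !lt_min !subr_gt0 ga0 gb0 ga1.
have [g1 g2 g3 g4] : [/\ g <= sigma2 psi0 0 - sigma2 a 0, g <= sigma2 b 0 - sigma2 psi0 0,
    g <= sigma2 psi0 1 - sigma2 a 1 & g <= sigma2 b 1 - sigma2 psi0 1].
  by rewrite /g !ge_min !lexx !orbT.
pose k := Num.min (r - rho a) (rho b - r).
have k0 : 0 < k by rewrite lt_min !subr_gt0 gra.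
have [ka kb] : k <= r - rho a /\ k <= rho b - r.
  by rewrite /k !ge_min !lexx orbT.
(* As above; the factor 4 comes from the bound of [second]. *)
pose h0 := Num.min 16^-1 (Num.min (Num.min (g / sigma2 psi0 0) (g / sigma2 psi0 1 / 4)) (k / 6)).
have [h1 h2 h2' h3] : [/\ h0 <= 16^-1, h0 <= g / sigma2 psi0 0, h0 <= g / sigma2 psi0 1 / 4
    & h0 <= k / 6].
  by rewrite /h0 !ge_min !lexx !orbT.
have h00 : 0 < h0 by rewrite /h0 !lt_min !divr_gt0// invr_gt0 ltr0n.
clearbody h0 g k.
exists (lip_const lo hi * close_const lo hi C1), h0; split => //.
move=> m s z psi X W Y [s_incr s01] [bx mn] [E1 E2 E3] hX hW hY.
have hl := rho_sqrt_linearization rc h1 hX hW hY.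
have hn := rho_lin_norm_le rc hX hW hY.
have hE := second_norm_le rc hX hW hY.
have [X0 E0] : 0 < 1 + X /\ 0 < 1 + second r c X W Y.
  have q : 4 * h0 < 1 by rewrite mulrC -ltr_pdivlMr// (le_lt_trans h1)// mul1r ltf_pV2 ?posrE// ltr_nat.
  split; [apply: (addr1_gt0 hX)|exact: (addr1_gt0 hE)].
  by rewrite (le_lt_trans _ q)// ler_peMl ?(ltW h00)// ler1n.
set E := second r c X W Y in hl hE E0 E3 *.
set rt := cross r c X W / _ in hl *.
pose B1 := th0 * sigma2 psi0 0 * (1 + X); pose B2 := th0 * sigma2 psi0 1 * (1 + E).
have B10 : 0 < B1 by rewrite !mulr_gt0.
have B20 : 0 < B2 by rewrite !mulr_gt0.
have S1 : sigma2 a 0 <= sigma2 psi0 0 * (1 + X) <= sigma2 b 0.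
  rewrite mulrDr mulr1; apply: perturb_bounds g1 g2.
  by rewrite normrM (gtr0_norm (s20 0)) mulrC -ler_pdivlMr// (le_trans hX).
have S2 : sigma2 a 1 <= sigma2 psi0 1 * (1 + E) <= sigma2 b 1.
  rewrite mulrDr mulr1; apply: perturb_bounds g3 g4.
  rewrite normrM (gtr0_norm (s20 1)) mulrC -ler_pdivlMr// (le_trans hE)//.
  by rewrite mulrC -ler_pdivlMr.
have [/andP[p1 p2] ps pr] := bx; have /andP[q1 q2] := ps 0; have /andP[q3 q4] := ps 1.

have sb0 i : 0 < sigma2 b i.
  by elim/ord2_ind: i; [exact: lt_trans gb0|exact: lt_trans gb1].
have vp : valid_param psi by case: (cb _ bx).
have [thp sp _] := vp.
(* Between [low] and [up] are the values y of theta for which y and the fitted variances B1 / y and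
   B2 / y lie in the box; th0 is one of them. *)
pose low := Num.max (theta a) (Num.max (B1 / sigma2 b 0) (B2 / sigma2 b 1)).
pose up := Num.min (theta b) (Num.min (B1 / sigma2 a 0) (B2 / sigma2 a 1)).
(* As [psi] is in the box, its theta can leave this range only by as much as its products theta
   sigma_k^2 miss B1 and B2. The projection is therefore close to it in terms of the coordinates. *)
pose d := `|theta psi * sigma2 psi 0 - B1| / sigma2 a 0 + `|theta psi * sigma2 psi 1 - B2| / sigma2 a 1.
have d1 : 0 <= `|theta psi * sigma2 psi 0 - B1| / sigma2 a 0 by rewrite divr_ge0// ltW.
have d2 : 0 <= `|theta psi * sigma2 psi 1 - B2| / sigma2 a 1 by rewrite divr_ge0// ltW.
have lowth : low <= th0.
  rewrite !ge_max !ler_pdivrMr ?(lt_trans _ gb0) ?(lt_trans _ gb1)// (ltW ga) /B1 /B2.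
  rewrite -[_ * _ * (1 + X)]mulrA -[_ * _ * (1 + E)]mulrA !ler_pM2l//.
  by case/andP: S1 => _ ->; case/andP: S2.
have thup : th0 <= up.
  rewrite !le_min !ler_pdivlMr// (ltW gb) /B1 /B2.
  rewrite -[_ * _ * (1 + X)]mulrA -[_ * _ * (1 + E)]mulrA !ler_pM2l//.
  by case/andP: S1 => ->; case/andP: S2.

have [/andP[yl yu] yd] : let y := Num.max low (Num.min (theta psi) up) in
    low <= y <= up /\ `|theta psi - y| <= d.
  apply: projection_dist; first exact: le_trans thup.
  - by rewrite addr_ge0.
  - by apply: max3_sub_le d1 d2 => //; apply: ratio_sub_le.
  - by apply: sub_min3_le d1 d2 => //; apply: sub_ratio_le.
move: (Num.max low (Num.min (theta psi) up)) yl yu yd => y yl yu yd.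
move: yl yu; rewrite !ge_max !le_min => /and3P[u1 u2 u3] /and3P[v1 v2 v3].
have y0 := lt_le_trans ta0 u1.
pose psi' := Param y (fun i => if i == 0 then B1 / y else B2 / y) rt.
have bx' : in_box a b psi'.
  split => /=; first by rewrite u1.
    move=> i; elim/ord2_ind: i => /=.
      rewrite ler_pdivlMr// ler_pdivrMr// mulrC -ler_pdivlMr// v2 mulrC -ler_pdivrMr//.
    by rewrite ler_pdivlMr// ler_pdivrMr// mulrC -ler_pdivlMr// v3 mulrC -ler_pdivrMr.
  rewrite -[rt](subrKC r); apply: perturb_bounds ka kb.
  by apply: (le_trans (rho_near hl hn (ltW h00) h1)); rewrite mulrC -ler_pdivlMr.
have BE1 : theta psi' * sigma2 psi' 0 = B1 by rewrite /= mulrC divfK ?gt_eqF.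
have BE2 : theta psi' * sigma2 psi' 1 = B2 by rewrite /= mulrC divfK ?gt_eqF.
have hth : `|theta psi - theta psi'| <= C1 * coord_dist psi psi'.
  have [l1 l2 _] := coord_lipschitz lo0 (cb _ bx) (cb _ bx'); rewrite BE1 BE2 in l1 l2.
  apply: (le_trans yd); rewrite /d /C1 mulrAC mulrDr; apply: lerD; apply: ler_wpM2r;
    rewrite ?(ltW (i0 _))//.
    by apply: (le_trans l1); apply: ler_wpM2r; [exact: coord_dist_ge0|exact: ler_norm].
  by apply: (le_trans l2); apply: ler_wpM2r; [exact: coord_dist_ge0|exact: ler_norm].
have := estimator_core s_incr s01 lo0 C10 t0b (cb _ bx) (cb _ bx') (mn _ bx') _ hth.
rewrite BE1 BE2; apply => q _; congr contrast.
- exact: E1.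
- rewrite -[LHS]/(moment s z 0 1) E2.
  have -> : sigma psi' 0 * sigma psi' 1 = Num.sqrt (B1 / y * (B2 / y)).
    by rewrite /sigma /= -sqrtrM//; apply: divr_ge0; exact: ltW.
  rewrite /=.
  rewrite (_ : B1 / y * (B2 / y) = (th0 * (sigma psi0 0 * sigma psi0 1) / y) ^+ 2 *
     ((1 + X) * (1 + E))); last by rewrite /B1 /B2 -!ss; field; rewrite gt_eqF.
  rewrite sqrtrM ?sqr_ge0// sqrtr_sqr ger0_norm; last first.
    by rewrite divr_ge0 ?(ltW y0)// !mulr_ge0 ?(ltW th0_gt0)// ltW.
  have g5 : 0 < Num.sqrt ((1 + X) * (1 + E)) by rewrite sqrtr_gt0 mulr_gt0.
  by rewrite /rt; field; rewrite !gt_eqF.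
- exact: E3.
Qed.

End cases.

(** * The innovations of the process *)

Section model_space.
Context {R : realType} d (T : measurableType d) (P : probability T R).
Variables (Z : 'I_2 -> R -> {RV P >-> R}) (psi0 : param R).
Hypotheses (lawZ : has_law Z psi0) (vp0 : valid_param psi0).
Local Notation Ex f := (Rintegral P setT f).
Local Notation integ f := (P.-integrable setT (EFin \o f)).

Definition spanned m (t : 'I_m -> R) (U : T -> R) : Prop :=
  exists c : 'I_2 * 'I_m -> R, U = fun w => \sum_ik c ik * Z ik.1 (t ik.2) w.

Lemma spanned_Z m (t : 'I_m -> R) i k : spanned t (Z i (t k)).
Proof.
exists (fun ik => (ik == (i, k))%:R); apply/funext => w.
rewrite (bigD1 (i, k))//= eqxx mul1r big1 ?addr0// => ik /negbTE ->.
by rewrite mul0r.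
Qed.

(** Joint normality leaves the mean of a combination open. The normal law gives integrability of all
    combinations, in particular of the Z_i(t_k), and only then can the mean be computed from
    theirs. *)
Lemma gaussian_spanned m (t : 'I_m -> R) : (forall k, 0 <= t k <= 1) ->
  gaussian_space P (spanned t).
Proof.
move=> t01; have [jg EZ _] := lawZ.
have mU U : spanned t U -> measurable_fun setT U.
  move=> [c ->]; apply: measurable_sum => ik; exact: measurable_funM.
have raw U : spanned t U -> exists m0, integ U /\ Ex U = m0 /\
    exists2 v, 0 <= v & forall A : set R, measurable A -> P (U @^-1` A) = gaussian_law m0 v A.
  move=> hU; have mu := mU _ hU; case: hU mu => c -> mu.
  have [m0 [v [v0 hv]]] := jg m t t01 c.
  have [i1 E1 _ _] := gaussian_moments mu v0 hv.
  have i3 : integ (fun w => \sum_ik c ik * Z ik.1 (t ik.2) w).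
    apply: integ_ext (integD (i1 1%N) (@integ_cst _ _ _ P m0)) => w.
    by rewrite expr1 subrK.
  exists m0; split => //; split; last by exists v.
  move: E1; rewrite ExB//; last exact: integ_cst.
  by rewrite Ex_cst => /eqP; rewrite subr_eq0 => /eqP.
have iZ i k : integ (Z i (t k)) by have [? []] := raw _ (spanned_Z t i k).
have EZ0 i k : Ex (Z i (t k)) = 0.
  by have := EZ i (t k) (t01 k); rewrite expectationE// => -[].
split=> [a b U V [c ->] [e ->]|U hU].
  exists (fun ik => a * c ik + b * e ik); apply/funext => w.
  by rewrite !mulr_sumr -big_split; apply: eq_bigr => ik _; rewrite mulrDl !mulrA.
split; first exact: mU.
have [m0 [iU [E hv]]] := raw _ hU.
suff m00 : m0 = 0 by rewrite m00 in hv.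
rewrite -E; case: hU => c ->.
rewrite Ex_sum; last by move=> ik; exact: integZ.
by rewrite big1// => ik _; rewrite ExZ// EZ0 mulr0.
Qed.

Lemma Z_cov i j s t : 0 <= s <= 1 -> 0 <= t <= 1 ->
  Ex (fun w => Z i s w * Z j t w) = cov_fun psi0 i j s t.
Proof.
move=> s01 t01; have [_ EZ cv] := lawZ.
pose u (k : 'I_2) := if k == 0 then s else t.
have u01 k : 0 <= u k <= 1 by rewrite /u; case: ifP.
have gH := gaussian_spanned u01.
have hs : spanned u (Z i s) by exact: (spanned_Z u i 0).
have ht : spanned u (Z j t) by exact: (spanned_Z u j 1).
have := cv i j s t s01 t01.
rewrite covariance.unlock (EZ i s s01) (EZ j t t01) /= => h.
have hE : (Z i s \- cst 0) * (Z j t \- cst 0) = (fun w => Z i s w * Z j t w) :> (T -> R).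
  by apply/funext => w; rewrite fctE /= !subr0.
rewrite hE expectationE in h; first by case: h.
exact: (gs_integM gH).
Qed.

Lemma Ex_mulC (U V : T -> R) : Ex (fun w => U w * V w) = Ex (fun w => V w * U w).
Proof. by apply: Ex_ext => w; rewrite mulrC. Qed.

Section sample.
Variables (m : nat) (s : 'I_m.+1 -> R).
Hypothesis ds : design s.
Local Notation th0 := (theta psi0).
Local Notation r := (rho psi0).
Local Notation tm := (times s).

Let gH : gaussian_space P (spanned s). Proof. exact: gaussian_spanned ds.2. Qed.

Definition innovation i k (w : T) : R := innov th0 tm (path tm (fun i u => Z i u w) i) k.

Lemma innovationS i k : innovation i k.+1 =
  (fun w => 1 * Z i (tm k.+1) w + - decay th0 tm k.+1 k * Z i (tm k) w).
Proof. by apply/funext => w; rewrite /innovation /= /path mul1r mulNr. Qed.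

Lemma spanned_innovation i k : spanned s (innovation i k).
Proof.
case: k => [|k]; first exact: (spanned_Z s i (inord 0)).
by rewrite innovationS; apply: gH.1; exact: spanned_Z.
Qed.

Lemma times_incr k l : (k < l <= m)%N -> tm k < tm l.
Proof.
by move=> /andP[kl lm]; apply: ds.1; rewrite !inordK// ltnS// ltnW// (leq_trans kl).
Qed.

Lemma innov_var_gt0 k : (k <= m)%N -> 0 < innov_var th0 tm k.
Proof.
have [th00 _ _] := vp0; case: k => [//|k] km /=.
rewrite subr_gt0 expr_lt1 ?expR_ge0// -[ltRHS]expR0 ltr_expR.
by rewrite mulNr oppr_lt0 mulr_gt0// subr_gt0 times_incr// ltnSn.
Qed.

Definition cov_const i j : R :=
  sigma psi0 i * sigma psi0 j * (r + (1 - r) * (i == j)%:R).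

Lemma cov_constC i j : cov_const i j = cov_const j i.
Proof. by rewrite /cov_const eq_sym [sigma _ i * _]mulrC. Qed.

Lemma Z_cov_times i j k l : (l <= k <= m)%N ->
  Ex (fun w => Z i (tm k) w * Z j (tm l) w) = cov_const i j * decay th0 tm k l.
Proof.
move=> /andP[lk km]; rewrite Z_cov ?ds.2// /cov_fun /cov_const /decay ger0_norm//.
move: lk; rewrite subr_ge0 leq_eqVlt => /orP[/eqP ->//|lk].
by rewrite ltW// times_incr// lk.
Qed.

Lemma Z_innovation_cov i j k l : (l <= k <= m)%N ->
  Ex (fun w => Z i (tm k) w * innovation j l w) =
  cov_const i j * decay th0 tm k l * innov_var th0 tm l.
Proof.
have ZH i' k' : spanned s (Z i' (tm k')) by exact: spanned_Z.
move=> /andP[lk km]; case: l lk => [|l] lk.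
  by rewrite [LHS](Z_cov_times i j (l := 0))//= mulr1.
rewrite innovationS Ex_mulC (gs_cov_lin gH)//.
rewrite (Ex_mulC (Z j (tm l.+1))) (Ex_mulC (Z j (tm l))).
rewrite !Z_cov_times ?lk ?(ltnW lk)// mul1r /= -(decayD th0 tm k l.+1 l); ring.
Qed.

(** For l < k the values at times k and k - 1 have covariances with the innovation l in the ratio of
    one decay, which the innovation k subtracts. The correlation in time is the same for all pairs
    of components, so i and j enter by a factor. *)
Lemma innovation_cov i j k l : (k <= m)%N -> (l <= m)%N ->
  Ex (fun w => innovation i k w * innovation j l w) =
  (k == l)%:R * (cov_const i j * innov_var th0 tm k).
Proof.
have ZH i' k' : spanned s (Z i' (tm k')) by exact: spanned_Z.
have IH := spanned_innovation.
wlog lk : i j k l / (l <= k)%N => [H km lm|km lm].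
  have [/H|/ltnW kl] := leqP l k; first exact.
  by rewrite Ex_mulC H// cov_constC eq_sym; case: eqP => [->//|_]; rewrite !mul0r.
move: lk; rewrite leq_eqVlt => /orP[/eqP ->|].
  rewrite eqxx mul1r; case: k km => [|k] km.
    by rewrite [LHS](Z_innovation_cov i j (k := 0) (l := 0))//= decayii !mulr1.
  rewrite {1}innovationS (gs_cov_lin gH)// Z_innovation_cov ?leqnn// decayii mulr1 mul1r.
  rewrite Ex_mulC innovationS (gs_cov_lin gH)// (Ex_mulC (Z j (tm k))) !Z_cov_times ?leqnn ?leqnSn ?km ?(ltnW km)//.
  by rewrite decayii (cov_constC j i); ring.
case: k km => // k km; rewrite ltnS => lk.
rewrite innovationS (gs_cov_lin gH)// !Z_innovation_cov ?lk ?(ltnW km) ?km ?(leqW lk)//.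
by rewrite -(decayD th0 tm k.+1 k l) gtn_eqF// mul0r; ring.
Qed.

Local Notation c := (Num.sqrt (1 - rho psi0 ^+ 2)).
Local Notation N := (m.+1%:R : R).
Local Notation sd k := (Num.sqrt (innov_var th0 tm k)).

Let r2_lt1 : 0 < 1 - r ^+ 2. Proof. by have [_ _ h] := vp0; nra. Qed.
Let c_gt0 : 0 < c. Proof. by rewrite sqrtr_gt0. Qed.
Let cE : c ^+ 2 = 1 - r ^+ 2. Proof. by rewrite sqr_sqrtr// ltW. Qed.
Let s_gt0 i : 0 < sigma psi0 i. Proof. exact: sigma_gt0. Qed.
Let N_gt0 : 0 < N. Proof. exact: ltr0n. Qed.

Definition white (a b : R) k (w : T) : R :=
  a / sd k * innovation 0 k w + b / sd k * innovation 1 k w.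

(* The normalized innovations of [Z_1], and the part of those of [Z_2] which is orthogonal
   to them. *)
Definition white1 := white (sigma psi0 0)^-1 0.
Definition white2 := white (- r / (c * sigma psi0 0)) (c * sigma psi0 1)^-1.

Lemma spanned_white a b k : spanned s (white a b k).
Proof. by apply: gH.1; exact: spanned_innovation. Qed.

Lemma white_cov a b a' b' k l : (k <= m)%N -> (l <= m)%N ->
  Ex (fun w => white a b k w * white a' b' l w) = (k == l)%:R *
  (a * a' * sigma psi0 0 ^+ 2 + (a * b' + b * a') * (r * (sigma psi0 0 * sigma psi0 1)) +
   b * b' * sigma psi0 1 ^+ 2).
Proof.
move=> km lm; have hI := spanned_innovation; have hW := spanned_white.
rewrite (gs_cov_lin gH)// (Ex_mulC (innovation 0 k)) (Ex_mulC (innovation 1 k)).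
rewrite !(gs_cov_lin gH)// !innovation_cov// eq_sym.
case: eqP => [<-|_]; last by rewrite !mul0r; ring.
rewrite /cov_const /=.
have vE : innov_var th0 tm k = sd k ^+ 2 by rewrite sqr_sqrtr// ltW// innov_var_gt0.
have v0 : 0 < sd k by rewrite sqrtr_gt0 innov_var_gt0.
move: (sd k) vE v0 => v -> v0; field.
by rewrite gt_eqF.
Qed.

Lemma white1_cov k l : (k < m.+1)%N -> (l < m.+1)%N ->
  Ex (fun w => white1 k w * white1 l w) = (k == l)%:R.
Proof. by move=> km lm; rewrite white_cov//; field; rewrite gt_eqF. Qed.

Lemma white2_cov k l : (k < m.+1)%N -> (l < m.+1)%N ->
  Ex (fun w => white2 k w * white2 l w) = (k == l)%:R.
Proof.
move=> km lm; rewrite white_cov// -[RHS]mulr1; congr (_ * _).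
transitivity ((1 - r ^+ 2) / c ^+ 2); first by field; rewrite !gt_eqF.
by rewrite cE divff// gt_eqF.
Qed.

Lemma white12_cov k l : (k < m.+1)%N -> (l < m.+1)%N ->
  Ex (fun w => white1 k w * white2 l w) = 0.
Proof. by move=> km lm; rewrite white_cov//; field; rewrite !gt_eqF. Qed.

Lemma innovation1E k w : (k <= m)%N ->
  innovation 0 k w = sigma psi0 0 * sd k * white1 k w.
Proof.
move=> km; have v0 : 0 < sd k by rewrite sqrtr_gt0 innov_var_gt0.
by rewrite /white1 /white; field; rewrite !gt_eqF.
Qed.

Lemma innovation2E k w : (k <= m)%N ->
  innovation 1 k w = sigma psi0 1 * sd k * (r * white1 k w + c * white2 k w).
Proof.
move=> km; have v0 : 0 < sd k by rewrite sqrtr_gt0 innov_var_gt0.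
by rewrite /white1 /white2 /white; field; rewrite !gt_eqF.
Qed.

Definition meanX w : R := N^-1 * \sum_(j < m.+1) (white1 j w ^+ 2 - 1).
Definition meanW w : R := N^-1 * \sum_(j < m.+1) white1 j w * white2 j w.
Definition meanY w : R := N^-1 * \sum_(j < m.+1) (white2 j w ^+ 2 - 1).

Let momentE i j w (f : nat -> R) : (forall k, (k <= m)%N ->
    innovation i k w * innovation j k w = innov_var th0 tm k * f k) ->
  moment psi0 s (fun i u => Z i u w) i j = th0 * (N^-1 * \sum_(k < m.+1) f k).
Proof.
move=> hf; rewrite /moment /quadN -mulrA [_ * N^-1]mulrC; congr (_ * (_ * _)).
apply: eq_bigr => k _; have := hf k (ltn_ord k); rewrite /innovation => ->.
by rewrite mulrAC divff ?mul1r// gt_eqF// innov_var_gt0// -ltnS.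
Qed.

Lemma sample_expanded w :
  expanded psi0 c s (fun i u => Z i u w) (meanX w) (meanW w) (meanY w).
Proof.
have vE k : (k <= m)%N -> innov_var th0 tm k = sd k ^+ 2.
  by move=> km; rewrite sqr_sqrtr// ltW// innov_var_gt0.
have ss i : sigma psi0 i ^+ 2 = sigma2 psi0 i by exact: sigma_sqr.
have EX : N^-1 * (\sum_(j < m.+1) white1 j w ^+ 2) = 1 + meanX w.
  by rewrite /meanX sumrB sumr_const card_ord; field; rewrite gt_eqF.
have EY : N^-1 * (\sum_(j < m.+1) white2 j w ^+ 2) = 1 + meanY w.
  by rewrite /meanY sumrB sumr_const card_ord; field; rewrite gt_eqF.
split.
- rewrite (momentE (f := fun k => sigma2 psi0 0 * white1 k w ^+ 2)) => [|k km].
    by rewrite -mulr_sumr [N^-1 * (_ * _)]mulrCA EX mulrA.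
  by rewrite !innovation1E//; move: (sd k) (vE k km) => v ->; rewrite -ss; ring.
- rewrite (momentE (f := fun k => sigma psi0 0 * sigma psi0 1 *
     (r * white1 k w ^+ 2 + c * (white1 k w * white2 k w)))) => [|k km].
    rewrite -mulr_sumr [N^-1 * (_ * _)]mulrCA -[RHS]mulrA; congr (_ * (_ * _)).
    by rewrite big_split /= -!mulr_sumr mulrDr [N^-1 * (r * _)]mulrCA EX /cross /meanW; ring.
  by rewrite innovation1E// innovation2E//; move: (sd k) (vE k km) => v ->; ring.
- rewrite (momentE (f := fun k => sigma2 psi0 1 *
     (r ^+ 2 * white1 k w ^+ 2 + (2 * r * c * (white1 k w * white2 k w) +
      c ^+ 2 * white2 k w ^+ 2)))) => [|k km].
    rewrite -mulr_sumr [N^-1 * (_ * _)]mulrCA -[RHS]mulrA; congr (_ * (_ * _)).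
    rewrite big_split /= big_split /= -!mulr_sumr !mulrDr [N^-1 * (r ^+ 2 * _)]mulrCA EX.
    rewrite [N^-1 * (c ^+ 2 * _)]mulrCA EY /second /meanW mulrDr mulrDr !mulr1 {1}cE; ring.
  by rewrite !innovation2E//; move: (sd k) (vE k km) => v ->; rewrite -ss; ring.
Qed.

Let hw1 k : spanned s (white1 k). Proof. exact: spanned_white. Qed.
Let hw2 k : spanned s (white2 k). Proof. exact: spanned_white. Qed.

Lemma cov_const_diag i : cov_const i i = sigma2 psi0 i.
Proof. by rewrite /cov_const eqxx mulr1 subrKC mulr1 -expr2 sigma_sqr. Qed.

Lemma Z_sqr i k : (k <= m)%N -> Ex (fun w => Z i (tm k) w ^+ 2) = sigma2 psi0 i.
Proof.
move=> km; transitivity (Ex (fun w => Z i (tm k) w * Z i (tm k) w)).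
  by apply: Ex_ext => w; rewrite expr2.
by rewrite Z_cov_times ?leqnn// decayii cov_const_diag mulr1.
Qed.

(** A squared increment has mean 2 sigma^2 (1 - exp(-theta_0 D)) <= 2 sigma^2 theta_0 D, and the
    spacings D sum to at most 1. The end points and the Riemann sum contribute 2 sigma^2 each. *)
Lemma roughness_integ i :
  let f := fun w => roughness tm m (path tm (fun i u => Z i u w) i) in
  integ f /\ Ex f <= sigma2 psi0 i * (4 + 2 * th0).
Proof.
have [th00 s20 _] := vp0; move=> f.
have ZH k : spanned s (Z i (tm k)) by exact: spanned_Z.
have iZ k := gs_integX gH 2 (ZH k).
have D0 (k : 'I_m) : tm k < tm k.+1 by rewrite times_incr// ltnSn /=.
pose g (k : 'I_m) := fun w => (tm k.+1 - tm k) * (Z i (tm k.+1) w ^+ 2 + Z i (tm k) w ^+ 2) +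
   (1 * Z i (tm k.+1) w + -1 * Z i (tm k) w) ^+ 2.
have id k : integ (fun w => (1 * Z i (tm k.+1) w + -1 * Z i (tm k) w) ^+ 2).
  by apply: (gs_integX gH 2); apply: gH.1.
have i1 (k : 'I_m) : integ (fun w => (tm k.+1 - tm k) * (Z i (tm k.+1) w ^+ 2 + Z i (tm k) w ^+ 2)).
  by apply: integZ; apply: integD.
have ig k : integ (g k) by apply: integD.
have fE : (fun w => Z i (tm 0%N) w ^+ 2 + Z i (tm m) w ^+ 2 + \sum_(k < m) g k w) =1 f.
  by move=> w; rewrite /f /roughness /g /path; congr (_ + _); apply: eq_bigr => k _; ring.
have i2 := integD (iZ 0%N) (iZ m); have i3 := integ_sum (index_enum 'I_m) ig.
split; first by apply: integ_ext fE _; exact: integD.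
rewrite -(Ex_ext P fE) ExD// ExD// !Z_sqr// Ex_sum//.
have Eg k : Ex (g k) <= (2 * sigma2 psi0 i + 2 * sigma2 psi0 i * th0) * (tm k.+1 - tm k).
  have dk : 0 <= tm k.+1 - tm k by rewrite subr_ge0 ltW.
  rewrite /g ExD// ExZ; last exact: integD.
  rewrite ExD// (gs_sqr_lin gH)// !Z_sqr ?(ltnW (ltn_ord k))// Z_cov_times ?leqnSn ?ltn_ord//.
  rewrite cov_const_diag; have := expR_ge1Dx (- th0 * (tm k.+1 - tm k)); rewrite -/(decay th0 tm k.+1 k) => h.
  have := ler_wpM2l (ltW (s20 i)) h; lra.
apply: (@le_trans _ _ (sigma2 psi0 i + sigma2 psi0 i + \sum_(k < m)
   (2 * sigma2 psi0 i + 2 * sigma2 psi0 i * th0) * (tm k.+1 - tm k))).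
  by rewrite lerD2l; apply: ler_sum => k _; exact: Eg.
have t1 : tm m - tm 0%N <= 1.
  by have /andP[] := ds.2 (inord m); have /andP[] := ds.2 (inord 0); rewrite /times; lra.
rewrite -mulr_sumr sum_increments.
have c0 : 0 <= 2 * sigma2 psi0 i + 2 * sigma2 psi0 i * th0.
  by rewrite addr_ge0// ?mulr_ge0// ltW.
have := ler_wpM2l c0 t1; lra.
Qed.

Definition sumX w : R := \sum_(j < m.+1) (white1 j w ^+ 2 - 1).
Definition sumY w : R := \sum_(j < m.+1) (white2 j w ^+ 2 - 1).
(** Polarization: with the sums of squares this determines the sum of products, so that
    [sum_sqr_var] controls all three means. The summands have mean 2 before centring. *)
Definition sumXY w : R := \sum_(j < m.+1) ((1 * white1 j w + 1 * white2 j w) ^+ 2 - 2).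

Definition tight w : R := rough_total s (fun i u => Z i u w) +
  N^-1 * (sumX w ^+ 2 + (sumY w ^+ 2 + sumXY w ^+ 2)).

Lemma rough_total_ge0 z : 0 <= rough_total s z.
Proof.
have incr k : (k < m)%N -> tm k < tm k.+1 by move=> km; rewrite times_incr// ltnSn.
have h i := roughness_ge0 incr (path tm z i).
by apply: addr_ge0 (h 1); apply: addr_ge0 (h 0).
Qed.

Lemma tight_ge0 w : 0 <= tight w.
Proof.
rewrite addr_ge0 ?rough_total_ge0// mulr_ge0 ?invr_ge0//.
by apply: addr_ge0 (sqr_ge0 _) _; apply: addr_ge0; exact: sqr_ge0.
Qed.

(** Here 12 = 2 + 2 + 8 is the sum of the variances 2 v^2 for v = 1, 1, 2. *)
Definition tight_const : R :=
  1 + sigma2 psi0 0 * (4 + 2 * th0) + sigma2 psi0 1 * (4 + 2 * th0) + 12.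

Lemma tight_integ : integ tight /\ Ex tight <= tight_const.
Proof.
have [i0 e0] := roughness_integ 0; have [i1 e1] := roughness_integ 1.
have uu k l : (k < m.+1)%N -> (l < m.+1)%N ->
    Ex (fun w => (1 * white1 k w + 1 * white2 k w) * (1 * white1 l w + 1 * white2 l w)) =
    (k == l)%:R * 2.
  move=> km lm; have hs j : spanned s (fun w => 1 * white1 j w + 1 * white2 j w) by exact: gH.1.
  rewrite (gs_cov_lin gH 1 1 (hw1 k) (hw2 k) (hs l)) (Ex_mulC (white1 k)) (Ex_mulC (white2 k)).
  rewrite (gs_cov_lin gH 1 1 (hw1 l) (hw2 l) (hw1 k)) (gs_cov_lin gH 1 1 (hw1 l) (hw2 l) (hw2 k)).
  rewrite (Ex_mulC (white2 l) (white1 k)) white1_cov// white2_cov// !white12_cov// eq_sym; ring.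
have hs j : spanned s (fun w => 1 * white1 j w + 1 * white2 j w) by exact: gH.1.
have one1 (k l : nat) : (k == l)%:R = (k == l)%:R * 1 :> R by rewrite mulr1.
have [ix ex] := sum_sqr_var gH hw1 (fun k l hk hl => etrans (white1_cov hk hl) (one1 k l)).
have [iy ey] := sum_sqr_var gH hw2 (fun k l hk hl => etrans (white2_cov hk hl) (one1 k l)).
have [iz ez] := sum_sqr_var gH hs uu.
have ir : integ (fun w => rough_total s (fun i u => Z i u w)).
  by apply: integD => //; apply: integD => //; exact: integ_cst.
have iyz := integD iy iz; have ixyz := integD ix iyz.
split; first by apply: integD => //; exact: integZ.
have E1 : Ex (fun w => N^-1 * (sumX w ^+ 2 + (sumY w ^+ 2 + sumXY w ^+ 2))) = 12.
  rewrite /sumX /sumY /sumXY (ExZ _ ixyz) (ExD ix iyz) (ExD iy iz) ex ey ez.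
  by field; rewrite gt_eqF.
rewrite (ExD ir (integZ N^-1 ixyz)) E1 /tight_const lerD2r.
rewrite (ExD (integD (@integ_cst _ _ _ P 1) i0) i1) (ExD (@integ_cst _ _ _ P 1) i0) Ex_cst.
by apply: lerD => //; rewrite lerD2l.
Qed.

Lemma tight_bounds K w : tight w <= K ->
  [/\ rough_total s (fun i u => Z i u w) <= K, `|Num.sqrt N * meanX w| <= 2 * (K + 1),
      `|Num.sqrt N * meanW w| <= 2 * (K + 1) & `|Num.sqrt N * meanY w| <= 2 * (K + 1)].
Proof.
have q0 : 0 < Num.sqrt N by rewrite sqrtr_gt0.
have qE : Num.sqrt N ^+ 2 = N by rewrite sqr_sqrtr// ltW.
have qN : Num.sqrt N / N = (Num.sqrt N)^-1.
  by move: (Num.sqrt N) q0 qE => v v0 <-; field; rewrite gt_eqF.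
have r0 := rough_total_ge0 (fun i u => Z i u w).
rewrite /tight.
have EN x : N^-1 * x ^+ 2 = (x / Num.sqrt N) ^+ 2 by rewrite expr_div_n qE mulrC.
rewrite !mulrDr !EN => h.
have EX : Num.sqrt N * meanX w = sumX w / Num.sqrt N.
  by rewrite /meanX mulrA qN mulrC.
have EY : Num.sqrt N * meanY w = sumY w / Num.sqrt N.
  by rewrite /meanY mulrA qN mulrC.
have EW : Num.sqrt N * meanW w =
    (sumXY w / Num.sqrt N - sumX w / Num.sqrt N - sumY w / Num.sqrt N) / 2.
  have -> : sumXY w = sumX w + sumY w + 2 * \sum_(j < m.+1) white1 j w * white2 j w.
    rewrite /sumXY /sumX /sumY mulr_sumr -!big_split /=; apply: eq_bigr => j _; ring.
  by rewrite /meanW mulrA qN; field; rewrite gt_eqF.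
have nb (x : R) : `|x| <= 1 + x ^+ 2.
  by rewrite -[x ^+ 2]real_normK ?num_real//; have := sqr_ge0 (`|x| - 1); have := normr_ge0 x; nra.
rewrite EX EY EW; move: h r0.
move: (sumX w / _) (sumY w / _) (sumXY w / _) (rough_total _ _) => x y z ro h r0.
have := nb x; have := nb y; have := nb z.
have := sqr_ge0 x; have := sqr_ge0 y; have := sqr_ge0 z.
move=> a1 a2 a3 b1 b2 b3.
split; [lra|lra| |lra].
rewrite normrM [X in _ * X]ger0_norm ?invr_ge0//.
have := ler_normB (z - x) y; have := ler_normB z x; lra.
Qed.

Lemma mean_blockS a b e w : Num.sqrt N * (a * meanX w + b * meanW w + e * meanY w) =
  blockS white1 white2 a b e (Num.sqrt N)^-1 m.+1 w.
Proof.
have q0 : 0 < Num.sqrt N by rewrite sqrtr_gt0.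
have qE : Num.sqrt N ^+ 2 = N by rewrite sqr_sqrtr// ltW.
have qN : Num.sqrt N / N = (Num.sqrt N)^-1.
  by move: (Num.sqrt N) q0 qE => v v0 <-; field; rewrite gt_eqF.
rewrite /blockS /quad -mulr_sumr !big_split /= -!mulr_sumr -qN.
by rewrite /meanX /meanW /meanY; ring.
Qed.

Lemma measurable_mean a b e :
  measurable_fun setT (fun w => Num.sqrt N * (a * meanX w + b * meanW w + e * meanY w)).
Proof.
rewrite (_ : (fun w => _) = blockS white1 white2 a b e (Num.sqrt N)^-1 m.+1).
  exact: (measurable_blockS gH).
by apply/funext => w; rewrite mean_blockS.
Qed.

Lemma mean_clt a b e ph :
  `|Ex (fun w => cos (ph + Num.sqrt N * (a * meanX w + b * meanW w + e * meanY w))) -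
    cos ph * expR (- ((2 * a ^+ 2 + b ^+ 2 + 2 * e ^+ 2) / 2))| <= clt_const a b e / Num.sqrt N.
Proof.
under Ex_ext => w do rewrite mean_blockS.
exact: (clt_blockS gH hw1 hw2 white1_cov white2_cov white12_cov).
Qed.

(** * Limit laws *)

End sample.

Section limits.
Variable s : forall n, 'I_n -> R.
Hypothesis ds : forall m, design (@s m.+1).
Arguments s : clear implicits.

(** The sample statistics are defined for m + 1 points; a sequence indexed by n gets the value 0 at
    n = 0. *)
Definition at_size (F : forall m, ('I_m.+1 -> R) -> T -> R) n : T -> R :=
  match n return ('I_n -> R) -> T -> R with 0 => fun _ _ => 0 | m.+1 => F m end (s n).

Definition tight_seq := at_size (fun m sm => tight sm).

Definition lin_seq (a b e : R) := at_size (fun m sm w =>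
  Num.sqrt m.+1%:R * (a * meanX sm w + b * meanW sm w + e * meanY sm w)).

Lemma measurable_lin_seq a b e n : measurable_fun setT (lin_seq a b e n).
Proof. by case: n => [|m]; [exact: measurable_cst|exact: measurable_mean]. Qed.

Lemma lin_seq_sum k (t A B C : 'I_k -> R) n w :
  \sum_i t i * lin_seq (A i) (B i) (C i) n w =
  lin_seq (\sum_i t i * A i) (\sum_i t i * B i) (\sum_i t i * C i) n w.
Proof.
case: n => [|m]; first by rewrite big1// => i _; rewrite mulr0.
rewrite /lin_seq /at_size !mulr_suml -!big_split /= mulr_sumr; apply: eq_bigr => i _; ring.
Qed.

Lemma lin_seq_cf a b e ph :
  Ex (fun w => cos (ph + lin_seq a b e n w)) @[n --> \oo] -->
  cos ph * expR (- ((2 * a ^+ 2 + b ^+ 2 + 2 * e ^+ 2) / 2)).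
Proof.
have H n : (0 < n)%N -> `|cos ph * expR (- ((2 * a ^+ 2 + b ^+ 2 + 2 * e ^+ 2) / 2)) -
    Ex (fun w => cos (ph + lin_seq a b e n w))| <= clt_const a b e / Num.sqrt n%:R.
  by case: n => // m _; rewrite distrC; exact: mean_clt.
apply/cvgrPdist_le => eps eps0; near=> n.
apply: (le_trans (H n _)); first by near: n; exact: nbhs_infty_gt.
by near: n; exact: near_div_sqrt_nat_le.
Unshelve. all: by end_near. Qed.

Lemma tight_seq_ge0 n w : 0 <= tight_seq n w.
Proof. by case: n => [|m]; [exact: lexx|exact: tight_ge0]. Qed.

Lemma near_tight_seq : \forall n \near \oo,
  integ (tight_seq n) /\ Ex (tight_seq n) <= tight_const.
Proof.
have H n : (0 < n)%N -> integ (tight_seq n) /\ Ex (tight_seq n) <= tight_const.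
  by case: n => // m _; exact: tight_integ.
by near=> n; apply: H; near: n; exact: nbhs_infty_gt.
Unshelve. all: by end_near. Qed.

(* The three orthonormal Gaussian variables of the limit vector are taken among the
   innovations at the times 0 and 1. *)
Definition two_points (k : 'I_2) : R := (k : nat)%:R.

Lemma design_two_points : design two_points.
Proof.
split=> [i j ij|i]; first by rewrite ltr_nat.
by rewrite ler0n lern1 -ltnS ltn_ord.
Qed.

Let gH := gaussian_spanned design_two_points.2.

(** The Gaussian counterpart of sqrt N (a X + b W + e Y): the roots of 2 are there because x^2 - 1
    and y^2 - 1 have variance 2 and x y has variance 1. *)
Definition limit_var (a b e : R) (w : T) : R :=
  1 * (Num.sqrt 2 * a * white1 two_points 0 w + b * white2 two_points 0 w) +
  Num.sqrt 2 * e * white1 two_points 1 w.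

Lemma spanned_limit_var a b e : spanned two_points (limit_var a b e).
Proof.
have h := design_two_points.
by apply: gH.1; [apply: gH.1|]; apply: (spanned_white h).
Qed.

Lemma limit_var_sum k (t A B C : 'I_k -> R) w :
  \sum_i t i * limit_var (A i) (B i) (C i) w =
  limit_var (\sum_i t i * A i) (\sum_i t i * B i) (\sum_i t i * C i) w.
Proof.
rewrite /limit_var !mulr_sumr !mulr_suml -!big_split /= mulr_sumr -big_split /=.
by apply: eq_bigr => i _; ring.
Qed.

Lemma limit_var_cov a b e a' b' e' :
  Ex (fun w => limit_var a b e w * limit_var a' b' e' w) =
  2 * (a * a') + b * b' + 2 * (e * e').
Proof.
have h := design_two_points.
have h1 k : spanned two_points (white1 two_points k) by exact: spanned_white.
have h2 k : spanned two_points (white2 two_points k) by exact: spanned_white.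
have h3 x y : spanned two_points
  (fun w => x * white1 two_points 0 w + y * white2 two_points 0 w) by exact: gH.1.
have hl := spanned_limit_var a' b' e'.
have c1 := white1_cov h; have c2 := white2_cov h; have c3 := white12_cov h.
have L U : spanned two_points U -> Ex (fun w => U w * limit_var a' b' e' w) =
    Num.sqrt 2 * a' * Ex (fun w => white1 two_points 0 w * U w) +
    b' * Ex (fun w => white2 two_points 0 w * U w) +
    Num.sqrt 2 * e' * Ex (fun w => white1 two_points 1 w * U w).
  move=> hU; rewrite Ex_mulC (gs_cov_lin gH 1 _ (h3 _ _) (h1 1%N) hU).
  by rewrite (gs_cov_lin gH _ _ (h1 0%N) (h2 0%N) hU) mul1r.
rewrite {1}/limit_var (gs_cov_lin gH 1 _ (h3 _ _) (h1 1%N) hl).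
rewrite (gs_cov_lin gH _ _ (h1 0%N) (h2 0%N) hl) !L//.
rewrite (Ex_mulC (white2 two_points 0) (white1 two_points 0)).
rewrite (Ex_mulC (white2 two_points 0) (white1 two_points 1)).
rewrite !c1// !c2// !c3// /=.
have s2 : Num.sqrt 2 ^+ 2 = 2 :> R by rewrite sqr_sqrtr.
rewrite (_ : 2 * (a * a') + _ + _ = Num.sqrt 2 ^+ 2 * (a * a') + b * b' +
   Num.sqrt 2 ^+ 2 * (e * e')); first by ring.
by rewrite s2.
Qed.

Lemma limit_var_cf a b e ph : Ex (fun w => cos (ph + limit_var a b e w)) =
  cos ph * expR (- ((2 * a ^+ 2 + b ^+ 2 + 2 * e ^+ 2) / 2)).
Proof.
rewrite (gs_cos gH _ (spanned_limit_var a b e)); congr (_ * expR (- (_ / 2))).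
transitivity (Ex (fun w => limit_var a b e w * limit_var a b e w)).
  by apply: Ex_ext => w; rewrite expr2.
by rewrite limit_var_cov; ring.
Qed.

(** Closeness to a linear statistic that is pathwise on each event where the tightness variable is
    bounded, as the Slutsky step takes it. *)
Definition asymptotically_linear k (A B C : 'I_k -> R) (est : nat -> 'I_k -> T -> R) : Prop :=
  forall K, exists D : R, \forall n \near \oo, forall w, tight_seq n w <= K -> forall i,
    `|est n i w| <= D /\
    `|est n i w - lin_seq (A i) (B i) (C i) n w| <= D / Num.sqrt n%:R.

(** The limit vector has entries [limit_var (A i) (B i) (C i)], and its covariance is the Gram
    matrix of the coefficients with weights 2, 1, 2. *)
Lemma normal_limit k (A B C : 'I_k -> R) (est : nat -> 'I_k -> T -> R) (S : 'M[R]_k) :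
  (forall n i, measurable_fun setT (est n i)) -> asymptotically_linear A B C est ->
  (forall i j, S i j = 2 * (A i * A j) + B i * B j + 2 * (C i * C j)) ->
  cvg_to_normal P (fun n w => \col_i est n i w) S.
Proof.
move=> mest hest SE.
pose G i := limit_var (A i) (B i) (C i).
have hG i : spanned two_points (G i) by exact: spanned_limit_var.
have mG i : measurable_fun setT (G i) by exact: (gs_meas gH (hG i)).
pose Y i : {RV P >-> R} := mfun_Sub (mem_set (mG i)).
have iG i : integ (G i) by exact: (gs_integ gH (hG i)).
have EG i : ('E_P[Y i] = 0)%E.
  by rewrite -[LHS]/('E_P[G i])%E expectationE// (gs_mean gH (hG i)).
exists d, T, P, Y; split.
  split => [c||i j].
  - have hs : spanned two_points (fun w => \sum_i c i * G i w).
      rewrite (_ : (fun w => _) = limit_var (\sum_i c i * A i) (\sum_i c i * B i) (\sum_i c i * C i)).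
        exact: spanned_limit_var.
      by apply/funext => w; rewrite limit_var_sum.
    by have [_ [v v0 hv]] := gH.2 _ hs; exists 0, v.
  - exact: EG.
  - rewrite covariance.unlock !EG /=.
    have -> : ((Y i \- cst 0) * (Y j \- cst 0) = (fun w => G i w * G j w) :> (T -> R))%R.
      by apply/funext => w; rewrite fctE /= !subr0.
    rewrite expectationE; last exact: (gs_integM gH).
    by rewrite limit_var_cov SE.
apply: (@slutsky_distribution R d T P d T P k est (fun n i => lin_seq (A i) (B i) (C i) n)
  G tight_seq (fun w => \sum_i G i w ^+ 2) tight_const 'cV[R]_k (fun x => \col_i x i)) => //.
- exact: ball_emb_col.
- by move=> n i; exact: measurable_lin_seq.
- exact: tight_seq_ge0.
- exact: near_tight_seq.
- by apply: integ_sum => i; exact: (gs_integX gH 2 (hG i)).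
- by move=> w; apply: sumr_ge0 => i _; exact: sqr_ge0.
- move=> K; exists (1 + K) => w hw i.
  have h : G i w ^+ 2 <= K.
    apply: le_trans hw; rewrite (bigD1 i)//= lerDl sumr_ge0// => j _; exact: sqr_ge0.
  apply: (@le_trans _ _ (1 + G i w ^+ 2)); last by rewrite lerD2l.
  rewrite -[G i w ^+ 2]real_normK ?num_real//; have := normr_ge0 (G i w).
  by have := sqr_ge0 (`|G i w| - 1); move: `|G i w| => g; nra.
- move=> ph t.
  rewrite (_ : Ex (fun w => cos (ph + \sum_i t i * G i w)) =
    Ex (fun w => cos (ph + limit_var (\sum_i t i * A i) (\sum_i t i * B i) (\sum_i t i * C i) w))).
    rewrite limit_var_cf; under eq_fun => n do under Ex_ext => w do rewrite lin_seq_sum.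
    exact: lin_seq_cf.
  by apply: Ex_ext => w; rewrite limit_var_sum.
Qed.

Lemma normal_limit_real (a b e v : R) (est : nat -> T -> R) : 0 < v ->
  (forall n, measurable_fun setT (est n)) ->
  asymptotically_linear (fun=> a) (fun=> b) (fun=> e) (fun n (_ : 'I_1) => est n) ->
  v ^+ 2 = 2 * a ^+ 2 + b ^+ 2 + 2 * e ^+ 2 ->
  cvg_in_distribution P (normal_prob 0 v) est (fun x : R => x).
Proof.
move=> v0 mest hest vE.
apply: (@slutsky_distribution R d T P _ _ (normal_prob 0 v) 1 (fun n _ => est n)
  (fun n _ => lin_seq a b e n) (fun _ x => x) tight_seq (fun x => x ^+ 2) tight_const
  R (fun x => x ord0)) => //.
- exact: ball_emb_real.
- by move=> n i; exact: measurable_lin_seq.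
- exact: tight_seq_ge0.
- exact: near_tight_seq.
- apply: eq_integrable (integrable_power_normal 0 v0 2) => //= x _.
  by rewrite subr0.
- by move=> w; exact: sqr_ge0.
- move=> K; exists (1 + K) => x hx _.
  apply: (@le_trans _ _ (1 + x ^+ 2)); last by rewrite lerD2l.
  rewrite -[x ^+ 2]real_normK ?num_real//; have := normr_ge0 x.
  by have := sqr_ge0 (`|x| - 1); move: `|x| => g; nra.
- move=> ph t; rewrite (_ : Rintegral _ _ _ = cos ph * expR (- (t ord0 ^+ 2 * v ^+ 2 / 2))).
    rewrite (_ : t ord0 ^+ 2 * v ^+ 2 = 2 * (t ord0 * a) ^+ 2 + (t ord0 * b) ^+ 2 +
      2 * (t ord0 * e) ^+ 2); last by rewrite vE; ring.
    under eq_fun => n do under Ex_ext => w do rewrite lin_seq_sum !big_ord1.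
    exact: lin_seq_cf.
  rewrite -(normal_cos 0 v0); congr Rintegral; apply/funext => x.
  by rewrite big_ord1 subr0.
Qed.

(** Where the tightness variable is at most K, the means are bounded by h = 2 (K + 1) / sqrt n. Both
    errors, roughness / n and h^2, are then O(1/n), and O(1 / sqrt n) after scaling. *)
Lemma expansion_asymptotically_linear k (A B C : 'I_k -> R) (est : nat -> 'I_k -> T -> R) :
  (exists D h0 : R, 0 < h0 /\ forall m w h i, let sm := s m.+1 in
     h <= h0 -> `|meanX sm w| <= h -> `|meanW sm w| <= h -> `|meanY sm w| <= h ->
     `|est m.+1 i w - (A i * meanX sm w + B i * meanW sm w + C i * meanY sm w)| <=
       D * (rough_total sm (fun i u => Z i u w) / m.+1%:R + h ^+ 2)) ->
  asymptotically_linear A B C (fun n i w => Num.sqrt n%:R * est n i w).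
Proof.
move=> [D [h0 [h00 H]]] K.
pose K1 := 2 * (K + 1).
pose D1 := `|D| * (`|K| + K1 ^+ 2).
have D10 : 0 <= D1 by rewrite mulr_ge0// addr_ge0// sqr_ge0.
exists (D1 + \sum_i (`|A i| + `|B i| + `|C i|) * `|K1|).
have main n : (0 < n)%N -> K1 / Num.sqrt n%:R <= h0 -> forall w, tight_seq n w <= K -> forall i,
    `|Num.sqrt n%:R * est n i w - lin_seq (A i) (B i) (C i) n w| <= D1 / Num.sqrt n%:R /\
    `|lin_seq (A i) (B i) (C i) n w| <= (`|A i| + `|B i| + `|C i|) * `|K1|.
  case: n => // m _ hK w /(tight_bounds (ds m))[r1 x1 w1 y1] i.
  set N : R := m.+1%:R in hK x1 w1 y1 *.
  have N0 : 0 < N by rewrite ltr0n.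
  have q0 : 0 < Num.sqrt N by rewrite sqrtr_gt0.
  have qE : Num.sqrt N ^+ 2 = N by rewrite sqr_sqrtr// ltW.
  have sc x : `|Num.sqrt N * x| <= K1 -> `|x| <= K1 / Num.sqrt N.
    by rewrite normrM (gtr0_norm q0) ler_pdivlMr// mulrC.
  have := H m w _ i hK (sc _ x1) (sc _ w1) (sc _ y1).
  rewrite /lin_seq /at_size -/N -mulrBr normrM (gtr0_norm q0) => hh; split.
    apply: (le_trans (ler_wpM2l (ltW q0) hh)).
    rewrite (_ : D1 / _ = Num.sqrt N * (`|D| * (`|K| / N + (K1 / Num.sqrt N) ^+ 2))); last first.
      by rewrite /D1; move: (Num.sqrt N) q0 qE => v v0 <-; field; rewrite gt_eqF.
    apply: ler_wpM2l; first exact: ltW.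
    have q1 : 0 <= rough_total (s m.+1) (fun i u => Z i u w) / N + (K1 / Num.sqrt N) ^+ 2.
      apply: addr_ge0 (sqr_ge0 _); apply: divr_ge0 (ltW N0).
      exact: (rough_total_ge0 (ds m)).
    apply: (le_trans (ler_wpM2r q1 (ler_norm D))).
    apply: ler_wpM2l => //; rewrite lerD2r; apply: ler_wpM2r; first by rewrite invr_ge0 ltW.
    exact: le_trans r1 (ler_norm K).
  have bd x y : `|Num.sqrt N * y| <= K1 -> `|Num.sqrt N * (x * y)| <= `|x| * `|K1|.
    by move=> hy; rewrite mulrCA normrM ler_wpM2l// (le_trans hy)// ler_norm.
  rewrite 2!mulrDr [leRHS]mulrDl; apply: (le_trans (ler_normD _ _)).
  apply: lerD; last exact: bd.
  by rewrite mulrDl; apply: (le_trans (ler_normD _ _)); apply: lerD; exact: bd.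
near=> n.
have n0 : (0 < n)%N by near: n; exact: nbhs_infty_gt.
have n1 : 1 <= Num.sqrt n%:R :> R by near: n; exact: near_sqrt_nat_ge.
have hK : K1 / Num.sqrt n%:R <= h0 by near: n; exact: near_div_sqrt_nat_le.
move=> w hw i; have [h1 h2] := main n n0 hK w hw i.
have n2 : 0 < Num.sqrt n%:R :> R by exact: lt_le_trans n1.
have Si : (`|A i| + `|B i| + `|C i|) * `|K1| <= \sum_i (`|A i| + `|B i| + `|C i|) * `|K1|.
  by rewrite (bigD1 i)//= lerDl sumr_ge0// => j _; rewrite mulr_ge0// !addr_ge0.
have S0 : 0 <= \sum_i (`|A i| + `|B i| + `|C i|) * `|K1|.
  by apply: sumr_ge0 => j _; rewrite mulr_ge0// !addr_ge0.
split.
  rewrite -(subrK (lin_seq (A i) (B i) (C i) n w) (_ * _)).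
  apply: (le_trans (ler_normD _ _)); apply: lerD; last exact: le_trans h2 Si.
  apply: (le_trans h1); rewrite ler_pdivrMr// ler_peMr//.
apply: (le_trans h1); rewrite ler_wpM2r ?invr_ge0 ?(ltW n2)//.
by rewrite lerDl.
Unshelve. all: by end_near. Qed.

End limits.
End model_space.

(** * The three limit laws *)

Theorem theorem4p2 (R : realType) (d : measure_display)
    (T : measurableType d) (P : probability T R)
    (Z : 'I_2 -> R -> {RV P >-> R}) (psi0 a b : param R)
    (s : forall n : nat, 'I_n -> R) (psihat : nat -> T -> param R) :
  has_law Z psi0 ->
  dense_design s ->
  0 < theta a ->
  (forall i : 'I_2, 0 < sigma2 a i) ->
  -1 < rho a ->
  rho b < 1 ->
  in_box a b psi0 ->
  is_ml_estimator a b s (fun w i x => Z i x w) psihat ->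
  measurable_estimator psihat ->
  let th0 := theta psi0 in
  let r0 := rho psi0 in
  let s01 := sigma psi0 0 in
  let s02 := sigma psi0 1 in
  let known_sigma2 := forall i : 'I_2,
    known (sigma2 a i) (sigma2 b i) (sigma2 psi0 i)
      (fun n w => sigma2 (psihat n w) i) in
  let known_rho := known (rho a) (rho b) (rho psi0)
      (fun n w => rho (psihat n w)) in
  [/\ known_sigma2 -> known_rho ->
      theta a < theta psi0 < theta b ->
      cvg_in_distribution P (normal_prob 0 th0)
        (fun n w => Num.sqrt n%:R * (theta (psihat n w) - th0))
        (fun x : R => x),
      known_sigma2 ->
      rho a < rho psi0 < rho b ->
      theta a < theta psi0 < theta b ->
      cvg_to_normal P
        (fun n w => Num.sqrt n%:R *: col_of 2
           [:: theta (psihat n w) - th0;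
               rho (psihat n w) - r0])
        (mx_of_rows 2
           [:: [:: th0 ^+ 2 * (1 + r0 ^+ 2); th0 * r0 * (1 - r0 ^+ 2)];
               [:: th0 * r0 * (1 - r0 ^+ 2); (r0 ^+ 2 - 1) ^+ 2]])
    & (forall i : 'I_2, sigma2 a i < sigma2 psi0 i < sigma2 b i) ->
      rho a < rho psi0 < rho b ->
      theta a < theta psi0 < theta b ->
      cvg_to_normal P
        (fun n w => Num.sqrt n%:R *: col_of 3
           [:: sigma2 (psihat n w) 0 * theta (psihat n w)
                 - sigma2 psi0 0 * th0;
               sigma2 (psihat n w) 1 * theta (psihat n w)
                 - sigma2 psi0 1 * th0;
               rho (psihat n w) - r0])
        (mx_of_rows 3
           [:: [:: 2 * (th0 * s01 ^+ 2) ^+ 2;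
                   2 * (th0 * r0 * s01 * s02) ^+ 2;
                   th0 * r0 * s01 ^+ 2 * (1 - r0 ^+ 2)];
               [:: 2 * (th0 * r0 * s01 * s02) ^+ 2;
                   2 * (th0 * s02 ^+ 2) ^+ 2;
                   th0 * r0 * s02 ^+ 2 * (1 - r0 ^+ 2)];
               [:: th0 * r0 * s01 ^+ 2 * (1 - r0 ^+ 2);
                   th0 * r0 * s02 ^+ 2 * (1 - r0 ^+ 2);
                   (r0 ^+ 2 - 1) ^+ 2]])].
Proof.
move=> lawZ [s01 sinc _] ta0 sa0 ra rb bx0 mle mest th0 r0 s1 s2 ksig krho.
have [lo [hi [_ cb]]] := box_coord_bounds ta0 sa0 ra rb bx0.
have [vp0 _ _ _ _] := cb _ bx0; have [th0_gt0 s20 r01] := vp0.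
pose c := Num.sqrt (1 - rho psi0 ^+ 2).
have cE : c ^+ 2 = 1 - rho psi0 ^+ 2 by rewrite sqr_sqrtr//; nra.
have ss i : sigma psi0 i ^+ 2 = sigma2 psi0 i by exact: sigma_sqr.
have ds m : design (@s m.+1) by split; [exact: sinc|exact: s01].
have mn m w : minimizes a b (@s m.+1) (fun i x => Z i x w) (psihat m.+1 w) by exact: mle.
have ex m w := sample_expanded Z vp0 (ds m) w.
have rt0 m w := rough_total_ge0 (ds m) (fun i u => Z i u w).
have DB (C D x h : R) : 0 <= x -> 0 <= D -> C * x + D * h ^+ 2 <= (`|C| + D) * (x + h ^+ 2).
  move=> x0 D0; have := ler_wpM2r x0 (ler_norm C); have := mulr_ge0 (normr_ge0 C) (sqr_ge0 h).
  have := mulr_ge0 D0 x0; lra.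
have msqrt n (f : T -> R) (x : R) : measurable_fun setT f ->
    measurable_fun setT (fun w => Num.sqrt n%:R * (f w - x)).
  by move=> mf; apply: measurable_funM => //; exact: measurable_funB.
(* The W coefficients all carry the factor c = sqrt(1 - rho_0^2); in covariances only c^2 occurs,
   which makes them polynomial in rho_0. *)
have BB (x y u v : R) : u + c * x * (c * y) + v = u + (1 - r0 ^+ 2) * (x * y) + v.
  by rewrite mulrACA -expr2 cE.
have c3lin (X W Y : R) : rho_lin r0 c X W Y =
    r0 * (1 - r0 ^+ 2) / 2 * X + c * (1 - r0 ^+ 2) * W + - (r0 * (1 - r0 ^+ 2) / 2) * Y.
  rewrite /rho_lin (_ : c ^+ 3 = c * c ^+ 2); last by ring.
  by rewrite cE -/r0; ring.
split.
- move=> ks [_ _ kr] gth.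
  have [C [h0 [h00 hC]]] := known_sigma_rho_close ta0 sa0 ra rb bx0 cE gth.
  (* The fitted theta is th0 + th0 (X + Y) / 2, of limiting variance 4 (th0 / 2)^2 = th0^2. *)
  apply: (normal_limit_real lawZ vp0 ds (a := th0 / 2) (b := 0) (e := th0 / 2)) => //.
  + by move=> n; apply: msqrt; have [] := mest n.
  + apply: (expansion_asymptotically_linear ds
      (est := fun n _ w => theta (psihat n w) - th0)).
    exists `|C|, h0; split => // m w h _ sm hh hX hW hY.
    have ks' i : sigma2 (psihat m.+1 w) i = sigma2 psi0 i by have [_ _ h1] := ks i; rewrite (h1 m.+1 w).
    have := hC m sm _ _ _ _ _ (ds m) (mn m w) ks' (esym (kr _ _)) (ex m w)
      (le_trans hX hh) (le_trans hY hh).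
    rewrite -/th0 (_ : _ - th0 - _ = theta (psihat m.+1 w) -
      th0 * (1 + (meanX Z psi0 sm w + meanY Z psi0 sm w) / 2)); last by field.
    move=> h1; apply: (le_trans h1); rewrite -mulrA -[`|C|]addr0.
    by apply: le_trans (DB _ _ _ h _ (lexx 0)); rewrite ?mul0r ?addr0// divr_ge0.
  + by field.
- move=> ks gr gth.
  have [C [h0 [h00 hC]]] := known_sigma_only_close ta0 sa0 ra rb bx0 cE gth gr.
  (* Coefficients of X, W and Y in th0 ([mean2] - 1) and in [rho_lin]; the former is exactly
     linear. *)
  pose A (i : 'I_2) := [:: th0 * (1 + r0 ^+ 2) / 2; r0 * (1 - r0 ^+ 2) / 2]`_i.
  pose B (i : 'I_2) := c * [:: th0 * r0; 1 - r0 ^+ 2]`_i.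
  pose E (i : 'I_2) := [:: th0 * (1 - r0 ^+ 2) / 2; - (r0 * (1 - r0 ^+ 2) / 2)]`_i.
  rewrite (_ : (fun n w => _) = (fun n w => \col_i (Num.sqrt n%:R *
      [:: theta (psihat n w) - th0; rho (psihat n w) - r0]`_i))); last first.
    by apply/funext => n; apply/funext => w; apply/colP => i; rewrite !mxE.
  apply: (normal_limit lawZ vp0 ds (A := A) (B := B) (C := E)).
  + move=> n; have [m1 _ m2] := mest n.
    by elim/ord2_ind => /=; exact: msqrt.
  + apply: (expansion_asymptotically_linear ds (est := fun n i w =>
      [:: theta (psihat n w) - th0; rho (psihat n w) - r0]`_i)).
    exists (`|C| + 20), (Num.min h0 16^-1); split; first by rewrite lt_min h00 invr_gt0 ltr0n.
    move=> m w h i sm; rewrite le_min => /andP[hh h16] hX hW hY.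
    have ks' j : sigma2 (psihat m.+1 w) j = sigma2 psi0 j by have [_ _ h1] := ks j; rewrite (h1 m.+1 w).
    have [h1 h2] := hC m sm _ _ _ _ _ (ds m) (mn m w) ks' (ex m w)
      (le_trans hX hh) (le_trans hW hh) (le_trans hY hh).
    have h3 := rho_linearization cE h16 hX hW hY.
    rewrite -(mulrA C) in h1 h2.
    have x0 : 0 <= rough_total sm (fun i u => Z i u w) / m.+1%:R by rewrite divr_ge0.
    apply: le_trans (DB C 20 _ h x0 (ler0n _ 20)).
    elim/ord2_ind: i => /=; rewrite /A /B /E /=.
      apply: ler_wpDr; first by rewrite mulr_ge0// sqr_ge0.
      rewrite [X in `|X|](_ : _ = theta (psihat m.+1 w) - th0 * mean2 r0 c (meanX Z psi0 sm w)
        (meanW Z psi0 sm w) (meanY Z psi0 sm w)) //.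
      by rewrite /mean2 /second cE -/r0; field.
    apply: le_trans (lerD h2 h3); apply: le_trans (ler_normD _ _).
    rewrite le_eqVlt; apply/orP; left; apply/eqP; congr `|_|.
    by rewrite -/r0 -/sm c3lin; ring.
  + move=> i j; rewrite BB mxE /A /E.
    by elim/ord2_ind: i; elim/ord2_ind: j => /=; rewrite -/th0 -/r0; field.
- move=> gs gr gth.
  have [C [h0 [h00 hC]]] := free_sigma_close ta0 sa0 ra rb bx0 cE gth gr gs.
  (* Coefficients of X, W and Y in th0 s1^2 X, th0 s2^2 [second] and [rho_lin]; only the last is a
     linearization. *)
  pose A (i : 'I_3) := [:: th0 * s1 ^+ 2; th0 * s2 ^+ 2 * r0 ^+ 2; r0 * (1 - r0 ^+ 2) / 2]`_i.
  pose B (i : 'I_3) := c * [:: 0; 2 * th0 * s2 ^+ 2 * r0; 1 - r0 ^+ 2]`_i.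
  pose E (i : 'I_3) := [:: 0; th0 * s2 ^+ 2 * (1 - r0 ^+ 2); - (r0 * (1 - r0 ^+ 2) / 2)]`_i.
  pose est n (i : 'I_3) w := [:: sigma2 (psihat n w) 0 * theta (psihat n w) - sigma2 psi0 0 * th0;
    sigma2 (psihat n w) 1 * theta (psihat n w) - sigma2 psi0 1 * th0; rho (psihat n w) - r0]`_i.
  rewrite (_ : (fun n w => _) = (fun n w => \col_i (Num.sqrt n%:R * est n i w))); last first.
    by apply/funext => n; apply/funext => w; apply/colP => i; rewrite !mxE.
  apply: (normal_limit lawZ vp0 ds (A := A) (B := B) (C := E)).
  + move=> n; have [m1 m2 m3] := mest n.
    by case=> [[|[|[|//]]] ?]; rewrite /est /=; apply: msqrt => //; exact: measurable_funM.
  + apply: (expansion_asymptotically_linear ds (est := est)).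
    exists (`|C| + 60), (Num.min h0 16^-1); split; first by rewrite lt_min h00 invr_gt0 ltr0n.
    move=> m w h i sm; rewrite le_min => /andP[hh h16] hX hW hY.
    have [h1 h2 h3] := hC m sm _ _ _ _ _ (ds m) (mn m w) (ex m w)
      (le_trans hX hh) (le_trans hW hh) (le_trans hY hh).
    have h4 := rho_sqrt_linearization cE h16 hX hW hY.
    rewrite -(mulrA C) in h1 h2 h3.
    have x0 : 0 <= rough_total sm (fun i u => Z i u w) / m.+1%:R by rewrite divr_ge0.
    apply: le_trans (DB C 60 _ h x0 (ler0n _ 60)).
    have hq : 0 <= 60 * h ^+ 2 by rewrite mulr_ge0// sqr_ge0.
    case: i => [[|[|[|//]]] ?]; rewrite /est /A /B /E /=.
    * apply: ler_wpDr => //; rewrite [X in `|X|](_ : _ = theta (psihat m.+1 w) * sigma2 (psihat m.+1 w) 0 -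
        th0 * sigma2 psi0 0 * (1 + meanX Z psi0 sm w))//.
      by rewrite -ss -/s1; ring.
    * apply: ler_wpDr => //; rewrite [X in `|X|](_ : _ = theta (psihat m.+1 w) * sigma2 (psihat m.+1 w) 1 -
        th0 * sigma2 psi0 1 * (1 + second r0 c (meanX Z psi0 sm w) (meanW Z psi0 sm w) (meanY Z psi0 sm w)))//.
      by rewrite -ss -/s2 /second cE -/r0; ring.
    apply: le_trans (lerD h3 h4); apply: le_trans (ler_normD _ _).
    rewrite le_eqVlt; apply/orP; left; apply/eqP; congr `|_|.
    by rewrite -/r0 -/sm c3lin; ring.
  + move=> i j; rewrite BB mxE /A /E.
    by case: i => [[|[|[|//]]] ?]; case: j => [[|[|[|//]]] ?] /=; field.
Qed.
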